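(* Let $b=b(x,y)$ be a function on $\mathbb R^2$ and let $\mathbf T=T\otimes T$, where $T$ is the dyadic shift given by $Th_I=h_{I_+}-h_{I_-}$ if $I$ is even and $Th_I=0$ otherwise. Then the commutator $[\mathbf T,b]=\mathbf T b-b\mathbf T$, that is, $f\mapsto \mathbf T(bf)-b\,\mathbf Tf$, is $L^2$-bounded if and only if $b\in bmo^d$ (dyadic little $bmo$).
   Context: $\mathcal D$ is the usual dyadic lattice on $\mathbb R$. For $I\in\mathcal D$, $I_+$ and $I_-$ are the two dyadic children (halves) of $I$, and $h_I=|I|^{-1/2}(\mathbf 1_{I_+}-\mathbf 1_{I_-})$ is the Haar function of $I$. An interval $I\in\mathcal D$ is called even if $|I|=2^{-2k}$ for some integer $k$, and odd otherwise. $T$ is the linear operator on $L^2(\mathbb R)$ determined by $Th_I=h_{I_+}-h_{I_-}$ for $I$ even and $Th_I=0$ for $I$ odd. $\mathbf T=T\otimes T$ acts on functions on $\mathbb R^2$ with one copy of $T$ acting in the variable $x$ and the other in the variable $y$, so that $\mathbf T(h_I\otimes h_J)=(Th_I)\otimes(Th_J)$ for $I,J\in\mathcal D$, where $(f\otimes g)(x,y)=f(x)g(y)$. In the commutator, $b$ stands for the operator of multiplication by $b$, and $L^2$ means $L^2(\mathbb R^2)$. Dyadic rectangles are the sets $R=I\times J$ with $I,J\in\mathcal D$; their family is $\mathcal D^2=\mathcal D\times\mathcal D$, and $\langle b\rangle_R=\frac1{|R|}\int_R b$. The space $bmo^d$ consists of those $b$ for which $$\|b\|_{bmo^d}:=\sup_{R\in\mathcal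 D^2}\frac1{|R|}\int_R|b(x,y)-\langle b\rangle_R|^2\,d(x,y)<\infty .$$ *)

(* Defs.v *)
From HB Require Import structures.
From mathcomp Require Import all_boot all_order all_algebra.
From mathcomp Require Import all_classical all_reals all_analysis.

Set Implicit Arguments.
Unset Strict Implicit.
Unset Printing Implicit Defensive.
Import Order.TTheory GRing.Theory Num.Theory.
Import numFieldNormedType.Exports.

Local Open Scope classical_set_scope.
Local Open Scope ring_scope.

(* Both carry their Borel sigma-algebra. *)
Definition line (R : realType) := measurableTypeR R.
Definition plane (R : realType) := (measurableTypeR R * measurableTypeR R)%type.
Definition mu1 (R : realType) : {measure set (line R) -> \bar R} :=
  @lebesgue_measure R.
Definition mu2 (R : realType) : {measure set (plane R) -> \bar R} :=
  (@lebesgue_measure R \x @lebesgue_measure R)%E.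

(* [Dyadic k m] stands for the interval [m 2^-k, (m+1) 2^-k). *)
Record dyadic := Dyadic { scale : int ; pos : int }.

Definition right_half (I : dyadic) := Dyadic (scale I + 1) (2 * pos I + 1).
Definition left_half (I : dyadic) := Dyadic (scale I + 1) (2 * pos I).

Section DyadicIntervals.
Context (R : realType).

Definition len (I : dyadic) : R := 2 ^ (- scale I).

Definition itv (I : dyadic) : set (line R) :=
  `[ (pos I)%:~R * len I, (pos I + 1)%:~R * len I [%classic.

Definition dyadic_even (I : dyadic) : Prop :=
  exists k : int, len I = 2 ^ (- (2 * k)).

(* I_+ is the right half and I_- the left half. *)
Definition haar (I : dyadic) : line R -> R := fun x =>
  (Num.sqrt (len I))^-1
  * (\1_(itv (right_half I)) x - \1_(itv (left_half I)) x).

Definition tensor (f g : line R -> R) : plane R -> R :=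
  fun z => f z.1 * g z.2.

End DyadicIntervals.
Arguments len : clear implicits.
Arguments itv : clear implicits.
Arguments haar : clear implicits.
Arguments dyadic_even : clear implicits.

Section L2.
Context d (X : measurableType d) (R : realType).
Variable mu : {measure set X -> \bar R}.

Definition norm2 (f : X -> R) : \bar R := ('N[mu]_2%:E[EFin \o f])%E.

(* A bounded linear operator on L^2(mu), given on representatives.  The values
   of T off L^2 are irrelevant; linearity and boundedness make T compatible
   with a.e. equality. *)
Definition L2_operator (T : (X -> R) -> (X -> R)) : Prop :=
  [/\ (forall f, f \in Lfun mu 2%:E -> T f \in Lfun mu 2%:E),
      (forall (a : R) f g, f \in Lfun mu 2%:E -> g \in Lfun mu 2%:E ->
         ae_eq mu setT (T (a \*: f + g)) (a \*: T f + T g))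
    & (exists C : R, forall f, f \in Lfun mu 2%:E ->
         (norm2 (T f) <= C%:E * norm2 f)%E)].

End L2.

Section Shift.
Context (R : realType).

(* Determines T up to a.e. equality, as finite linear combinations of the h_I
   are dense in L^2. *)
Definition dyadic_shift (T : (line R -> R) -> (line R -> R)) : Prop :=
  [/\ L2_operator (mu1 R) T,
      (forall I, dyadic_even R I ->
         ae_eq (mu1 R) setT (T (haar R I))
           (haar R (right_half I) \- haar R (left_half I)))
    & (forall I, ~ dyadic_even R I ->
         ae_eq (mu1 R) setT (T (haar R I)) (cst 0))].

(* TT is T (x) T; it is determined by T up to a.e. equality. *)
Definition tensor_square (T : (line R -> R) -> (line R -> R))
    (TT : (plane R -> R) -> (plane R -> R)) : Prop :=
  L2_operator (mu2 R) TT /\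
  (forall f g, f \in Lfun (mu1 R) 2%:E -> g \in Lfun (mu1 R) 2%:E ->
     ae_eq (mu2 R) setT (TT (tensor f g)) (tensor (T f) (T g))).

Definition commutator (TT : (plane R -> R) -> (plane R -> R))
    (b f : plane R -> R) : plane R -> R :=
  TT (b \* f) \- b \* TT f.

(* As b may be unbounded, the commutator is an operator with domain
   {f in L^2 | b f in L^2}.  It is required to be densely defined, in the sense
   that it makes sense on all h_I (x) h_J (equivalently, b is square integrable
   on every dyadic rectangle), and to be bounded on its domain. *)
Definition commutator_L2_bounded (TT : (plane R -> R) -> (plane R -> R))
    (b : plane R -> R) : Prop :=
  (forall I J : dyadic,
     b \* tensor (haar R I) (haar R J) \in Lfun (mu2 R) 2%:E) /\
  (exists C : R, forall f,
     f \in Lfun (mu2 R) 2%:E -> b \* f \in Lfun (mu2 R) 2%:E ->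
     (norm2 (mu2 R) (commutator TT b f) <= C%:E * norm2 (mu2 R) f)%E).

Definition rect (Q : dyadic * dyadic) : set (plane R) :=
  itv R Q.1 `*` itv R Q.2.

Definition area (Q : dyadic * dyadic) : R := len R Q.1 * len R Q.2.

Definition mean (b : plane R -> R) (Q : dyadic * dyadic) : R :=
  (area Q)^-1 * \int[mu2 R]_(z in rect Q) b z.

Definition bmod_norm (b : plane R -> R) : \bar R :=
  ereal_sup [set ((area Q)^-1%:E
                  * \int[mu2 R]_(z in rect Q) (`|b z - mean b Q| ^+ 2)%:E)%E
            | Q in [set: dyadic * dyadic]].

(* For measurable b a finite supremum forces b to be square integrable on
   every dyadic rectangle, whatever real value the library gives to [mean] when
   b is not integrable, so local integrability need not be required apart. *)
Definition bmod (b : plane R -> R) : Prop := (bmod_norm b < +oo)%E.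

End Shift.

(* Main.v *)
(** The bound on the commutator and the bmo norm are compared by testing on Haar
    functions.

    Sufficiency.  Polarized against a second Haar polynomial g, the commutator
    becomes the integral of b (f T1* T2* g - T1 T2 f g), which splits as
    b (f T1* (T2* g) - T1 f (T2* g)) + b (T1 f (T2* g) - T2 (T1 f) g), and in each
    bracket one variable is a mere parameter.  In one variable, expanding the
    integral of a triple product of martingales produces four paraproducts with
    symbol b, bounded by the Carleson embedding theorem, and the diagonal terms
    <b>_K (f_K G_K - F_K g_K), which regroup, up to sign, into
    f_K (<b>_K - <b>_K') g_K' over the children K' of K since F = T f and G = T* g.
    The bound then passes from Haar polynomials to the whole domain of the
    commutator because they are dense in L^2((1 + b^2) dz): the mass of b^2
    grows by a factor less than 4 when a side of a rectangle is doubled.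

    Necessity.  Let A be a dyadic interval, K its even parent or grandparent, and L
    the child of K not containing A.  For f of mean zero supported in A x A', TT f
    vanishes on L x L', while TT (b f) has coefficient
    +-(|K| |K'|)^(-1/2) int b f on h_L (x) h_L'.  So the commutator bounds
    int b f by |A x A'|^(1/2) |f|_2, and duality gives the oscillation of b on
    A x A'. *)

From HB Require Import structures.
Require Import Defs.
From mathcomp Require Import all_boot all_order all_algebra.
From mathcomp Require Import all_classical all_reals all_analysis.
From mathcomp Require Import measurable_realfun.
From mathcomp Require Import ring lra zify.

Set Implicit Arguments.
Unset Strict Implicit.
Unset Printing Implicit Defensive.
Import Order.TTheory GRing.Theory Num.Theory.
Import numFieldNormedType.Exports.
Local Open Scope classical_set_scope.
Local Open Scope ring_scope.

(** * Martingales on the dyadic tree *)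

Section Trees.
Context (R : realType).
Implicit Types (u v b f g : dyadic -> R) (K : dyadic) (n : nat).

(** The oscillation of $b$ is used in one variable at a time. This uniformity is what little bmo
    provides, and it avoids genuinely two-parameter paraproducts. The means themselves are
    unbounded, so the two diagonal sums can be estimated only after their difference is formed.
    Bilinear bounds have the form $C(\|f\|^2+\|g\|^2)$: they add up over cells and quadrants without
    square roots, and rescaling $g$ restores the operator bound. The number 4 in the density
    argument comes from telescoping: up to Haar functions $1_I$ is $2^{-k}$ times the indicator of
    its $k$-th ancestor, so the squared norm of the remainder is $4^{-k}$ times the mass of $1+b^2$
    there. In the lower bound $f$ has mean zero on the rectangle but not in each variable, so a
    factor $T1_A$ may leak out of $A$; the other factor is then some $Th_J$ with $J\subset A'$,
    which stays in $A'$. *)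

Fixpoint leaf_avg n u K : R :=
  if n is n'.+1 then
    (leaf_avg n' u (right_half K) + leaf_avg n' u (left_half K)) / 2
  else u K.

(** The Carleson sum $\frac1{|K|}\sum_{L\subset K}|L|\,u_L$ over generations $0,\dots,n-1$ below
    [K]; the generation on which [leaf_avg n] averages is the first one left out. *)
Fixpoint tree_sum n u K : R :=
  if n is n'.+1 then
    u K + (tree_sum n' u (right_half K) + tree_sum n' u (left_half K)) / 2
  else 0.

Definition martingale u :=
  forall K, u K = (u (right_half K) + u (left_half K)) / 2.

Definition incr u K : R := (u (right_half K) - u (left_half K)) / 2.

Lemma martingale_right u K : martingale u -> u (right_half K) = u K + incr u K.
Proof. by move=> /(_ K) ->; rewrite /incr; field. Qed.

Lemma martingale_left u K : martingale u -> u (left_half K) = u K - incr u K.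
Proof. by move=> /(_ K) ->; rewrite /incr; field. Qed.

Lemma eq_leaf_avg n u v K : u =1 v -> leaf_avg n u K = leaf_avg n v K.
Proof. by move=> uv; elim: n K => [|n IH] K //=; rewrite !IH. Qed.

Lemma eq_tree_sum n u v K : u =1 v -> tree_sum n u K = tree_sum n v K.
Proof. by move=> uv; elim: n K => [|n IH] K //=; rewrite !IH uv. Qed.

Lemma leaf_avg_le n u v K : (forall L, u L <= v L) ->
  leaf_avg n u K <= leaf_avg n v K.
Proof.
move=> uv; elim: n K => [|n IH] K //=.
by have := IH (right_half K); have := IH (left_half K); lra.
Qed.

Lemma tree_sum_le n u v K : (forall L, u L <= v L) ->
  tree_sum n u K <= tree_sum n v K.
Proof.
move=> uv; elim: n K => [|n IH] K //=.
by have := IH (right_half K); have := IH (left_half K); have := uv K; lra.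
Qed.

Lemma tree_sumD n u v K :
  tree_sum n (fun L => u L + v L) K = tree_sum n u K + tree_sum n v K.
Proof. by elim: n K => [|n IH] K /=; [rewrite addr0|rewrite !IH; field]. Qed.

Lemma tree_sumZ n (c : R) u K :
  tree_sum n (fun L => c * u L) K = c * tree_sum n u K.
Proof. by elim: n K => [|n IH] K /=; [rewrite mulr0|rewrite !IH; field]. Qed.

Lemma leaf_avgD n u v K :
  leaf_avg n (fun L => u L + v L) K = leaf_avg n u K + leaf_avg n v K.
Proof. by elim: n K => [|n IH] K //=; rewrite !IH; field. Qed.

Lemma leaf_avgZ n (c : R) u K :
  leaf_avg n (fun L => c * u L) K = c * leaf_avg n u K.
Proof. by elim: n K => [|n IH] K //=; rewrite !IH; field. Qed.

Lemma leaf_avg0 n K : leaf_avg n (fun=> 0) K = 0.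
Proof. by elim: n K => [|n IH] K //=; rewrite !IH addr0 mul0r. Qed.

Lemma leaf_avg_ge0 n u K : (forall L, 0 <= u L) -> 0 <= leaf_avg n u K.
Proof. by move=> u0; rewrite -(leaf_avg0 n K); exact: leaf_avg_le. Qed.

Lemma tree_sum_ge0 n u K : (forall L, 0 <= u L) -> 0 <= tree_sum n u K.
Proof.
move=> u0; elim: n K => [|n IH] K //=.
by have := IH (right_half K); have := IH (left_half K); have := u0 K; lra.
Qed.

Lemma tree_sum_norm n u K : `|tree_sum n u K| <= tree_sum n (fun L => `|u L|) K.
Proof.
rewrite ler_norml -mulN1r -tree_sumZ; apply/andP; split; apply: tree_sum_le => L.
  by rewrite mulN1r lerNl -normrN ler_norm.
exact: ler_norm.
Qed.

Lemma leaf_avg_norm n u K : `|leaf_avg n u K| <= leaf_avg n (fun L => `|u L|) K.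
Proof.
rewrite ler_norml -mulN1r -leaf_avgZ; apply/andP; split; apply: leaf_avg_le => L.
  by rewrite mulN1r lerNl -normrN ler_norm.
exact: ler_norm.
Qed.

(** Indexes all intervals but the root by their parents, which allows a sum over children to be
    compared term by term with a sum over parents. *)
Lemma tree_sum_root n u K :
  tree_sum n.+1 u K =
  u K + tree_sum n (fun L => (u (right_half L) + u (left_half L)) / 2) K.
Proof.
elim: n K => [|n IH] K; first by rewrite /=; field.
have -> : tree_sum n.+2 u K = u K +
  (tree_sum n.+1 u (right_half K) + tree_sum n.+1 u (left_half K)) / 2 by [].
by rewrite !IH /=; field.
Qed.

Lemma tree_sum_leaf n u K : tree_sum n.+1 u K = tree_sum n u K + leaf_avg n u K.
Proof.
elim: n K => [|n IH] K; first by rewrite /=; field.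
have -> : tree_sum n.+2 u K = u K +
  (tree_sum n.+1 u (right_half K) + tree_sum n.+1 u (left_half K)) / 2 by [].
by rewrite (IH (right_half K)) (IH (left_half K)) /=; field.
Qed.

Lemma leaf_avg_eq0 n u K :
  (forall L, scale L = scale K + n%:Z -> u L = 0) -> leaf_avg n u K = 0.
Proof.
elim: n K => [|n IH] K u0 /=; first by apply: u0; rewrite addr0.
rewrite !IH ?addr0 ?mul0r// => L sL; apply: u0; rewrite sL /= -addrA;
  congr (_ + _); rewrite -natz; lia.
Qed.

Lemma leaf_avg_exchange n m (u : dyadic -> dyadic -> R) K L :
  leaf_avg n (fun K' => leaf_avg m (u K') L) K =
  leaf_avg m (fun L' => leaf_avg n (u^~ L') K) L.
Proof.
elim: n K => [|n IH] K //=; rewrite !IH -leaf_avgD.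
by rewrite mulrC -leaf_avgZ; apply: eq_leaf_avg => L'; rewrite mulrC.
Qed.

(* The term cubic in the increments has opposite signs on the two children, so
   it averages out. *)
Lemma trilinear n b f g K : martingale b -> martingale f -> martingale g ->
  leaf_avg n (fun L => b L * f L * g L) K = b K * f K * g K +
  tree_sum n (fun L => b L * (incr f L * incr g L)
    + (incr b L * f L * incr g L + incr b L * g L * incr f L)) K.
Proof.
move=> mb mf mg; elim: n K => [|n IH] K /=; first by rewrite addr0.
rewrite !IH !(martingale_right _ mb) !(martingale_left _ mb).
rewrite !(martingale_right _ mf) !(martingale_left _ mf).
rewrite !(martingale_right _ mg) !(martingale_left _ mg).
by field.
Qed.

(** Parseval on the finite tree: the cross terms $\pm2f_K\,\mathrm{incr}f_K$ of the two children
    cancel. *)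
Lemma leaf_avg_sqr n f K : martingale f ->
  leaf_avg n (fun L => f L ^+ 2) K =
  f K ^+ 2 + tree_sum n (fun L => incr f L ^+ 2) K.
Proof.
move=> mf; elim: n K => [|n IH] K /=; first by rewrite addr0.
by rewrite !IH !(martingale_right _ mf) !(martingale_left _ mf); field.
Qed.

(** Midpoint convexity of the perspective function $(x,a)\mapsto x^2/a$: the difference of the two
    sides is a square over a positive denominator. *)
Lemma convex_sqr_div (x y a c : R) : 0 < a -> 0 < c ->
  ((x + y) / 2) ^+ 2 / ((a + c) / 2) <= (x ^+ 2 / a + y ^+ 2 / c) / 2.
Proof.
move=> a0 c0; rewrite -subr_ge0.
have -> : (x ^+ 2 / a + y ^+ 2 / c) / 2 - ((x + y) / 2) ^+ 2 / ((a + c) / 2) =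
  (c * x - a * y) ^+ 2 / (2 * a * c * (a + c)).
  by field; rewrite !gt_eqF//; lra.
by rewrite divr_ge0 ?sqr_ge0// !mulr_ge0//; lra.
Qed.

(** * Carleson embedding and paraproducts *)

Section Carleson.
Variables (b : dyadic -> R) (be : R).
Hypothesis be0 : 0 < be.
Hypothesis b_carleson :
  forall n K, tree_sum n (fun L => incr b L ^+ 2) K <= be.

(* For be = 1 this is the Bellman function F, x, A |-> 4 (F - x^2 / (1 + A)) of
   the Carleson embedding theorem. *)
Lemma carleson_bellman n f K : martingale f ->
  tree_sum n (fun L => incr b L ^+ 2 * f L ^+ 2) K <=
  4 * be * leaf_avg n (fun L => f L ^+ 2) K -
  4 * be ^+ 2 * (f K ^+ 2 / (be + tree_sum n (fun L => incr b L ^+ 2) K)).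
Proof.
move=> mf; elim: n K => [|n IH] K.
  rewrite /= addr0.
  have -> : 4 * be ^+ 2 * (f K ^+ 2 / be) = 4 * be * f K ^+ 2.
    by field; rewrite gt_eqF.
  by rewrite subrr.
have := b_carleson n.+1 K; rewrite /=.
set d := incr b K; set x := f K.
have := IH (right_half K); have := IH (left_half K).
set A1 := tree_sum n (fun L => incr b L ^+ 2) (right_half K).
set A2 := tree_sum n (fun L => incr b L ^+ 2) (left_half K).
have A10 : 0 <= A1 by apply: tree_sum_ge0 => L; exact: sqr_ge0.
have A20 : 0 <= A2 by apply: tree_sum_ge0 => L; exact: sqr_ge0.
have d0 : 0 <= d ^+ 2 by exact: sqr_ge0.
have a1 : 0 < be + A1 by rewrite ltr_pwDl.
have a2 : 0 < be + A2 by rewrite ltr_pwDl.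
have := convex_sqr_div (f (right_half K)) (f (left_half K)) a1 a2.
rewrite -(mf K) -/x.
set y1 := f (right_half K) ^+ 2 / _; set y2 := f (left_half K) ^+ 2 / _.
move=> cv h2 h1 hbe.
set m := (be + A1 + (be + A2)) / 2 in cv.
have m0 : 0 < m by rewrite /m; lra.
have -> : be + (d ^+ 2 + (A1 + A2) / 2) = m + d ^+ 2 by rewrite /m; field.
have mbe : m + d ^+ 2 <= 2 * be by move: hbe; rewrite /m; lra.
(* Convexity loses nothing at the children; the gain comes from the root, whose increment raises the
   denominator from $m$ to $m+d^2$. The drop $x^2/m-x^2/(m+d^2)$ equals $d^2x^2/(m(m+d^2))$, and
   both factors below are at most [2 * be]. *)
have key : d ^+ 2 * x ^+ 2 <=
    4 * be ^+ 2 * (x ^+ 2 / m) - 4 * be ^+ 2 * (x ^+ 2 / (m + d ^+ 2)).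
  rewrite -subr_ge0.
  have -> : 4 * be ^+ 2 * (x ^+ 2 / m) - 4 * be ^+ 2 * (x ^+ 2 / (m + d ^+ 2)) -
     d ^+ 2 * x ^+ 2 =
     d ^+ 2 * x ^+ 2 * (4 * be ^+ 2 - m * (m + d ^+ 2)) / (m * (m + d ^+ 2)).
    by field; rewrite !gt_eqF//; lra.
  apply: divr_ge0; last by apply: mulr_ge0; lra.
  apply: mulr_ge0; first by rewrite mulr_ge0 ?sqr_ge0.
  rewrite subr_ge0 (_ : 4 * be ^+ 2 = 2 * be * (2 * be)); last by ring.
  by apply: ler_pM => //; lra.
have b2 : 0 <= 4 * be ^+ 2 by rewrite mulr_ge0 ?sqr_ge0.
have := ler_wpM2l b2 cv.
rewrite mulrA mulrDr; move: h1 h2 key; lra.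
Qed.

Lemma carleson_embedding n f K : martingale f ->
  tree_sum n (fun L => incr b L ^+ 2 * f L ^+ 2) K <=
  4 * be * leaf_avg n (fun L => f L ^+ 2) K.
Proof.
move=> mf; apply: (le_trans (carleson_bellman _ _ mf)).
rewrite lerBlDr lerDl; apply: mulr_ge0; first by rewrite mulr_ge0 ?sqr_ge0.
apply: divr_ge0; first exact: sqr_ge0.
by apply: addr_ge0; [exact: ltW|apply: tree_sum_ge0 => L; exact: sqr_ge0].
Qed.

(** By the arithmetic-geometric mean inequality each term is at most half of
    $(\mathrm{incr}\,b)^2f^2+(\mathrm{incr}\,g)^2$; the first part is summed by Carleson embedding,
    the second by Parseval. *)
Lemma paraproduct_bound n f g K : martingale f -> martingale g ->
  `|tree_sum n (fun L => incr b L * f L * incr g L) K| <=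
  (4 * be + 1) / 2 * (leaf_avg n (fun L => f L ^+ 2) K +
                      leaf_avg n (fun L => g L ^+ 2) K).
Proof.
move=> mf mg; apply: (le_trans (tree_sum_norm _ _ _)).
apply: (@le_trans _ _ (tree_sum n (fun L =>
   2^-1 * (incr b L ^+ 2 * f L ^+ 2) + 2^-1 * incr g L ^+ 2) K)).
  apply: tree_sum_le => L; rewrite ler_norml.
  have := sqr_ge0 (incr b L * f L + incr g L).
  have := sqr_ge0 (incr b L * f L - incr g L).
  rewrite !expr2 => h1 h2; apply/andP; split; lra.
rewrite tree_sumD !tree_sumZ.
have := carleson_embedding n K mf.
have : tree_sum n (fun L => incr g L ^+ 2) K <= leaf_avg n (fun L => g L ^+ 2) K.
  by rewrite leaf_avg_sqr// lerDr sqr_ge0.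
have : 0 <= leaf_avg n (fun L => f L ^+ 2) K.
  by apply: leaf_avg_ge0 => L; exact: sqr_ge0.
have : 0 <= leaf_avg n (fun L => g L ^+ 2) K.
  by apply: leaf_avg_ge0 => L; exact: sqr_ge0.
set X := leaf_avg _ _ _; set Y := leaf_avg _ _ _ => X0 Y0 h1 h2.
have := mulr_ge0 (ltW be0) X0; lra.
Qed.


(** * The one-variable commutator on a finite tree *)

Section Shift1.
Variables (e : dyadic -> bool) (r : dyadic) (n : nat).
Let s2 : R := Num.sqrt 2.

(* F = T f and G = T^* g in terms of increments: the Haar coefficient on K is
   sqrt |K| times the increment, whence the factors sqrt 2. *)
Definition shift_pair f F := [/\ martingale f, martingale F,
  [/\ f r = 0, F r = 0 & incr F r = 0],
  (forall K, incr F (right_half K) = s2 * (e K)%:R * incr f K /\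
             incr F (left_half K) = - (s2 * (e K)%:R * incr f K))
  & forall K, scale r + n%:Z <= scale K -> incr f K = 0].

(** For even $K$, $\langle G,h_K\rangle=\langle g,h_{K_+}-h_{K_-}\rangle$, and the coefficient of
    $g$ on a child is $\sqrt{|K|/2}$ times its increment; dividing by $\sqrt{|K|}$ leaves
    $1/\sqrt2$, written [s2 / 2]. *)
Definition coshift_pair g G := [/\ martingale g, martingale G,
  g r = 0 /\ G r = 0,
  (forall K, incr G K =
     s2 / 2 * (e K)%:R * (incr g (right_half K) - incr g (left_half K)))
  & forall K, scale r + n%:Z <= scale K -> incr g K = 0].

(** [f] and [g] have increments in generations $0,\dots,n-1$ only, but the shift moves those of [F]
    down to generation $n$; hence the depth [n.+1]. *)
Local Notation sq u := (leaf_avg n.+1 (fun L => u L ^+ 2) r).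

Let sq_s2 : s2 * s2 = 2.
Proof. by rewrite -expr2 sqr_sqrtr. Qed.

Let sqr0 : 0 ^+ 2 = 0 :> R.
Proof. by rewrite expr0n. Qed.

Let e01 K : (e K)%:R = 0 :> R \/ (e K)%:R = 1 :> R.
Proof. by case: (e K); [right|left]. Qed.

Let tree_sum_sqr_le m u : martingale u ->
  tree_sum m (fun L => incr u L ^+ 2) r <= leaf_avg m (fun L => u L ^+ 2) r.
Proof. by move=> mu; rewrite leaf_avg_sqr// lerDr sqr_ge0. Qed.

(** The shift has norm at most $\sqrt2$: an increment of [f] reappears on both children with factor
    $\pm\sqrt2$, and the mean of the two squares is twice the original. *)
Lemma shift_pair_sqr f F : shift_pair f F -> sq F <= 2 * sq f.
Proof.
move=> [mf mF [_ Fr dFr] FE _].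
rewrite leaf_avg_sqr// Fr sqr0 add0r tree_sum_root dFr sqr0 add0r.
apply: (@le_trans _ _ (2 * tree_sum n (fun L => incr f L ^+ 2) r)).
  rewrite -tree_sumZ; apply: tree_sum_le => L.
  have [-> ->] := FE L.
  have -> : ((s2 * (e L)%:R * incr f L) ^+ 2 +
    (- (s2 * (e L)%:R * incr f L)) ^+ 2) / 2 =
    s2 * s2 * ((e L)%:R ^+ 2 * incr f L ^+ 2) by field.
  rewrite sq_s2; have := sqr_ge0 (incr f L).
  by have [->|->] := e01 L; rewrite ?expr0n ?expr1n/=; lra.
rewrite ler_pM2l//; apply: le_trans (tree_sum_sqr_le n.+1 mf).
by rewrite tree_sum_leaf lerDl leaf_avg_ge0// => L; exact: sqr_ge0.
Qed.

Let tree_sum_children g : martingale g ->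
  (forall K, scale r + n%:Z <= scale K -> incr g K = 0) ->
  tree_sum n.+1 (fun L =>
    (incr g (right_half L) ^+ 2 + incr g (left_half L) ^+ 2) / 2) r <= sq g.
Proof.
move=> mg g0; apply: le_trans (tree_sum_sqr_le n.+1 mg).
have := tree_sum_root n.+1 (fun L => incr g L ^+ 2) r.
rewrite tree_sum_leaf (@leaf_avg_eq0 n.+1) ?addr0 => [->|L sL].
  by rewrite lerDr sqr_ge0.
by rewrite g0 ?sqr0// sL lerD2l lez_nat.
Qed.

Lemma coshift_pair_sqr g G : coshift_pair g G -> sq G <= 2 * sq g.
Proof.
move=> [mg mG [_ Gr] GE g0].
rewrite leaf_avg_sqr// Gr sqr0 add0r.
apply: (@le_trans _ _ (2 * tree_sum n.+1 (fun L =>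
    (incr g (right_half L) ^+ 2 + incr g (left_half L) ^+ 2) / 2) r)).
  rewrite -tree_sumZ; apply: tree_sum_le => L; rewrite GE.
  set x := incr g _; set y := incr g _.
  have -> : (s2 / 2 * (e L)%:R * (x - y)) ^+ 2 =
    s2 * s2 / 4 * ((e L)%:R ^+ 2 * (x - y) ^+ 2) by field.
  rewrite sq_s2; have := sqr_ge0 (x - y); have := sqr_ge0 (x + y).
  rewrite !expr2.
  by have [->|->] := e01 L => h1 h2; lra.
by rewrite ler_pM2l//; exact: tree_sum_children.
Qed.

Lemma diagonal_bound f F g G : martingale b ->
  shift_pair f F -> coshift_pair g G ->
  `|tree_sum n.+1 (fun L => b L * (incr f L * incr G L)) r -
    tree_sum n.+1 (fun L => b L * (incr F L * incr g L)) r| <=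
  (be + 2) * (sq f + sq g).
Proof.
move=> mb [mf mF [fr Fr dFr] FE f0] [mg mG [gr Gr] GE g0].
(* The two sums are brought to the same index set: in the first the last generation drops because
   [incr f] vanishes there, in the second the root drops because [incr F r] does, and the rest is
   indexed by parents. *)
rewrite tree_sum_leaf (@leaf_avg_eq0 n) ?addr0; last first.
  by move=> L sL; rewrite f0 ?sL// mul0r mulr0.
rewrite tree_sum_root dFr mul0r mulr0 add0r -mulN1r -tree_sumZ -tree_sumD.
apply: (le_trans (tree_sum_norm _ _ _)).
apply: (@le_trans _ _ (tree_sum n (fun L => be / 2 * incr f L ^+ 2 +
   2 * ((incr g (right_half L) ^+ 2 + incr g (left_half L) ^+ 2) / 2)) r)).
  apply: tree_sum_le => L; have [-> ->] := FE L.
  rewrite GE (martingale_right _ mb) (martingale_left _ mb).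
  set x := incr g _; set y := incr g _; set d := incr b _.
  (* The unbounded value [b L] cancels between the two sums; only the increment [d], at most
     $\sqrt{be}$ in modulus, survives. *)
  have -> : b L * (incr f L * (s2 / 2 * (e L)%:R * (x - y))) +
    -1 * (((b L + d) * (s2 * (e L)%:R * incr f L * x) +
           (b L - d) * (- (s2 * (e L)%:R * incr f L) * y)) / 2) =
    - ((s2 / 2) * (e L)%:R) * (d * incr f L * (x + y)) by field.
  have dbe : d ^+ 2 <= be.
    by have := b_carleson 1 L; rewrite /= !addr0 mul0r addr0.
  rewrite normrM.
  apply: (@le_trans _ _ `|d * incr f L * (x + y)|).
    rewrite -[leRHS]mul1r ler_wpM2r// normrN normrM ger0_norm ?divr_ge0 ?sqrtr_ge0//.
    have : s2 <= 2.
      by rewrite -[leRHS]ger0_norm// -sqrtr_sqr ler_sqrt ?sqr_ge0//; lra.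
    have : 0 <= s2 by exact: sqrtr_ge0.
    by have [->|->] := e01 L; rewrite ?normr0 ?normr1; lra.
  have h : d ^+ 2 * incr f L ^+ 2 <= be * incr f L ^+ 2.
    by rewrite ler_wpM2r ?sqr_ge0.
  have := sqr_ge0 (d * incr f L + (x + y)).
  have := sqr_ge0 (d * incr f L - (x + y)).
  have := sqr_ge0 (x - y).
  move: h; rewrite !expr2 => h h1 h2 h3; rewrite ler_norml; apply/andP; split; nra.
rewrite tree_sumD !tree_sumZ.
have h1 : tree_sum n (fun L => incr f L ^+ 2) r <= sq f.
  apply: le_trans (tree_sum_sqr_le n.+1 mf).
  by rewrite tree_sum_leaf lerDl leaf_avg_ge0// => L; exact: sqr_ge0.
have h2 : tree_sum n (fun L =>
    (incr g (right_half L) ^+ 2 + incr g (left_half L) ^+ 2) / 2) r <= sq g.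
  apply: le_trans (tree_sum_children mg g0).
  rewrite tree_sum_leaf lerDl leaf_avg_ge0// => L.
  by rewrite divr_ge0 ?addr_ge0 ?sqr_ge0.
have h3 : 0 <= sq f by apply: leaf_avg_ge0 => L; exact: sqr_ge0.
have h4 : 0 <= sq g by apply: leaf_avg_ge0 => L; exact: sqr_ge0.
have := ler_wpM2l (ltW be0) h1; have := mulr_ge0 (ltW be0) h3.
have := mulr_ge0 (ltW be0) h4; lra.
Qed.

(** The vanishing root values remove the boundary terms of [trilinear]. The four paraproducts
    together cost [4 * be + 1] times $\|f\|^2+\|g\|^2+\|F\|^2+\|G\|^2\le3(\|f\|^2+\|g\|^2)$, and the
    diagonal part costs [be + 2]; the sum is [13 * be + 5]. *)
Lemma tree_commutator f F g G : martingale b ->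
  shift_pair f F -> coshift_pair g G ->
  `|leaf_avg n.+1 (fun L => b L * f L * G L) r -
    leaf_avg n.+1 (fun L => b L * F L * g L) r| <=
  (13 * be + 5) * (sq f + sq g).
Proof.
move=> mb fF gG.
have := diagonal_bound mb fF gG.
have := shift_pair_sqr fF; have := coshift_pair_sqr gG.
case: fF gG => [mf mF [fr Fr dFr] FE f0] [mg mG [gr Gr] GE g0].
rewrite !trilinear// fr Fr mulr0 !mul0r !add0r !tree_sumD.
have := paraproduct_bound n.+1 r mf mG; have := paraproduct_bound n.+1 r mG mf.
have := paraproduct_bound n.+1 r mF mg; have := paraproduct_bound n.+1 r mg mF.
set t1 := tree_sum _ _ _; set t2 := tree_sum _ _ _.
set t3 := tree_sum _ _ _; set t4 := tree_sum _ _ _.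
set d1 := tree_sum _ _ _; set d2 := tree_sum _ _ _.
set a1 := sq f; set a2 := sq g; set a3 := sq F; set a4 := sq G.
have p1 : 0 <= a1 by apply: leaf_avg_ge0 => L; exact: sqr_ge0.
have p2 : 0 <= a2 by apply: leaf_avg_ge0 => L; exact: sqr_ge0.
move=> h1 h2 h3 h4 g4 g3 hd.
have tri (x y : R) : `|x + y| <= `|x| + `|y| by exact: ler_normD.
have -> : d1 + (t4 + t3) - (d2 + (t2 + t1)) =
   (d1 - d2) + ((t4 + t3) + (- t2 - t1)) by ring.
apply: (le_trans (tri _ _)).
have := tri (t4 + t3) (- t2 - t1); have := tri t4 t3; have := tri (- t2) (- t1).
rewrite !normrN => k1 k2 k3.
have q3 := ler_wpM2l (ltW be0) g3; have q4 := ler_wpM2l (ltW be0) g4.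
have := mulr_ge0 (ltW be0) p1; have := mulr_ge0 (ltW be0) p2.
move: h1 h2 h3 h4 hd q3 q4; rewrite ?mulrDl ?mulrDr; lra.
Qed.

End Shift1.
End Carleson.


(* With f1 = T1 f, f12 = T2 f1, g2 = T2^* g and g12 = T1^* g2, the intermediate
   term is the average of b f1 g2. *)
Lemma tree_commutator2 (e : dyadic -> bool) (b : dyadic -> dyadic -> R) (be : R)
    (r r' : dyadic) n (f f1 f12 g g2 g12 : dyadic -> dyadic -> R) :
  0 < be ->
  (forall K, martingale (b K)) -> (forall L, martingale (b^~ L)) ->
  (forall K m L, tree_sum m (fun L => incr (b K) L ^+ 2) L <= be) ->
  (forall L m K, tree_sum m (fun K => incr (b^~ L) K ^+ 2) K <= be) ->
  (forall L, shift_pair e r n (f^~ L) (f1^~ L)) ->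
  (forall K, shift_pair e r' n (f1 K) (f12 K)) ->
  (forall K, coshift_pair e r' n (g K) (g2 K)) ->
  (forall L, coshift_pair e r n (g2^~ L) (g12^~ L)) ->
  `|leaf_avg n.+1 (fun K => leaf_avg n.+1
       (fun L => b K L * f K L * g12 K L) r') r -
    leaf_avg n.+1 (fun K => leaf_avg n.+1
       (fun L => b K L * f12 K L * g K L) r') r| <=
  4 * (13 * be + 5) *
    (leaf_avg n.+1 (fun K => leaf_avg n.+1 (fun L => f K L ^+ 2) r') r +
     leaf_avg n.+1 (fun K => leaf_avg n.+1 (fun L => g K L ^+ 2) r') r).
Proof.
move=> be0 mb1 mb2 cb1 cb2 ff1 ff12 gg2 gg12.
set A := leaf_avg _ _ r; set D := (X in _ <= _ * X).
pose M := leaf_avg n.+1 (fun K => leaf_avg n.+1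
       (fun L => b K L * f1 K L * g2 K L) r') r.
set B := leaf_avg _ _ r.
have c0 : 0 <= 13 * be + 5 by lra.
(* Here the second variable is the parameter, so the two averages are exchanged before the
   one-variable bound is applied; replacing [g2] by [g] afterwards costs the factor 2. *)
have AM : `|A - M| <= (13 * be + 5) * (2 * D).
  rewrite /A /M leaf_avg_exchange (leaf_avg_exchange _ _ _ r).
  rewrite -mulN1r -leaf_avgZ -leaf_avgD.
  apply: (le_trans (leaf_avg_norm _ _ _)).
  apply: (@le_trans _ _ (leaf_avg n.+1 (fun L => (13 * be + 5) *
    (leaf_avg n.+1 (fun K => f K L ^+ 2) r +
     leaf_avg n.+1 (fun K => g2 K L ^+ 2) r)) r')).
    apply: leaf_avg_le => L; rewrite mulN1r.
    exact: (tree_commutator be0 (cb2 L) (mb2 L) (ff1 L) (gg12 L)).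
  rewrite leaf_avgZ ler_wpM2l// leaf_avgD mulrDr lerD//.
    rewrite -leaf_avg_exchange -[leLHS]mul1r ler_wpM2r ?ler1n//.
    by do 2!apply: leaf_avg_ge0 => ?; exact: sqr_ge0.
  rewrite -leaf_avg_exchange -leaf_avgZ; apply: leaf_avg_le => K.
  exact: (coshift_pair_sqr (gg2 K)).
have MB : `|M - B| <= (13 * be + 5) * (2 * D).
  rewrite /M /B -mulN1r -leaf_avgZ -leaf_avgD.
  apply: (le_trans (leaf_avg_norm _ _ _)).
  apply: (@le_trans _ _ (leaf_avg n.+1 (fun K => (13 * be + 5) *
    (leaf_avg n.+1 (fun L => f1 K L ^+ 2) r' +
     leaf_avg n.+1 (fun L => g K L ^+ 2) r')) r)).
    apply: leaf_avg_le => K; rewrite mulN1r.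
    exact: (tree_commutator be0 (cb1 K) (mb1 K) (ff12 K) (gg2 K)).
  rewrite leaf_avgZ ler_wpM2l// leaf_avgD mulrDr lerD//.
    rewrite leaf_avg_exchange (leaf_avg_exchange _ _ _ r) -leaf_avgZ.
    by apply: leaf_avg_le => L; exact: (shift_pair_sqr (ff1 L)).
  rewrite -[leLHS]mul1r ler_wpM2r ?ler1n//.
  by do 2!apply: leaf_avg_ge0 => ?; exact: sqr_ge0.
apply: le_trans (ler_distD M _ _) _.
by apply: (le_trans (lerD AM MB)); lra.
Qed.

End Trees.

(** * Square integrable functions *)

Section SquareIntegrable.
Context d (X : measurableType d) (R : realType).
Variable mu : {measure set X -> \bar R}.
Implicit Types (f g h : X -> R).

Definition sqint f := measurable_fun setT f /\
  mu.-integrable setT (EFin \o (fun x => f x ^+ 2)).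

Definition ip f g : R := \int[mu]_x (f x * g x).

Lemma sqint_le f g : measurable_fun setT f -> sqint g ->
  (forall x, `|f x| <= `|g x|) -> sqint f.
Proof.
move=> mf [mg ig] fg; split => //.
apply: (le_integrable measurableT _ _ ig).
  by apply/measurable_EFinP; exact: measurable_funX.
move=> x _ /=; rewrite lee_fin !normrX.
by apply: lerXn2r (fg x); rewrite nnegrE normr_ge0.
Qed.

Lemma sqint_mul f g : sqint f -> sqint g ->
  mu.-integrable setT (EFin \o (fun x => f x * g x)).
Proof.
move=> [mf If] [mg Ig].
apply: (le_integrable measurableT _ _ (integrableD measurableT If Ig)).
  by apply/measurable_EFinP; exact: measurable_funM.
move=> x _ /=; rewrite lee_fin normrM (ger0_norm (addr_ge0 (sqr_ge0 _) (sqr_ge0 _))).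
rewrite -[f x ^+ 2]real_normK ?num_real// -[g x ^+ 2]real_normK ?num_real//.
have := sqr_ge0 (`|f x| - `|g x|); have := normr_ge0 (f x); have := normr_ge0 (g x).
rewrite !expr2; nra.
Qed.

Lemma sqintD f g : sqint f -> sqint g -> sqint (fun x => f x + g x).
Proof.
move=> [mf If] [mg Ig]; have fg : measurable_fun setT (fun x => f x + g x).
  exact: measurable_funD.
split => //.
have := integrableD measurableT (integrableD measurableT If Ig)
          (integrableD measurableT If Ig).
move/(le_integrable measurableT); apply.
  by apply/measurable_EFinP; exact: measurable_funX.
move=> x _ /=; rewrite lee_fin !ger0_norm ?addr_ge0 ?sqr_ge0//.
by have := sqr_ge0 (f x - g x); rewrite !expr2; nra.
Qed.

Lemma sqintZ (c : R) f : sqint f -> sqint (fun x => c * f x).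
Proof.
move=> [mf If]; split; first exact: measurable_funM.
apply: eq_integrable (integrableZl measurableT (c ^+ 2) If) => //.
by move=> x _ /=; rewrite exprMn EFinM.
Qed.

Lemma sqintB f g : sqint f -> sqint g -> sqint (fun x => f x - g x).
Proof.
move=> sf sg; have := sqintD sf (sqintZ (-1) sg).
by under eq_fun do rewrite mulN1r.
Qed.

Lemma sqint0 : sqint (fun=> 0).
Proof.
split; first exact: measurable_cst.
apply: eq_integrable (integrable0 mu setT) => //.
by move=> x _ /=; rewrite expr0n.
Qed.

Lemma sqint_sum (I : Type) (l : seq I) (F : I -> X -> R) :
  (forall i, sqint (F i)) -> sqint (fun x => \sum_(i <- l) F i x).
Proof.
move=> sF; elim: l => [|i l IH].
  by under eq_fun do rewrite big_nil; exact: sqint0.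
by under eq_fun do rewrite big_cons; exact: sqintD.
Qed.

Lemma ipC f g : ip f g = ip g f.
Proof. by apply: eq_Rintegral => x _; rewrite mulrC. Qed.

Lemma eq_ip f f' g g' : f =1 f' -> g =1 g' -> ip f g = ip f' g'.
Proof. by move=> e1 e2; apply: eq_Rintegral => x _; rewrite e1 e2. Qed.

Lemma ipDl f g h : sqint f -> sqint g -> sqint h ->
  ip (fun x => f x + g x) h = ip f h + ip g h.
Proof.
move=> sf sg sh; rewrite /ip -RintegralD//; [|exact: sqint_mul..].
by apply: eq_Rintegral => x _; rewrite mulrDl.
Qed.

Lemma ipZl c f g : sqint f -> sqint g -> ip (fun x => c * f x) g = c * ip f g.
Proof.
move=> sf sg; rewrite /ip -RintegralZl//; last exact: sqint_mul.
by apply: eq_Rintegral => x _; rewrite mulrA.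
Qed.

Lemma ipBl f g h : sqint f -> sqint g -> sqint h ->
  ip (fun x => f x - g x) h = ip f h - ip g h.
Proof.
move=> sf sg sh; rewrite /ip -RintegralB//; [|exact: sqint_mul..].
by apply: eq_Rintegral => x _; rewrite mulrBl.
Qed.

Lemma ipDr f g h : sqint f -> sqint g -> sqint h ->
  ip h (fun x => f x + g x) = ip h f + ip h g.
Proof. by move=> *; rewrite ipC ipDl// !(ipC h). Qed.

Lemma ipZr c f g : sqint f -> sqint g -> ip f (fun x => c * g x) = c * ip f g.
Proof. by move=> *; rewrite ipC ipZl// ipC. Qed.

Lemma ipBr f g h : sqint f -> sqint g -> sqint h ->
  ip h (fun x => f x - g x) = ip h f - ip h g.
Proof. by move=> *; rewrite ipC ipBl// !(ipC h). Qed.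

Lemma ip0l g : ip (fun=> 0) g = 0.
Proof.
rewrite /ip (@eq_Rintegral _ _ _ _ _ (fun=> 0)) => [|x _]; last by rewrite mul0r.
by rewrite Rintegral_cst// mul0r.
Qed.

Lemma ip_suml (I : Type) (l : seq I) (F : I -> X -> R) g :
  (forall i, sqint (F i)) -> sqint g ->
  ip (fun x => \sum_(i <- l) F i x) g = \sum_(i <- l) ip (F i) g.
Proof.
move=> sF sg; elim: l => [|i l IH].
  by rewrite big_nil; apply: etrans (ip0l g); apply: eq_ip => x //; rewrite big_nil.
rewrite big_cons -IH -ipDl//; last exact: sqint_sum.
by apply: eq_ip => x //; rewrite big_cons.
Qed.

Lemma ip_sumr (I : Type) (l : seq I) (F : I -> X -> R) g :
  (forall i, sqint (F i)) -> sqint g ->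
  ip g (fun x => \sum_(i <- l) F i x) = \sum_(i <- l) ip g (F i).
Proof.
by move=> sF sg; rewrite ipC ip_suml//; apply: eq_bigr => i _; rewrite ipC.
Qed.

Lemma ip_ge0 f : 0 <= ip f f.
Proof. by apply: Rintegral_ge0 => x _; rewrite -expr2 sqr_ge0. Qed.

Lemma ip_le f g : sqint f -> sqint g -> (forall x, `|f x| <= `|g x|) ->
  ip f f <= ip g g.
Proof.
move=> sf sg fg; apply: le_Rintegral => //; [exact: sqint_mul..|move=> x _].
rewrite -!expr2 -[f x ^+ 2]real_normK ?num_real// -[g x ^+ 2]real_normK ?num_real//.
by apply: lerXn2r (fg x); rewrite nnegrE normr_ge0.
Qed.

Lemma ipDD f g : sqint f -> sqint g ->
  ip (fun x => f x + g x) (fun x => f x + g x) =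
  ip f f + 2 * ip f g + ip g g.
Proof.
by move=> sf sg; rewrite ipDl ?ipDr// ?(ipC g f); [ring|exact: sqintD].
Qed.

Lemma ipBB f g : sqint f -> sqint g ->
  ip (fun x => f x - g x) (fun x => f x - g x) =
  ip f f - 2 * ip f g + ip g g.
Proof.
by move=> sf sg; rewrite ipBl ?ipBr// ?(ipC g f); [ring|exact: sqintB].
Qed.

Lemma ipZZ c f : sqint f ->
  ip (fun x => c * f x) (fun x => c * f x) = c ^+ 2 * ip f f.
Proof. by move=> sf; rewrite ipZl ?ipZr//; [ring|exact: sqintZ]. Qed.

(** A Cauchy-Schwarz inequality without roots; the free parameter [t] makes one of the two terms
    small in limiting arguments. *)
Lemma ip_bound (t : R) f g : 0 < t -> sqint f -> sqint g ->
  `|ip f g| <= t * ip f f + ip g g / t.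
Proof.
move=> t0 sf sg.
have h (c : R) : 0 <= c ^+ 2 * ip f f + 2 * c * ip f g + ip g g.
  have := ip_ge0 (fun x => c * f x + g x).
  by rewrite ipDD ?ipZZ ?ipZl//; [lra|exact: sqintZ].
have tne : t != 0 by rewrite gt_eqF.
have := h (t * 1); have := h (- t).
have e : t * ip f f + ip g g / t = (t ^+ 2 * ip f f + ip g g) / t by field.
rewrite e ler_pdivlMr//.
have -> : `|ip f g| * t = `|ip f g * t| by rewrite normrM (gtr0_norm t0).
rewrite ler_norml.
rewrite sqrrN mulr1 => h1 h2; have := ip_ge0 f; have := ip_ge0 g => g0 f0.
have := mulr_ge0 (sqr_ge0 t) f0.
by move=> tf; apply/andP; split; lra.
Qed.

Lemma ip_sqrD f g : sqint f -> sqint g ->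
  ip (fun x => f x + g x) (fun x => f x + g x) <= 2 * ip f f + 2 * ip g g.
Proof.
move=> sf sg; rewrite ipDD//; have := ip_ge0 (fun x => f x - g x).
by rewrite ipBB//; lra.
Qed.

Lemma ip_sqrB f g : sqint f -> sqint g ->
  ip (fun x => f x - g x) (fun x => f x - g x) <= 2 * ip f f + 2 * ip g g.
Proof.
move=> sf sg; rewrite ipBB//; have := ip_ge0 (fun x => f x + g x).
by rewrite ipDD//; lra.
Qed.

Lemma CauchySchwarz_ip f g : sqint f -> sqint g ->
  ip f g ^+ 2 <= ip f f * ip g g.
Proof.
move=> sf sg; have g0 := ip_ge0 g; have f0 := ip_ge0 f.
have h (c e : R) : 0 <= c ^+ 2 * ip f f + 2 * (c * e) * ip f g + e ^+ 2 * ip g g.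
  have := ip_ge0 (fun x => c * f x + e * g x).
  rewrite ipDD ?ipZZ ?ipZl ?ipZr//; try exact: sqintZ; lra.
have [f00|f00] := eqVneq (ip f f) 0; last first.
  have fp : 0 < ip f f by rewrite lt_neqAle eq_sym f00.
  have := h (- ip f g) (ip f f).
  have -> : (- ip f g) ^+ 2 * ip f f + 2 * (- ip f g * ip f f) * ip f g +
    ip f f ^+ 2 * ip g g = ip f f * (ip f f * ip g g - ip f g ^+ 2) by ring.
  by rewrite pmulr_rge0// subr_ge0.
(* When $\|f\|=0$ the nonnegative quadratic form is affine in [c], so suitable values of [c] force
   $\langle f,g\rangle=0$. *)
rewrite f00 mul0r; have := h (- (1 + ip g g) * ip f g) 1.
rewrite f00.
have -> : (- (1 + ip g g) * ip f g) ^+ 2 * 0 +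
   2 * (- (1 + ip g g) * ip f g * 1) * ip f g + 1 ^+ 2 * ip g g =
   - (2 * (1 + ip g g) * ip f g ^+ 2 - ip g g) by ring.
rewrite oppr_ge0 subr_le0 => hh.
have := sqr_ge0 (ip f g) => hs.
have [//|x0] := leP (ip f g ^+ 2) 0.
have := h (- ip g g / (ip f g)) 1; rewrite f00.
have xne : ip f g != 0 by apply: contraTneq x0 => ->; rewrite expr0n ltxx.
have -> : (- ip g g / ip f g) ^+ 2 * 0 + 2 * (- ip g g / ip f g * 1) * ip f g +
  1 ^+ 2 * ip g g = - ip g g by field.
rewrite oppr_ge0 => gle; have g00 : ip g g = 0 by apply/le_anti; rewrite gle.
by move: hh; rewrite g00; lra.
Qed.

Lemma eq_ip_ae f f' g : measurable_fun setT f -> measurable_fun setT f' ->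
  measurable_fun setT g -> ae_eq mu setT f f' -> ip f g = ip f' g.
Proof.
move=> mf mf' mg ff'; congr fine; apply: ae_eq_integral => //.
- by apply/measurable_EFinP; exact: measurable_funM.
- by apply/measurable_EFinP; exact: measurable_funM.
- by apply: filterS ff' => x /(_ I) fx _; rewrite fx.
Qed.

Lemma eq_ip_ae2 f f' : measurable_fun setT f -> measurable_fun setT f' ->
  ae_eq mu setT f f' -> ip f f = ip f' f'.
Proof.
move=> mf mf' ff'; rewrite (eq_ip_ae mf mf' mf ff').
by rewrite ipC (eq_ip_ae mf mf' mf' ff').
Qed.

Lemma eq_sqint_ae f f' : measurable_fun setT f' -> sqint f ->
  ae_eq mu setT f f' -> sqint f'.
Proof.
move=> mf' [mf /integrableP[_ If]] ff'; split => //.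
apply/integrableP; split; first by apply/measurable_EFinP; exact: measurable_funX.
apply: le_lt_trans If; rewrite le_eqVlt; apply/orP; left; apply/eqP.
apply: ae_eq_integral => //.
- by apply: measurableT_comp => //; apply/measurable_EFinP; exact: measurable_funX.
- by apply: measurableT_comp => //; apply/measurable_EFinP; exact: measurable_funX.
- by apply: filterS ff' => x /(_ I) fx _; rewrite /= fx.
Qed.

Lemma EFin_ip f : sqint f -> (ip f f)%:E = (\int[mu]_x (`|f x| ^+ 2)%:E)%E.
Proof.
move=> sf; rewrite /ip /Rintegral fineK; last first.
  by apply: integrable_fin_num => //; exact: sqint_mul.
by apply: eq_integral => x _; rewrite -expr2 real_normK// num_real.
Qed.

Lemma norm2E f : measurable_fun setT f ->
  norm2 mu f = ((\int[mu]_x (`|f x| ^+ 2)%:E) `^ 2^-1)%E.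
Proof.
move=> mf; rewrite /norm2 unlock; congr (_ `^ _)%E.
by apply: eq_integral => x _ /=; rewrite powR_mulrn.
Qed.

Lemma LfunE f : f \in Lfun mu 2%:E <-> sqint f.
Proof.
split=> [Lf|[mf If]].
  split; last exact: Lfun2_integrable_sqr Lf.
  by have := sub_Lfun_mfun Lf; rewrite inE.
rewrite inE; apply/andP; split; rewrite inE//= /finite_norm.
change (norm2 mu f < +oo)%E.
by rewrite norm2E// -EFin_ip//= ltry.
Qed.

Lemma norm2_sqint f : sqint f -> norm2 mu f = (Num.sqrt (ip f f))%:E.
Proof.
move=> sf; rewrite norm2E; last by case: sf.
by rewrite -EFin_ip//= powR12_sqrt// ip_ge0.
Qed.

Lemma norm2_le (C : R) f g : sqint f -> sqint g ->
  (norm2 mu f <= C%:E * norm2 mu g)%E -> ip f f <= C ^+ 2 * ip g g.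
Proof.
move=> sf sg; rewrite !norm2_sqint// -EFinM lee_fin => h.
rewrite -[leLHS]sqr_sqrtr ?ip_ge0// -[ip g g]sqr_sqrtr ?ip_ge0// -exprMn.
apply: lerXn2r (h); rewrite nnegrE ?sqrtr_ge0//.
by apply: le_trans h; exact: sqrtr_ge0.
Qed.

Lemma le_norm2 (C : R) f g : 0 <= C -> sqint f -> sqint g ->
  ip f f <= C * ip g g -> (norm2 mu f <= (Num.sqrt C)%:E * norm2 mu g)%E.
Proof.
move=> C0 sf sg h; rewrite !norm2_sqint// -EFinM lee_fin -sqrtrM//.
by rewrite ler_sqrt// mulr_ge0// ip_ge0.
Qed.

Lemma ip_dct (u : nat -> X -> R) f g :
  (forall n, measurable_fun setT (u n)) -> sqint g ->
  (forall n x, `|u n x - f x| <= `|g x|) ->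
  (forall x, (fun n => u n x) @ \oo --> f x) -> measurable_fun setT f ->
  forall eps, 0 < eps -> exists N, forall n, (N <= n)%N ->
    ip (fun x => u n x - f x) (fun x => u n x - f x) < eps.
Proof.
move=> mu_ sg ug uf mf eps eps0.
have mB n : measurable_fun setT (fun x => u n x - f x) by exact: measurable_funB.
have sB n : sqint (fun x => u n x - f x) by apply: sqint_le sg _.
have := @dominated_convergence _ _ _ mu setT measurableT
  (fun n x => ((u n x - f x) ^+ 2)%:E) (fun=> 0%E) (fun x => (g x ^+ 2)%:E).
case.
- by move=> n; apply/measurable_EFinP; exact: measurable_funX.
- exact: measurable_cst.
- apply: aeW => x _; apply: cvg_EFin; first exact: nearW.
  have -> : fine \o (fun n => ((u n x - f x) ^+ 2)%:E) =
     (fun n => (u n x - f x) * (u n x - f x)).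
    by apply/funext => n /=; rewrite expr2.
  rewrite -[X in _ --> X](mulr0 (0 : R)).
  suff ux : (fun n => u n x - f x) @ \oo --> (0 : R) by exact: (cvgM ux ux).
  by rewrite -(subrr (f x)); apply: cvgB; [exact: uf|exact: cvg_cst].
- by case: sg.
- apply: aeW => x n _; rewrite lee_fin ger0_norm ?sqr_ge0//.
  rewrite -[leLHS]real_normK ?num_real// -[leRHS]real_normK ?num_real//.
  by apply: lerXn2r (ug n x); rewrite nnegrE normr_ge0.
move=> _ _; rewrite integral0 => /fine_cvgP[_] /cvgrPdist_lt /(_ _ eps0).
case=> N _ hN; exists N => n /hN; rewrite /= sub0r normrN => h.
apply: le_lt_trans h; rewrite /ip /Rintegral.
by under eq_integral do rewrite -expr2; exact: ler_norm.
Qed.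

(** Monotone convergence along the sets $\{|b|\le M\}$, on which multiplication by [b] is bounded.
    It delivers square integrability of [F] together with the bound; for a commutator with unbounded
    [b] neither is known beforehand. *)
Lemma sqint_truncate (b F : X -> R) (C : R) :
  measurable_fun setT b -> measurable_fun setT F ->
  (forall M : nat, let FM x := \1_[set x | `|b x| <= M%:R] x * F x in
     sqint FM /\ ip FM FM <= C) ->
  sqint F /\ ip F F <= C.
Proof.
move=> mb mF H.
have mE : measurable_fun setT (fun x => (F x ^+ 2)%:E).
  by apply/measurable_EFinP; exact: measurable_funX.
pose G (M : nat) x := \1_[set x | `|b x| <= M%:R] x * F x.
have mG M : measurable_fun setT (fun x => (G M x ^+ 2)%:E).
  by apply/measurable_EFinP; apply: measurable_funX; case: (H M) => -[].
have GF x : (fun M => (G M x ^+ 2)%:E) @ \oo --> (F x ^+ 2)%:E.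
  apply: cvg_near_cst; near=> M.
  rewrite /G indicE mem_set ?mul1r//=.
  near: M; exists (Num.truncn `|b x|).+1 => // M /= hM.
  by apply: (le_trans (ltW (truncnS_gt _))); rewrite ler_nat.
have key : (\int[mu]_x (F x ^+ 2)%:E <= C%:E)%E.
  have cv : (\int[mu]_x (G n x ^+ 2)%:E @[n --> \oo] -->
      \int[mu]_x limn (fun M => (G M x ^+ 2)%:E))%E.
    apply: cvg_monotone_convergence => // [n x _|x _ m n mn].
      by rewrite lee_fin sqr_ge0.
    rewrite lee_fin /G !exprMn ler_wpM2r ?sqr_ge0// !indicE.
    case: (boolP (x \in [set x | `|b x| <= m%:R])) => [|_]; last first.
      by rewrite expr0n sqr_ge0.
    rewrite inE/= => bm; rewrite mem_set//=.
    by apply: le_trans bm _; rewrite ler_nat.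
  have e : (\int[mu]_x (F x ^+ 2)%:E =
      \int[mu]_x limn (fun M => (G M x ^+ 2)%:E))%E.
    by apply: eq_integral => x _; apply/esym/cvg_lim => //; exact: GF.
  rewrite e -(cvg_lim _ cv)//; apply: lime_le.
    by apply/cvg_ex; eexists; exact: cv.
  apply: nearW => M; have [sG GC] := H M.
  rewrite (_ : integral _ _ _ = (ip (G M) (G M))%:E) ?lee_fin//.
  rewrite EFin_ip//; apply: eq_integral => x _.
  by rewrite real_normK// num_real.
have sF : sqint F.
  split => //; apply/integrableP; split => //.
  under eq_integral do rewrite /= ger0_norm ?sqr_ge0//.
  exact: le_lt_trans key (ltry _).
split => //; rewrite -lee_fin EFin_ip//; apply: le_trans key.
by under eq_integral do rewrite real_normK ?num_real//.
Unshelve. all: by end_near.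
Qed.

End SquareIntegrable.

(** * From bilinear bounds to norm bounds *)

Section Duality.
Context d (X : measurableType d) (R : realType).
Variable mu : {measure set X -> \bar R}.

(** Testing with $g=F/(4C)$ would give $\|F\|^2/(4C)\le CA+\|F\|^2/(16C)$, and the last term is
    absorbed. Since [F] need not lie in [S], an element of [S] within $\|F\|^2/16$ in square norm is
    scaled instead; the constant 16 leaves room for this error. *)
Lemma dual_bound (S : (X -> R) -> Prop) (F : X -> R) (A C : R) :
  0 < C -> 0 <= A -> sqint mu F ->
  (forall g, S g -> sqint mu g) ->
  (forall c g, S g -> S (fun x => c * g x)) ->
  (forall g, S g -> ip mu F g <= C * (A + ip mu g g)) ->
  (forall eps, 0 < eps -> exists g, S g /\
     ip mu (fun x => F x - g x) (fun x => F x - g x) < eps) ->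
  ip mu F F <= 16 * C ^+ 2 * A.
Proof.
move=> C0 A0 sF sS SZ bS dS; set G := ip mu F F.
have [G0|Gp] := leP G 0.
  apply: (le_trans G0); apply: mulr_ge0 => //.
  by rewrite mulr_ge0 ?sqr_ge0.
have [|g [Sg gF]] := dS (G / 16); first by rewrite divr_gt0.
have sg := sS _ Sg.
have := CauchySchwarz_ip sF (sqintB sF sg).
have := bS _ (SZ (4 * C)^-1 _ Sg); rewrite ipZr// ipZZ//.
move: gF; rewrite ipBB// ipBr// -/G.
set a := ip mu F g; set e := ip mu g g => h1 h2 h3.
have sG : (G - a) ^+ 2 <= (G / 4) ^+ 2.
  apply: (le_trans h3); have -> : (G / 4) ^+ 2 = G * (G / 16) by field.
  by rewrite ler_pM2l// ltW.
have absG : `|G - a| <= G / 4.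
  by rewrite -(@ler_pXn2r _ 2) ?nnegrE ?real_normK ?num_real//; lra.
move: absG; rewrite ler_norml => /andP[lG uG].
have eG : e <= 2 * G by lra.
have Cne : C != 0 by rewrite gt_eqF.
have : (4 * C)^-1 * (3 / 4 * G) <= C * A + (16 * C)^-1 * (2 * G).
  apply: (@le_trans _ _ ((4 * C)^-1 * a)).
    by rewrite ler_pM2l ?invr_gt0 ?mulr_gt0//; lra.
  apply: (le_trans h2); rewrite mulrDr lerD2l.
  have -> : C * ((4 * C)^-1 ^+ 2 * e) = (16 * C)^-1 * e by field.
  by rewrite ler_pM2l ?invr_gt0 ?mulr_gt0.
have -> : (4 * C)^-1 * (3 / 4 * G) = (16 * C)^-1 * (3 * G) by field.
rewrite -lerBlDr -mulrBr -(@ler_pM2l _ (16 * C)); last by rewrite mulr_gt0.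
rewrite mulrA mulfV ?mul1r; last by rewrite mulf_neq0.
rewrite expr2; lra.
Qed.

End Duality.

(** * Dyadic intervals and Haar functions *)

HB.instance Definition _ := gen_eqMixin dyadic.

Section DyadicLine.
Context (R : realType).
Implicit Types (I K L : dyadic) (x y : R).
Local Notation right := right_half.
Local Notation left := left_half.

Lemma len_gt0 I : 0 < len R I.
Proof. by rewrite exprz_gt0. Qed.

Lemma len_neq0 I : len R I != 0.
Proof. by rewrite gt_eqF// len_gt0. Qed.

Lemma len_right I : len R (right I) = len R I / 2.
Proof. by rewrite /len/= opprD expfzDr. Qed.

Lemma len_left I : len R (left I) = len R I / 2.
Proof. by rewrite /len/= opprD expfzDr. Qed.

(** In this form incidence between dyadic intervals is integer arithmetic on floors. *)
Lemma itvE I x : itv R I x <-> Num.floor (x * 2 ^ scale I) = pos I.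
Proof.
rewrite /itv /= in_itv/=.
have e a b : (a * len R I <= b) = (a <= b * 2 ^ scale I).
  by rewrite /len -ler_pdivlMr ?exprz_gt0// -invr_expz invrK.
have e' a b : (b < a * len R I) = (b * 2 ^ scale I < a).
  by rewrite /len -ltr_pdivrMr ?exprz_gt0// -invr_expz invrK.
rewrite e e'; split=> [h|<-]; first exact: floor_def.
exact: floor_itv.
Qed.

Lemma itv_children I x : itv R I x <-> itv R (right I) x \/ itv R (left I) x.
Proof.
rewrite !itvE /= expfzDr// mulrA.
set z := x * _; have := floor_itv z; have := floor_itv (z * 2).
set n := Num.floor (z * 2); set m := Num.floor z.
move=> /andP[n1 n2] /andP[m1 m2].
have h1 : 2 * m <= n.
  by rewrite -ltzD1 -(ltr_int R) rmorphM/=; lra.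
have h2 : n < 2 * m + 2.
  by rewrite -(ltr_int R) rmorphD rmorphM/=; lra.
rewrite /=; lia.
Qed.

Lemma itv_right I x : itv R (right I) x -> itv R I x.
Proof. by move=> h; apply/itv_children; left. Qed.

Lemma itv_left I x : itv R (left I) x -> itv R I x.
Proof. by move=> h; apply/itv_children; right. Qed.

Lemma itv_inj I K x : scale I = scale K -> itv R I x -> itv R K x -> I = K.
Proof.
case: I K => [s p] [s' p'] /= <- /itvE/= h /itvE/= h'.
by rewrite -h -h'.
Qed.

Lemma children_disjoint I x : itv R (right I) x -> itv R (left I) x -> False.
Proof.
by move=> h h'; have := @itv_inj (right I) (left I) x erefl h h'; case; lia.
Qed.

(** Integer division by 2 rounds down, so negative positions are treated correctly too. *)
Definition parent I := Dyadic (scale I - 1) (pos I %/ 2)%Z.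
Definition is_right I : bool := (pos I %% 2)%Z == 1.

Lemma parent_right I : parent (right I) = I.
Proof. by case: I => s p; rewrite /parent /=; congr Dyadic; lia. Qed.

Lemma parent_left I : parent (left I) = I.
Proof. by case: I => s p; rewrite /parent /=; congr Dyadic; lia. Qed.

Lemma is_right_right I : is_right (right I).
Proof. by case: I => s p; rewrite /is_right /=; lia. Qed.

Lemma is_right_left I : is_right (left I) = false.
Proof. by case: I => s p; rewrite /is_right /=; lia. Qed.

Lemma childP I : (if is_right I then right (parent I) else left (parent I)) = I.
Proof.
case: I => s p; rewrite /is_right /parent /=.
case: ifP => /eqP h.
  by congr Dyadic; rewrite /=; lia.
by congr Dyadic; rewrite /=; lia.
Qed.

Lemma itv_parent I x : itv R I x -> itv R (parent I) x.
Proof.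
by rewrite -{1}(childP I); case: ifP => _; [exact: itv_right|exact: itv_left].
Qed.

Lemma itv_nested I K x y : scale I <= scale K ->
  itv R K x -> itv R K y -> itv R I x -> itv R I y.
Proof.
move=> IK; have [n En] : exists n : nat, scale K = scale I + n%:Z.
  by exists `|scale K - scale I|%N; lia.
elim: n K {IK} En => [|n IH] K En Kx Ky Ix.
  by rewrite (@itv_inj I K x)//; lia.
by apply: (IH (parent K)) => //=; [lia|exact: itv_parent..].
Qed.

(** Serves as the sample point at which the constant value of a coarser Haar function on [I] is read
    off. *)
Definition left_end I : R := (pos I)%:~R * len R I.

Lemma left_end_itv I : itv R I (left_end I).
Proof.
by apply/itvE; rewrite /left_end /len -mulrA -expfzDr// addNr mulr1 intrKfloor.
Qed.

Lemma measurable_itv I : measurable (itv R I).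
Proof. exact: measurable_itv. Qed.

Lemma mu1_itv I : mu1 R (itv R I) = (len R I)%:E.
Proof.
have := lebesgue_measure_itv `[(pos I)%:~R * len R I, (pos I + 1)%:~R * len R I[.
move=> h; apply: (eq_trans h); rewrite /= lte_fin ltr_pM2r ?len_gt0//.
rewrite rmorphD/= ltrDl ltr01 -EFinD; congr EFin; ring.
Qed.

Lemma indic_children I x :
  \1_(itv R I) x = \1_(itv R (right I)) x + \1_(itv R (left I)) x :> R.
Proof.
rewrite !indicE.
case: (boolP (x \in itv R I)) => [|]; rewrite ?inE ?notin_setE.
  move=> /itv_children[h|h].
    rewrite (mem_set h) memNset ?addr0// => h'; exact: children_disjoint h h'.
  by rewrite (mem_set h) memNset ?add0r// => h'; exact: children_disjoint h' h.
by move=> h; rewrite !memNset ?addr0// => h'; apply: h;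
  [exact: itv_left|exact: itv_right].
Qed.

Lemma haar_right I x : itv R (right I) x -> haar R I x = (Num.sqrt (len R I))^-1.
Proof.
move=> h; rewrite /haar !indicE (mem_set h) memNset ?subr0 ?mulr1//.
exact: children_disjoint h.
Qed.

Lemma haar_left I x : itv R (left I) x -> haar R I x = - (Num.sqrt (len R I))^-1.
Proof.
move=> h; rewrite /haar !indicE (mem_set h) memNset ?sub0r ?mulrN1//.
by move=> h'; exact: children_disjoint h' h.
Qed.

Lemma haar_out I x : ~ itv R I x -> haar R I x = 0.
Proof.
move=> h; rewrite /haar !indicE !memNset ?subr0 ?mulr0// => h'; apply: h;
  [exact: itv_left|exact: itv_right].
Qed.

Lemma indic_const I K x y : scale I <= scale K -> itv R K x -> itv R K y ->
  \1_(itv R I) x = \1_(itv R I) y :> R.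
Proof.
move=> IK Kx Ky; rewrite !indicE; congr (_ %:R); congr nat_of_bool.
by apply/idP/idP; rewrite !inE; [exact: itv_nested Kx Ky|exact: itv_nested Ky Kx].
Qed.

Lemma haar_const I K x y : scale I < scale K -> itv R K x -> itv R K y ->
  haar R I x = haar R I y.
Proof.
move=> IK Kx Ky; rewrite /haar; congr (_ * (_ - _)); apply: indic_const Kx Ky;
  by rewrite /= lezD1.
Qed.

Lemma haar_sqr I x : haar R I x ^+ 2 = (len R I)^-1 * \1_(itv R I) x.
Proof.
rewrite indicE; case: (boolP (x \in itv R I)) => [|]; rewrite ?inE ?notin_setE.
  have s : (Num.sqrt (len R I))^-1 ^+ 2 = (len R I)^-1.
    by rewrite exprVn sqr_sqrtr// ltW// len_gt0.
  by move=> /itv_children[/haar_right|/haar_left] ->; rewrite ?sqrrN s mulr1.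
by move=> /haar_out ->; rewrite mulr0 expr0n.
Qed.

(* Average of the Haar function of I on K. *)
Definition haar_avg I K : R := if scale I < scale K then haar R I (left_end K) else 0.

Lemma haar_avgE I K x : scale I < scale K -> itv R K x -> haar R I x = haar_avg I K.
Proof.
by move=> IK Kx; rewrite /haar_avg IK; apply: haar_const Kx (left_end_itv K).
Qed.

Lemma haar_avg_children I K :
  haar_avg I (right K) = haar_avg I K + (K == I)%:R * (Num.sqrt (len R I))^-1 /\
  haar_avg I (left K) = haar_avg I K - (K == I)%:R * (Num.sqrt (len R I))^-1.
Proof.
have [IK|KI|e] := ltgtP (scale I) (scale K).
- have -> : (K == I) = false by apply/eqP => E; move: IK; rewrite E ltxx.
  rewrite mul0r addr0 subr0; split; symmetry; rewrite /haar_avg IK [in RHS]ifT/=;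
    try lia; apply: haar_const (left_end_itv _) _ => //.
    exact/itv_right/left_end_itv.
  exact/itv_left/left_end_itv.
- have -> : (K == I) = false by apply/eqP => E; move: KI; rewrite E ltxx.
  rewrite mul0r addr0 subr0 /haar_avg !ifF//=; lia.
- rewrite /haar_avg !e ltxx /= !ltzD1 lexx add0r sub0r.
  have [->|KI] := eqVneq K I.
    rewrite mul1r; split; [apply: haar_right|apply: haar_left]; exact: left_end_itv.
  rewrite mul0r oppr0; split; apply: haar_out => h; move/eqP: KI; apply;
    apply: itv_inj h => //; [apply/itv_right|apply/itv_left]; exact: left_end_itv.
Qed.

Lemma martingale_haar_avg I : martingale (haar_avg I).
Proof. by move=> K; have [-> ->] := haar_avg_children I K; lra. Qed.

Lemma incr_haar_avg I K :
  incr (haar_avg I) K = (K == I)%:R * (Num.sqrt (len R I))^-1.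
Proof. by rewrite /incr; have [-> ->] := haar_avg_children I K; lra. Qed.

Lemma sqrt_len_right I : Num.sqrt (len R (right I)) = Num.sqrt (len R I) / Num.sqrt 2.
Proof. by rewrite len_right sqrtrM ?sqrtrV// ltW// len_gt0. Qed.

Lemma sqrt_len_left I : Num.sqrt (len R (left I)) = Num.sqrt (len R I) / Num.sqrt 2.
Proof. by rewrite len_left sqrtrM ?sqrtrV// ltW// len_gt0. Qed.

End DyadicLine.

(** * Orthonormality of the Haar system, the shift and its adjoint, tensor products *)

Section HaarSystem.
Context (R : realType).
Implicit Types (I K L : dyadic) (x y : R).
Local Notation right := right_half.
Local Notation left := left_half.
Local Notation mu1 := (mu1 R).
Local Notation mu2 := (mu2 R).

Lemma integrable_itv I : mu1.-integrable setT (EFin \o \1_(itv R I)).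
Proof.
exact: integrable_indic_itv.
Qed.

Lemma Rintegral_itv I : \int[mu1]_x \1_(itv R I) x = len R I.
Proof.
rewrite /Rintegral integral_indic//; last exact: measurable_itv.
by rewrite setIT mu1_itv.
Qed.

Lemma sqint_itv I : sqint mu1 (\1_(itv R I)).
Proof.
split; first by apply: measurable_indic; exact: measurable_itv.
apply: eq_integrable (integrable_itv I) => // x _ /=.
by rewrite indicE; case: (x \in _); rewrite ?expr1n ?expr0n.
Qed.

Lemma sqint_haar I : sqint mu1 (haar R I).
Proof.
apply: sqintZ; apply: sqintB; exact: sqint_itv.
Qed.

Lemma Rintegral_haar I : \int[mu1]_x haar R I x = 0.
Proof.
rewrite RintegralZl//; last first.
  exact: (integrableB measurableT (integrable_itv (right I)) (integrable_itv (left I))).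
rewrite RintegralB//; try exact: integrable_itv.
by rewrite !Rintegral_itv len_right len_left subrr mulr0.
Qed.

Lemma ip_haar I K : ip mu1 (haar R I) (haar R K) = (I == K)%:R.
Proof.
wlog IK : I K / scale I <= scale K.
  move=> H; have [/H//|/ltW/H h] := leP (scale I) (scale K).
  by rewrite ipC h eq_sym.
have [<-|neq] := eqVneq I K.
  transitivity (\int[mu1]_x ((len R I)^-1 * \1_(itv R I) x)).
    by apply: eq_Rintegral => x _; rewrite -haar_sqr expr2.
  rewrite RintegralZl//; last exact: integrable_itv.
  by rewrite Rintegral_itv mulVf// len_neq0.
(* The coarser Haar function is constant on the support of the finer one, whose integral is zero; at
   equal scale the supports are disjoint and [c] is 0. *)
have [c Hc] : exists c, forall x, haar R I x * haar R K x = c * haar R K x.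
  have [e|ne] := eqVneq (scale I) (scale K).
    exists 0 => x; rewrite mul0r.
    have [xK|/haar_out ->] := pselect (itv R K x); last by rewrite mulr0.
    rewrite haar_out ?mul0r// => xI; move/eqP: neq; apply; exact: itv_inj xI xK.
  exists (haar_avg R I K) => x.
  have [xK|/haar_out ->] := pselect (itv R K x); last by rewrite !mulr0.
  by rewrite (@haar_avgE _ I K x)// lt_neqAle ne.
rewrite /ip; under eq_Rintegral do rewrite Hc.
rewrite RintegralZl ?Rintegral_haar ?mulr0//.
exact: (integrableZl measurableT _
  (integrableB measurableT (integrable_itv (right K)) (integrable_itv (left K)))).
Qed.

Lemma child_eq : (forall I K, (right I == right K) = (I == K)) *
  (forall I K, (left I == left K) = (I == K)) *
  ((forall I K, (right I == left K) = false) *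
   (forall I K, (left I == right K) = false)).
Proof.
split; split=> I K.
- by apply/eqP/eqP => [/(congr1 parent)|->//]; rewrite !parent_right.
- by apply/eqP/eqP => [/(congr1 parent)|->//]; rewrite !parent_left.
- by apply/eqP => /(congr1 is_right); rewrite is_right_right is_right_left.
- by apply/eqP => /(congr1 is_right); rewrite is_right_right is_right_left.
Qed.

Definition even_itv I : bool := `[< dyadic_even R I >].

Definition shift_haar I x : R :=
  (even_itv I)%:R * (haar R (right I) x - haar R (left I) x).

(* T^* h_I, see ip_shift_haar. *)
Definition coshift_haar I x : R :=
  (even_itv (parent I))%:R * (if is_right I then 1 else -1) * haar R (parent I) x.

Definition shift_avg I K : R :=
  (even_itv I)%:R * (haar_avg R (right I) K - haar_avg R (left I) K).

Definition coshift_avg I K : R :=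
  (even_itv (parent I))%:R * (if is_right I then 1 else -1) *
  haar_avg R (parent I) K.

Lemma sqint_shift_haar I : sqint mu1 (shift_haar I).
Proof. by apply: sqintZ; apply: sqintB; exact: sqint_haar. Qed.

Lemma sqint_coshift_haar I : sqint mu1 (coshift_haar I).
Proof. by apply: sqintZ; exact: sqint_haar. Qed.

Lemma ip_shift_haar I K :
  ip mu1 (shift_haar I) (haar R K) = ip mu1 (haar R I) (coshift_haar K).
Proof.
have [sh sB] := (sqint_haar, fun J J' => sqintB (sqint_haar J) (sqint_haar J')).
rewrite [LHS](ipZl _ (sB _ _))// [RHS](ipZr _ (sh _))// ipBl// !ip_haar.
rewrite -{1 2}(childP K).
case: ifP => _; rewrite ?child_eq;
  by have [->|_] := eqVneq I (parent K); rewrite /= ?mulr0n ?mulr1n; ring.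
Qed.

Lemma martingale_shift_avg I : martingale (shift_avg I).
Proof.
move=> K; rewrite /shift_avg (martingale_haar_avg R (right I) K).
by rewrite (martingale_haar_avg R (left I) K); lra.
Qed.

Lemma martingale_coshift_avg I : martingale (coshift_avg I).
Proof.
by move=> K; rewrite /coshift_avg (martingale_haar_avg R (parent I) K); lra.
Qed.

Lemma incr_shift_avg I K :
  incr (shift_avg I) (right K) =
    Num.sqrt 2 * (even_itv K)%:R * incr (haar_avg R I) K /\
  incr (shift_avg I) (left K) =
    - (Num.sqrt 2 * (even_itv K)%:R * incr (haar_avg R I) K).
Proof.
have e J : incr (shift_avg I) J =
    (even_itv I)%:R * (incr (haar_avg R (right I)) J - incr (haar_avg R (left I)) J).
  by rewrite /incr /shift_avg; lra.
rewrite !e !incr_haar_avg.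
rewrite !child_eq ?sqrt_len_right ?sqrt_len_left invfM invrK.
by have [->|_] := eqVneq K I; rewrite /= ?mulr0n ?mulr1n; split; ring.
Qed.

Lemma incr_coshift_avg I K : incr (coshift_avg I) K =
  Num.sqrt 2 / 2 * (even_itv K)%:R *
  (incr (haar_avg R I) (right K) - incr (haar_avg R I) (left K)).
Proof.
have -> : incr (coshift_avg I) K = (even_itv (parent I))%:R *
    (if is_right I then 1 else -1) * incr (haar_avg R (parent I)) K.
  by rewrite /incr /coshift_avg; lra.
rewrite !incr_haar_avg.
have s2 : Num.sqrt 2 * Num.sqrt 2 = 2 :> R by rewrite -expr2 sqr_sqrtr.
have s3 : Num.sqrt 2 / 2 * Num.sqrt 2 = 1 :> R by rewrite mulrAC s2 mulfV.
have := childP I; move: (parent I) => P.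
case: ifP => _ <-; rewrite !child_eq ?sqrt_len_right ?sqrt_len_left invfM invrK;
  have [->|_] := eqVneq K P; rewrite /= ?mulr0n ?mulr1n;
  by rewrite -[LHS]mul1r -[X in X * _ = _]s3; ring.
Qed.

Lemma tensor_integrable (f g : line R -> R) :
  mu1.-integrable setT (EFin \o f) -> mu1.-integrable setT (EFin \o g) ->
  mu2.-integrable setT (EFin \o tensor f g) /\
  \int[mu2]_z tensor f g z = (\int[mu1]_x f x) * (\int[mu1]_x g x).
Proof.
move=> If Ig.
have mf : measurable_fun setT f by apply/measurable_EFinP; case/integrableP: If.
have mg : measurable_fun setT g by apply/measurable_EFinP; case/integrableP: Ig.
have mt : measurable_fun setT (tensor f g).
  apply: measurable_funM; first exact: measurableT_comp mf measurable_fst.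
  exact: measurableT_comp mg measurable_snd.
have fing : (\int[mu1]_x (g x)%:E)%E \is a fin_num by exact: integrable_fin_num.
have It : mu2.-integrable setT (EFin \o tensor f g).
  apply/integrable12ltyP; first exact/measurable_EFinP.
  case/integrableP: If => _ If; case/integrableP: Ig => _ Ig.
  have -> : (\int[lebesgue_measure]_x \int[lebesgue_measure]_y
     `|(EFin \o tensor f g) (x, y)| =
    \int[mu1]_x (`|(f x)%:E| * \int[mu1]_y `|(g y)%:E|))%E.
    apply: eq_integral => x _; rewrite -ge0_integralZl//.
    - by apply: eq_integral => y _; rewrite -abseM.
    - by apply: measurableT_comp => //; exact/measurable_EFinP.
  rewrite ge0_integralZr//; last 2 first.
  - by apply: measurableT_comp => //; exact/measurable_EFinP.
  - exact: integral_ge0.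
  rewrite lte_mul_pinfty// ?integral_ge0//.
  by rewrite ge0_fin_numE ?integral_ge0.
split => //.
rewrite /Rintegral -(integral12_prod_meas1 It) -fineM//; last first.
  exact: integrable_fin_num.
congr fine; rewrite -(fineK fing) -integralZr//.
apply: eq_integral => x _ /=.
rewrite /fubini_F /tensor /=.
under eq_integral do rewrite EFinM.
by rewrite integralZl// fineK.
Qed.

Lemma sqint_tensor (f g : line R -> R) : sqint mu1 f -> sqint mu1 g ->
  sqint mu2 (tensor f g).
Proof.
move=> [mf If] [mg Ig]; split.
  apply: measurable_funM; first exact: measurableT_comp mf measurable_fst.
  exact: measurableT_comp mg measurable_snd.
have [It _] := tensor_integrable If Ig.
by apply: eq_integrable It => // z _; rewrite /= /tensor exprMn.
Qed.

Lemma ip_tensor (f g f' g' : line R -> R) :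
  sqint mu1 f -> sqint mu1 g -> sqint mu1 f' -> sqint mu1 g' ->
  ip mu2 (tensor f g) (tensor f' g') = ip mu1 f f' * ip mu1 g g'.
Proof.
move=> sf sg sf' sg'.
have [_ <-] := tensor_integrable (sqint_mul sf sf') (sqint_mul sg sg').
by apply: eq_Rintegral => z _; rewrite /tensor mulrACA.
Qed.

Lemma ae_eq_tensor (f f' g g' : line R -> R) :
  ae_eq mu1 setT f f' -> ae_eq mu1 setT g g' ->
  ae_eq mu2 setT (tensor f g) (tensor f' g').
Proof.
move=> [N [mN N0 Nf]] [M [mM M0 Mg]].
exists ((N `*` setT) `|` (setT `*` M)); split.
- by apply: measurableU; apply: measurableX.
- rewrite null_set_setU//; try exact: measurableX.
    transitivity (mu1 N * mu1 setT)%E; first exact: product_measure1E.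
    by rewrite N0 mul0e.
  transitivity (mu1 setT * mu1 M)%E; first exact: product_measure1E.
  by rewrite M0 mule0.
move=> z /= h; apply: contrapT => /not_orP[/= hN hM]; apply: h => _.
rewrite /tensor; congr (_ * _).
  by apply: contrapT => h; apply: hN; split => //; apply: Nf => /= /(_ I).
by apply: contrapT => h; apply: hM; split => //; apply: Mg => /= /(_ I).
Qed.

End HaarSystem.

(** * Means over dyadic rectangles *)

Section Rectangles.
Context (R : realType).
Implicit Types (I J K L : dyadic) (Q : dyadic * dyadic) (u b : plane R -> R).
Local Notation right := right_half.
Local Notation left := left_half.
Local Notation mu1 := (mu1 R).
Local Notation mu2 := (mu2 R).

Lemma measurable_rect Q : measurable (@rect R Q).
Proof. by apply: measurableX; exact: measurable_itv. Qed.

Lemma area_gt0 Q : 0 < area R Q.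
Proof. by rewrite mulr_gt0 ?len_gt0. Qed.

Lemma area_neq0 Q : area R Q != 0.
Proof. by rewrite gt_eqF// area_gt0. Qed.

Lemma indic_rect Q :
  \1_(@rect R Q) = tensor (\1_(itv R Q.1)) (\1_(itv R Q.2)) :> (plane R -> R).
Proof.
apply/funext => z; rewrite /tensor !indicE -natrM mulnb; congr (_ %:R).
by congr nat_of_bool; apply/idP/andP; rewrite !inE.
Qed.

Lemma sqint_rect Q : sqint mu2 (\1_(@rect R Q)).
Proof. by rewrite indic_rect; apply: sqint_tensor; exact: sqint_itv. Qed.

Lemma indic_idem T (A : set T) (x : T) : \1_A x * \1_A x = \1_A x :> R.
Proof. by rewrite indicE; case: (x \in A); rewrite ?mul1r ?mul0r. Qed.

Lemma Rintegral_rect Q : \int[mu2]_z \1_(@rect R Q) z = area R Q.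
Proof.
have [_] := tensor_integrable (integrable_itv R Q.1) (integrable_itv R Q.2).
by rewrite !Rintegral_itv indic_rect => ->.
Qed.

Lemma integrable_rect Q : mu2.-integrable setT (EFin \o \1_(@rect R Q)).
Proof.
rewrite indic_rect.
by have [] := tensor_integrable (integrable_itv R Q.1) (integrable_itv R Q.2).
Qed.

Lemma ip_rect Q : ip mu2 (\1_(@rect R Q)) (\1_(@rect R Q)) = area R Q.
Proof. by rewrite -Rintegral_rect; apply: eq_Rintegral => z _; exact: indic_idem. Qed.

Lemma Rintegral_in_rect u Q :
  \int[mu2]_(z in @rect R Q) u z = \int[mu2]_z (\1_(@rect R Q) z * u z).
Proof.
rewrite Rintegral_mkcond; apply: eq_Rintegral => z _.
by rewrite /patch indicE; case: ifP => _; rewrite ?mul1r ?mul0r.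
Qed.

Lemma meanE u Q : mean u Q = (area R Q)^-1 * \int[mu2]_z (\1_(@rect R Q) z * u z).
Proof. by rewrite /mean Rintegral_in_rect. Qed.

Definition locint u := measurable_fun setT u /\
  forall Q, mu2.-integrable setT (EFin \o (fun z => \1_(@rect R Q) z * u z)).

Definition locsqint u := measurable_fun setT u /\
  forall Q, sqint mu2 (fun z => \1_(@rect R Q) z * u z).

Lemma locint_mul u b : locsqint u -> locsqint b -> locint (fun z => u z * b z).
Proof.
move=> [mu su] [mb sb]; split; first exact: measurable_funM.
move=> Q; apply: eq_integrable (sqint_mul (su Q) (sb Q)) => // z _ /=.
by rewrite mulrACA indic_idem.
Qed.

Lemma locsqint_sqint u : sqint mu2 u -> locsqint u.
Proof.
move=> su; split; first by case: su.
move=> Q; apply: sqint_le (su) _.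
  apply: measurable_funM; last by case: su.
  by apply: measurable_indic; exact: measurable_rect.
move=> z; rewrite normrM indicE; case: (z \in _); rewrite ?normr1 ?normr0 ?mul1r//.
by rewrite mul0r.
Qed.

Lemma locsqint_cst (c : R) : locsqint (cst c).
Proof.
split; first exact: measurable_cst.
move=> Q; have := sqintZ c (sqint_rect Q).
by under eq_fun do rewrite mulrC.
Qed.

Lemma locsqintB u b : locsqint u -> locsqint b -> locsqint (fun z => u z - b z).
Proof.
move=> [mu su] [mb sb]; split; first exact: measurable_funB.
by move=> Q; under eq_fun do rewrite mulrBr; exact: sqintB.
Qed.

Lemma locint_locsqint u : locsqint u -> locint u.
Proof.
move=> su; have := locint_mul su (locsqint_cst 1).
by under eq_fun do rewrite mulr1.
Qed.

(** Jensen's inequality. The constant [c] is free because in the iteration over subrectangles it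
    remains the mean over the root. *)
Lemma sqr_mean_le u c Q : locsqint u ->
  (mean u Q - c) ^+ 2 <=
  (area R Q)^-1 * \int[mu2]_z (\1_(@rect R Q) z * (u z - c) ^+ 2).
Proof.
move=> su.
have [mv sv] := locsqintB su (locsqint_cst c).
have iu := (locint_locsqint su).2 Q.
have := CauchySchwarz_ip (sqint_rect Q) (sv Q).
rewrite ip_rect.
have -> : ip mu2 (fun z => \1_(@rect R Q) z * (u z - cst c z))
   (fun z => \1_(@rect R Q) z * (u z - cst c z)) =
   \int[mu2]_z (\1_(@rect R Q) z * (u z - c) ^+ 2).
  by apply: eq_Rintegral => z _; rewrite mulrACA indic_idem expr2.
have -> : ip mu2 (\1_(@rect R Q)) (fun z => \1_(@rect R Q) z * (u z - cst c z)) =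
   area R Q * (mean u Q - c).
  rewrite meanE mulrBr mulrA mulfV ?area_neq0// mul1r -[in RHS]Rintegral_rect.
  have i1 := integrable_rect Q.
  rewrite -RintegralZr// -RintegralB//.
    apply: eq_Rintegral => z _; rewrite mulrA indic_idem; exact: mulrBr.
  exact: (locint_locsqint (locsqint_cst c)).2 Q.
rewrite exprMn => h.
by rewrite ler_pdivlMl ?area_gt0// -(ler_pM2l (area_gt0 Q)) mulrA -expr2.
Qed.

(* P bisects either the second or the first side of a dyadic rectangle. *)
Section OneDirection.
Variable P : dyadic -> dyadic * dyadic.
Hypothesis P_split : (exists I, P = pair I) \/ (exists J, P = pair^~ J).

Lemma indic_split L z : \1_(@rect R (P L)) z =
  \1_(@rect R (P (right L))) z + \1_(@rect R (P (left L))) z :> R.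
Proof.
rewrite !indic_rect /tensor.
case: P_split => -[K ->] /=; rewrite (indic_children L); ring.
Qed.

Lemma area_split L : area R (P (right L)) = area R (P L) / 2 /\
  area R (P (left L)) = area R (P L) / 2.
Proof.
by case: P_split => -[K ->]; rewrite /area/= ?len_right ?len_left; split; ring.
Qed.

Lemma martingale_mean u : locint u -> martingale (fun L => mean u (P L)).
Proof.
move=> [_ iu] L; rewrite !meanE.
have [-> ->] := area_split L.
under eq_Rintegral do rewrite indic_split mulrDl.
rewrite RintegralD//; have := area_neq0 (P L) => h; field.
by rewrite h.
Qed.

Lemma Rintegral_split u L : locint u ->
  \int[mu2]_z (\1_(@rect R (P L)) z * u z) =
  \int[mu2]_z (\1_(@rect R (P (right L))) z * u z) +
  \int[mu2]_z (\1_(@rect R (P (left L))) z * u z).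
Proof.
move=> [_ iu]; rewrite -RintegralD//.
by apply: eq_Rintegral => z _; rewrite indic_split mulrDl.
Qed.

Lemma leaf_avg_sqr_mean u c n L : locsqint u ->
  leaf_avg n (fun L' => (mean u (P L') - c) ^+ 2) L <=
  (area R (P L))^-1 * \int[mu2]_z (\1_(@rect R (P L)) z * (u z - c) ^+ 2).
Proof.
move=> su; elim: n L => [|n IH] L /=; first exact: sqr_mean_le.
have sv := locsqintB su (locsqint_cst c).
rewrite Rintegral_split; last first.
  by have := locint_mul sv sv; under eq_fun do rewrite -expr2.
have := IH (right L); have := IH (left L).
have [-> ->] := area_split L; rewrite !invfM invrK !mulrDr; lra.
Qed.

Lemma mean_carleson b (be : R) n L : locsqint b ->
  (forall Q, \int[mu2]_z (\1_(@rect R Q) z * (b z - mean b Q) ^+ 2) <=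
     be * area R Q) ->
  tree_sum n (fun L => incr (fun L' => mean b (P L')) L ^+ 2) L <= be.
Proof.
move=> sb hb; set c := mean b (P L).
have := leaf_avg_sqr_mean c n L sb.
have -> : tree_sum n (fun L => incr (fun L' => mean b (P L')) L ^+ 2) L =
   tree_sum n (fun L => incr (fun L' => mean b (P L') - c) L ^+ 2) L.
  by apply: eq_tree_sum => K; congr (_ ^+ 2); rewrite /incr; lra.
rewrite leaf_avg_sqr; last first.
  by move=> K; rewrite (martingale_mean (locint_locsqint sb) K); lra.
rewrite {1}/c subrr expr0n add0r => h; apply: (le_trans h).
by rewrite ler_pdivrMl ?area_gt0// mulrC.
Qed.

End OneDirection.

Definition bounded_oscillation b (be : R) := locsqint b /\
  forall Q, \int[mu2]_z (\1_(@rect R Q) z * (b z - mean b Q) ^+ 2) <= be * area R Q.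

Lemma bmodP b : measurable_fun setT b ->
  bmod b <-> exists2 be : R, 0 < be & bounded_oscillation b be.
Proof.
move=> mb.
have E Q : (\int[mu2]_(z in @rect R Q) (`|b z - mean b Q| ^+ 2)%:E =
  \int[mu2]_z (\1_(@rect R Q) z * (b z - mean b Q) ^+ 2)%:E)%E.
  rewrite integral_mkcond; apply: eq_integral => z _.
  rewrite /patch indicE; case: ifP => _; rewrite ?mul1r ?mul0r//.
  by rewrite real_normK// num_real.
have mE Q : measurable_fun setT (fun z => \1_(@rect R Q) z * (b z - mean b Q)).
  apply: measurable_funM; last exact: measurable_funB.
  by apply: measurable_indic; exact: measurable_rect.
have sE Q z : (\1_(@rect R Q) z * (b z - mean b Q)) ^+ 2 =
    \1_(@rect R Q) z * (b z - mean b Q) ^+ 2.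
  by rewrite exprMn expr2 indic_idem.
split=> [hb|[be be0 [lb hb]]].
- pose N := bmod_norm b.
  have N0 : (0 <= N)%E.
    apply: (@le_trans _ _ ((area R (Dyadic 0 0, Dyadic 0 0))^-1%:E *
       \int[mu2]_(z in @rect R (Dyadic 0 0, Dyadic 0 0))
         (`|b z - mean b (Dyadic 0 0, Dyadic 0 0)| ^+ 2)%:E)%E).
      rewrite mule_ge0 ?lee_fin ?invr_ge0 ?(ltW (area_gt0 _))//.
      by apply: integral_ge0 => z _; rewrite lee_fin exprn_ge0.
    by apply: ereal_sup_ubound; exists (Dyadic 0 0, Dyadic 0 0).
  have Nfin : N \is a fin_num by rewrite ge0_fin_numE.
  have H Q : (\int[mu2]_z (\1_(@rect R Q) z * (b z - mean b Q) ^+ 2)%:E <=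
      (fine N * area R Q)%:E)%E.
    have : ((area R Q)^-1%:E *
       \int[mu2]_(z in @rect R Q) (`|b z - mean b Q| ^+ 2)%:E <= N)%E.
      by apply: ereal_sup_ubound; exists Q.
    rewrite E EFinM fineK// => h.
    by rewrite muleC -lee_pdivrMl// ?area_gt0.
  have s1 Q : sqint mu2 (fun z => \1_(@rect R Q) z * (b z - mean b Q)).
    split => //; apply/integrableP; split.
      by apply/measurable_EFinP; exact: measurable_funX.
    apply: le_lt_trans (ltry (fine N * area R Q)); apply: le_trans (H Q).
    rewrite le_eqVlt; apply/orP; left; apply/eqP; apply: eq_integral => z _ /=.
    by rewrite sE ger0_norm// mulr_ge0 ?sqr_ge0// indicE.
  (* The summand 1 keeps the constant positive when the norm is 0. *)
  exists (fine N + 1); first by rewrite ltr_wpDl ?fine_ge0.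
  split.
    split => // Q; have := sqintD (s1 Q) (sqintZ (mean b Q) (sqint_rect Q)).
    by under eq_fun do rewrite mulrBr (mulrC (mean _ _)) subrK.
  move=> Q; rewrite -lee_fin /Rintegral fineK; last first.
    apply: integrable_fin_num => //; case: (s1 Q) => _.
    by apply: eq_integrable => // z _; rewrite /= sE.
  apply: le_trans (H Q) _; rewrite lee_fin ler_wpM2r ?(ltW (area_gt0 _))//.
  by rewrite lerDl.
- rewrite /bmod; apply: (@le_lt_trans _ _ be%:E); last exact: ltry.
  apply: ge_ereal_sup => _ [Q _ <-]; rewrite E lee_pdivrMl ?area_gt0//.
  have /(_ Q) [_ ib] := (locsqintB lb (locsqint_cst (mean b Q))).2.
  have -> : (\int[mu2]_z (\1_(@rect R Q) z * (b z - mean b Q) ^+ 2)%:E =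
    (\int[mu2]_z (\1_(@rect R Q) z * (b z - mean b Q) ^+ 2))%:E)%E.
    rewrite /Rintegral fineK//; apply: integrable_fin_num => //.
    by apply: eq_integrable ib => // z _; rewrite /= sE.
  by rewrite -EFinM lee_fin mulrC; exact: hb.
Qed.

End Rectangles.

(** * The commutator form on Haar polynomials *)

Section Leaves.
Context (R : realType).

Lemma leaf_avg_martingale n (u : dyadic -> R) K :
  martingale u -> leaf_avg n u K = u K.
Proof. by move=> mu; elim: n K => [|n IH] K //=; rewrite !IH -mu. Qed.

Lemma eq_leaf_avg_scale n (u v : dyadic -> R) K :
  (forall L, scale L = scale K + n%:Z -> u L = v L) ->
  leaf_avg n u K = leaf_avg n v K.
Proof.
move=> uv; apply/eqP; rewrite -subr_eq0 -mulN1r -leaf_avgZ -leaf_avgD.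
by apply/eqP/leaf_avg_eq0 => L /uv ->; rewrite mulN1r subrr.
Qed.

Lemma martingale_sum (T : Type) (l : seq T) (u : T -> dyadic -> R) :
  (forall t, martingale (u t)) -> martingale (fun K => \sum_(t <- l) u t K).
Proof.
move=> mu K; rewrite -big_split /= mulr_suml; apply: eq_bigr => t _.
by rewrite (mu t K).
Qed.

Lemma incr_sum (T : Type) (l : seq T) (u : T -> dyadic -> R) K :
  incr (fun K => \sum_(t <- l) u t K) K = \sum_(t <- l) incr (u t) K.
Proof. by rewrite /incr -sumrB mulr_suml. Qed.

Lemma martingaleZ (a : R) u : martingale u -> martingale (fun K => a * u K).
Proof. by move=> mu K; rewrite (mu K); lra. Qed.

Lemma incrZ (a : R) u K : incr (fun K => a * u K) K = a * incr u K.
Proof. by rewrite /incr; lra. Qed.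

Section LinearCombination.
Variables (T : eqType) (l : seq T) (a : T -> R) (I : T -> dyadic).
Variables (r : dyadic) (n : nat).
(** One generation of room below the root: [coshift_avg] passes to the parent of [I t], whose Haar
    function must still have average zero on [r]. *)
Hypothesis Ir : forall t, t \in l -> scale r + 1 <= scale (I t).
Hypothesis In : forall t, t \in l -> scale (I t) < scale r + n%:Z.

Let lin (u : dyadic -> dyadic -> R) K := \sum_(t <- l) a t * u (I t) K.

Let lin_eq0 u K : (forall t, t \in l -> u (I t) K = 0) -> lin u K = 0.
Proof. by move=> u0; rewrite /lin big_seq big1// => t /u0 ->; rewrite mulr0. Qed.

Let incr_lin u K : incr (lin u) K = lin (fun J => incr (u J)) K.
Proof.
by rewrite [LHS]incr_sum; apply: eq_bigr => t _; rewrite incrZ.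
Qed.

Let martingale_lin u : (forall J, martingale (u J)) -> martingale (lin u).
Proof. by move=> mu; apply: martingale_sum => t; exact: martingaleZ. Qed.

Let incr_haar_lin_eq0 K : scale r + n%:Z <= scale K -> incr (lin (haar_avg R)) K = 0.
Proof.
move=> rK; rewrite incr_lin; apply: lin_eq0 => t /In tn; rewrite incr_haar_avg.
by case: eqP => [E|_]; [move: tn; rewrite -E; lia|rewrite mul0r].
Qed.

Let haar_lin_root J : scale r <= scale J -> haar_avg R J r = 0.
Proof. by rewrite /haar_avg => h; rewrite ltNge h. Qed.

Lemma shift_pair_lin :
  shift_pair (even_itv R) r n (lin (haar_avg R)) (lin (@shift_avg R)).
Proof.
split.
- by apply: martingale_lin => J; exact: martingale_haar_avg.
- by apply: martingale_lin => J; exact: martingale_shift_avg.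
- split.
  + apply: lin_eq0 => t /Ir rt; apply: haar_lin_root; lia.
  + apply: lin_eq0 => t /Ir rt.
    by rewrite /shift_avg !haar_lin_root ?subrr ?mulr0//=; lia.
  + rewrite incr_lin; apply: lin_eq0 => t /Ir rt.
    have -> : incr (@shift_avg R (I t)) r = (even_itv R (I t))%:R *
        (incr (haar_avg R (right_half (I t))) r -
         incr (haar_avg R (left_half (I t))) r).
      by rewrite /incr /shift_avg; lra.
    rewrite !incr_haar_avg; case: eqP => [E|_]; first by move: rt; rewrite E/=; lia.
    case: eqP => [E|_]; first by move: rt; rewrite E/=; lia.
    by rewrite !mul0r subrr mulr0.
- move=> K; rewrite !incr_lin; split.
    rewrite mulr_sumr; apply: eq_bigr => t _.
    by have [-> _] := incr_shift_avg R (I t) K; ring.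
  rewrite mulr_sumr -sumrN; apply: eq_bigr => t _.
  by have [_ ->] := incr_shift_avg R (I t) K; ring.
- exact: incr_haar_lin_eq0.
Qed.

Lemma coshift_pair_lin :
  coshift_pair (even_itv R) r n (lin (haar_avg R)) (lin (@coshift_avg R)).
Proof.
split.
- by apply: martingale_lin => J; exact: martingale_haar_avg.
- by apply: martingale_lin => J; exact: martingale_coshift_avg.
- split.
    apply: lin_eq0 => t /Ir rt; apply: haar_lin_root; lia.
  apply: lin_eq0 => t /Ir rt.
  by rewrite /coshift_avg haar_lin_root ?mulr0//=; lia.
- move=> K; rewrite !incr_lin /lin -sumrB mulr_sumr; apply: eq_bigr => t _.
  by rewrite incr_coshift_avg; ring.
- exact: incr_haar_lin_eq0.
Qed.

End LinearCombination.

End Leaves.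

(** * Haar polynomials on one rectangle, reduced to cell means *)

Section Polynomials.
Context (R : realType).
Implicit Types (I J K L : dyadic) (u b : plane R -> R).
Implicit Types (l : seq (R * (dyadic * dyadic))).
Local Notation mu1 := (mu1 R).
Local Notation mu2 := (mu2 R).

Definition lin_tensor (al be : dyadic -> line R -> R) l : plane R -> R :=
  fun z => \sum_(t <- l) t.1 * tensor (al t.2.1) (be t.2.2) z.

Definition lin_avg (al be : dyadic -> dyadic -> R) l K L : R :=
  \sum_(t <- l) t.1 * (al t.2.1 K * be t.2.2 L).

Definition haar_span := lin_tensor (haar R) (haar R).

Lemma sqint_lin_tensor al be l :
  (forall I, sqint mu1 (al I)) -> (forall I, sqint mu1 (be I)) ->
  sqint mu2 (lin_tensor al be l).
Proof.
by move=> sa sb; apply: sqint_sum => t; apply: sqintZ; exact: sqint_tensor.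
Qed.

Lemma lin_tensor_cell al be al' be' l N K L z :
  (forall t, t \in l -> forall K x, N <= scale K -> itv R K x ->
     al t.2.1 x = al' t.2.1 K) ->
  (forall t, t \in l -> forall L y, N <= scale L -> itv R L y ->
     be t.2.2 y = be' t.2.2 L) ->
  N <= scale K -> N <= scale L -> rect (K, L) z ->
  lin_tensor al be l z = lin_avg al' be' l K L.
Proof.
move=> hal hbe NK NL [/= zK zL]; rewrite /lin_tensor /lin_avg big_seq [RHS]big_seq.
by apply: eq_bigr => t tl; rewrite /tensor (hal t tl K)// (hbe t tl L).
Qed.

Lemma mean_cell b u c Q : locint b ->
  (forall z, rect Q z -> u z = c) -> mean (fun z => b z * u z) Q = mean b Q * c.
Proof.
move=> [_ ib] uc; rewrite !meanE -mulrA; congr (_ * _).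
rewrite -RintegralZr//; apply: eq_Rintegral => z _; rewrite indicE.
case: (boolP (z \in rect Q)) => [|_]; last by rewrite !mul0r.
by rewrite inE => /uc ->; rewrite mulrA.
Qed.

Lemma mean_cst u c Q : (forall z, rect Q z -> u z = c) -> mean u Q = c.
Proof.
move=> uc; have l1 : locint (cst 1 : plane R -> R) by exact/locint_locsqint/locsqint_cst.
have := mean_cell l1 uc; under eq_fun do rewrite mul1r.
move=> ->; rewrite meanE; under eq_Rintegral do rewrite mulr1.
by rewrite Rintegral_rect mulVf ?mul1r// area_neq0.
Qed.

(** Means over rectangles are martingales in each side separately, so the rectangle is refined first
    in one variable and then in the other, down to cells on which the mean is known. *)
Lemma mean_leaf_avg u (v : dyadic -> dyadic -> R) r r' n : locint u ->
  (forall K L, scale K = scale r + n%:Z -> scale L = scale r' + n%:Z ->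
     mean u (K, L) = v K L) ->
  mean u (r, r') = leaf_avg n (fun K => leaf_avg n (v K) r') r.
Proof.
move=> iu uv.
rewrite -(@leaf_avg_martingale _ n (fun K => mean u (K, r'))); last first.
  by apply: (@martingale_mean _ (pair^~ r')) => //; right; exists r'.
apply: eq_leaf_avg_scale => K sK.
rewrite -(@leaf_avg_martingale _ n (fun L => mean u (K, L))); last first.
  by apply: (@martingale_mean _ (pair K)) => //; left; exists K.
by apply: eq_leaf_avg_scale => L sL; exact: uv.
Qed.

Definition bounded_plane_fun u := exists C : R, forall z, `|u z| <= C.

Lemma haar_bounded I x : `|haar R I x| <= (Num.sqrt (len R I))^-1.
Proof.
have h : 0 <= (Num.sqrt (len R I))^-1 by rewrite invr_ge0 sqrtr_ge0.
have [/itv_children[/haar_right|/haar_left]|/haar_out] := pselect (itv R I x) => ->.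
- by rewrite ger0_norm.
- by rewrite normrN ger0_norm.
- by rewrite normr0.
Qed.

Lemma lin_tensor_bounded al be l :
  (forall I, exists C : R, forall x, `|al I x| <= C) ->
  (forall I, exists C : R, forall x, `|be I x| <= C) ->
  bounded_plane_fun (lin_tensor al be l).
Proof.
move=> ba bb; elim: l => [|t l [C hC]].
  by exists 0 => z; rewrite /lin_tensor big_nil normr0.
have [A hA] := ba t.2.1; have [B hB] := bb t.2.2.
exists (`|t.1| * (A * B) + C) => z; rewrite /lin_tensor big_cons.
apply: (le_trans (ler_normD _ _)); apply: lerD (hC z).
rewrite normrM ler_wpM2l// /tensor normrM; apply: ler_pM => //.
Qed.

Lemma sqint_bounded_mul u v : bounded_plane_fun u -> measurable_fun setT u ->
  sqint mu2 v -> sqint mu2 (fun z => u z * v z).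
Proof.
move=> [C hC] mu sv; apply: sqint_le (sqintZ C sv) _.
  by apply: measurable_funM => //; case: sv.
by move=> z; rewrite !normrM ler_wpM2r//; apply: le_trans (hC z) (ler_norm _).
Qed.

Lemma locsqint_bounded_mul u v : bounded_plane_fun u -> measurable_fun setT u ->
  locsqint v -> locsqint (fun z => u z * v z).
Proof.
move=> bu mu [mv sv]; split; first exact: measurable_funM.
move=> Q; have := sqint_bounded_mul bu mu (sv Q).
by under eq_fun do rewrite mulrCA.
Qed.

Lemma haar_bounded_ex I : exists C : R, forall x, `|haar R I x| <= C.
Proof. by eexists => x; exact: haar_bounded. Qed.

Lemma shift_bounded I : exists C : R, forall x, `|@shift_haar R I x| <= C.
Proof.
have [A hA] := haar_bounded_ex (right_half I).
have [B hB] := haar_bounded_ex (left_half I).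
exists (1 * (A + B)) => x; rewrite /shift_haar normrM; apply: ler_pM => //.
  by case: (even_itv R I); rewrite ?normr1 ?normr0.
by apply: (le_trans (ler_normB _ _)); exact: lerD.
Qed.

Lemma coshift_bounded I : exists C : R, forall x, `|@coshift_haar R I x| <= C.
Proof.
have [A hA] := haar_bounded_ex (parent I).
exists (1 * A) => x; rewrite /coshift_haar normrM; apply: ler_pM => //.
by case: (even_itv R _); case: ifP => _; rewrite ?mul0r ?mul1r ?normrN ?normr1 ?normr0.
Qed.

(** The margin of one generation is dictated by [shift_cell], where the halves of [I] must still be
    coarser than the cell; it is shared by all three facts so that one depth [N] serves them. *)
Let haar_cell I N K x : scale I + 1 < N -> N <= scale K -> itv R K x ->
  haar R I x = haar_avg R I K.
Proof. by move=> IN NK; apply: haar_avgE; lia. Qed.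

Let shift_cell I N K x : scale I + 1 < N -> N <= scale K -> itv R K x ->
  @shift_haar R I x = @shift_avg R I K.
Proof.
move=> IN NK Kx; rewrite /shift_haar /shift_avg.
by rewrite !(@haar_avgE _ _ K)//=; lia.
Qed.

Let coshift_cell I N K x : scale I + 1 < N -> N <= scale K -> itv R K x ->
  @coshift_haar R I x = @coshift_avg R I K.
Proof.
move=> IN NK Kx; rewrite /coshift_haar /coshift_avg.
by rewrite !(@haar_avgE _ _ K)//=; lia.
Qed.

(** The integrand of $\langle[\mathbf T,b]f,g\rangle$ after the outer $\mathbf T$ has been moved
    onto $g$: everything that multiplies [b] is now an explicit step function. *)
Definition commutator_form b lf lg : plane R -> R := fun z =>
  b z * (haar_span lf z * lin_tensor (@coshift_haar R) (@coshift_haar R) lg z) -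
  b z * (lin_tensor (@shift_haar R) (@shift_haar R) lf z * haar_span lg z).

Lemma measurable_lin_tensor al be l :
  (forall I, sqint mu1 (al I)) -> (forall I, sqint mu1 (be I)) ->
  measurable_fun setT (lin_tensor al be l).
Proof. by move=> sa sb; have [] := sqint_lin_tensor l sa sb. Qed.

Hint Resolve haar_bounded_ex shift_bounded coshift_bounded sqint_haar
  sqint_shift_haar sqint_coshift_haar : core.

Lemma locint_form1 b lf lg : locsqint b -> locint (fun z => b z *
    (haar_span lf z * lin_tensor (@coshift_haar R) (@coshift_haar R) lg z)).
Proof.
move=> lb; apply: locint_mul => //; apply: locsqint_bounded_mul.
- exact: lin_tensor_bounded.
- exact: measurable_lin_tensor.
- by apply: locsqint_sqint; exact: sqint_lin_tensor.
Qed.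

Lemma locint_form2 b lf lg : locsqint b -> locint (fun z => b z *
    (lin_tensor (@shift_haar R) (@shift_haar R) lf z * haar_span lg z)).
Proof.
move=> lb; apply: locint_mul => //; apply: locsqint_bounded_mul.
- exact: lin_tensor_bounded.
- exact: measurable_lin_tensor.
- by apply: locsqint_sqint; exact: sqint_lin_tensor.
Qed.

Lemma locint_commutator_form b lf lg : locsqint b ->
  locint (commutator_form b lf lg).
Proof.
move=> lb; have [m1 i1] := locint_form1 lf lg lb; have [m2 i2] := locint_form2 lf lg lb.
split; first exact: measurable_funB.
move=> Q; apply: eq_integrable (integrableB measurableT (i1 Q) (i2 Q)) => //.
by move=> z _; rewrite /= -EFinB -mulrBr.
Qed.

Lemma locint_haar_span_sqr l : locint (fun z => haar_span l z ^+ 2).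
Proof.
have sp : locsqint (haar_span l) by apply: locsqint_sqint; exact: sqint_lin_tensor.
by have := locint_mul sp sp; under eq_fun do rewrite -expr2.
Qed.

(** At generation [n.+1] below the root all factors other than [b] are constant on cells, so [b]
    enters only through its cell means, and the claim is [tree_commutator2] multiplied by the area
    of the root. *)
Lemma root_estimate b (be : R) r r' n lf lg : 0 < be ->
  bounded_oscillation b be ->
  (forall t, t \in lf ++ lg -> [/\ scale r + 1 <= scale t.2.1,
     scale t.2.1 < scale r + n%:Z, scale r' + 1 <= scale t.2.2 &
     scale t.2.2 < scale r' + n%:Z]) -> scale r = scale r' ->
  `|\int[mu2]_z (\1_(rect (r, r')) z * commutator_form b lf lg z)| <=
  4 * (13 * be + 5) * (\int[mu2]_z (\1_(rect (r, r')) z * haar_span lf z ^+ 2) +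
                       \int[mu2]_z (\1_(rect (r, r')) z * haar_span lg z ^+ 2)).
Proof.
move=> be0 [lb ob] hl rr'.
have hf t : t \in lf -> [/\ scale r + 1 <= scale t.2.1,
     scale t.2.1 < scale r + n%:Z, scale r' + 1 <= scale t.2.2 &
     scale t.2.2 < scale r' + n%:Z].
  by move=> tl; apply: hl; rewrite mem_cat tl.
have hg t : t \in lg -> [/\ scale r + 1 <= scale t.2.1,
     scale t.2.1 < scale r + n%:Z, scale r' + 1 <= scale t.2.2 &
     scale t.2.2 < scale r' + n%:Z].
  by move=> tl; apply: hl; rewrite mem_cat tl orbT.
pose N := scale r + n.+1%:Z.
pose f := lin_avg (haar_avg R) (haar_avg R) lf.
pose f1 := lin_avg (@shift_avg R) (haar_avg R) lf.
pose f12 := lin_avg (@shift_avg R) (@shift_avg R) lf.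
pose g := lin_avg (haar_avg R) (haar_avg R) lg.
pose g2 := lin_avg (haar_avg R) (@coshift_avg R) lg.
pose g12 := lin_avg (@coshift_avg R) (@coshift_avg R) lg.
pose B K L := mean b (K, L).
have lib := locint_locsqint lb.
have fE K L z : N <= scale K -> N <= scale L -> rect (K, L) z ->
    haar_span lf z = f K L.
  apply: lin_tensor_cell => t /hf[? ? ? ?] ? ?; apply: haar_cell; rewrite /N; lia.
have f12E K L z : N <= scale K -> N <= scale L -> rect (K, L) z ->
    lin_tensor (@shift_haar R) (@shift_haar R) lf z = f12 K L.
  apply: lin_tensor_cell => t /hf[? ? ? ?] ? ?; apply: shift_cell; rewrite /N; lia.
have gE K L z : N <= scale K -> N <= scale L -> rect (K, L) z ->
    haar_span lg z = g K L.
  apply: lin_tensor_cell => t /hg[? ? ? ?] ? ?; apply: haar_cell; rewrite /N; lia.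
have g12E K L z : N <= scale K -> N <= scale L -> rect (K, L) z ->
    lin_tensor (@coshift_haar R) (@coshift_haar R) lg z = g12 K L.
  apply: lin_tensor_cell => t /hg[? ? ? ?] ? ?; apply: coshift_cell; rewrite /N; lia.
have i1 := locint_form1 lf lg lb; have i2 := locint_form2 lf lg lb.
have isq := locint_haar_span_sqr.
have m1 : mean (fun z => b z * (haar_span lf z *
    lin_tensor (@coshift_haar R) (@coshift_haar R) lg z)) (r, r') =
   leaf_avg n.+1 (fun K => leaf_avg n.+1 (fun L => B K L * f K L * g12 K L) r') r.
  apply: mean_leaf_avg => // K L sK sL; rewrite -mulrA; apply: mean_cell => // z zQ.
  by rewrite (fE K L z) ?(g12E K L z)// /N; lia.
have m2 : mean (fun z => b z * (lin_tensor (@shift_haar R) (@shift_haar R) lf z *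
    haar_span lg z)) (r, r') =
   leaf_avg n.+1 (fun K => leaf_avg n.+1 (fun L => B K L * f12 K L * g K L) r') r.
  apply: mean_leaf_avg => // K L sK sL; rewrite -mulrA; apply: mean_cell => // z zQ.
  by rewrite (f12E K L z) ?(gE K L z)// /N; lia.
have m3 : mean (fun z => haar_span lf z ^+ 2) (r, r') =
   leaf_avg n.+1 (fun K => leaf_avg n.+1 (fun L => f K L ^+ 2) r') r.
  apply: mean_leaf_avg => // K L sK sL.
  by apply: mean_cst => z zQ; rewrite (fE K L z)// /N; lia.
have m4 : mean (fun z => haar_span lg z ^+ 2) (r, r') =
   leaf_avg n.+1 (fun K => leaf_avg n.+1 (fun L => g K L ^+ 2) r') r.
  apply: mean_leaf_avg => // K L sK sL.
  by apply: mean_cst => z zQ; rewrite (gE K L z)// /N; lia.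
have lin1 (al be' : dyadic -> dyadic -> R) l L :
    (lin_avg al be' l)^~ L =
    (fun K => \sum_(t <- l) (t.1 * be' t.2.2 L) * al t.2.1 K).
  by apply/funext => K; apply: eq_bigr => t _; ring.
have lin2 (al be' : dyadic -> dyadic -> R) l K :
    lin_avg al be' l K =
    (fun L => \sum_(t <- l) (t.1 * al t.2.1 K) * be' t.2.2 L).
  by apply/funext => L; apply: eq_bigr => t _; ring.
have key : `|leaf_avg n.+1 (fun K => leaf_avg n.+1 (fun L => B K L * f K L * g12 K L) r') r -
   leaf_avg n.+1 (fun K => leaf_avg n.+1 (fun L => B K L * f12 K L * g K L) r') r| <=
   4 * (13 * be + 5) *
    (leaf_avg n.+1 (fun K => leaf_avg n.+1 (fun L => f K L ^+ 2) r') r +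
     leaf_avg n.+1 (fun K => leaf_avg n.+1 (fun L => g K L ^+ 2) r') r).
  apply: (@tree_commutator2 _ (even_itv R) B be r r' n f f1 f12 g g2 g12) => //.
  - by move=> K; apply: (@martingale_mean _ (pair K)) => //; left; exists K.
  - by move=> L; apply: (@martingale_mean _ (pair^~ L)) => //; right; exists L.
  - by move=> K m L; apply: (@mean_carleson _ (pair K)) => //; left; exists K.
  - by move=> L m K; apply: (@mean_carleson _ (pair^~ L)) => //; right; exists L.
  - move=> L; rewrite /f /f1 !lin1; apply: shift_pair_lin => t /hf[? ? ? ?]//.
  - move=> K; rewrite /f1 /f12 !lin2; apply: shift_pair_lin => t /hf[? ? ? ?]//.
  - move=> K; rewrite /g /g2 !lin2; apply: coshift_pair_lin => t /hg[? ? ? ?]//.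
  - move=> L; rewrite /g2 /g12 !lin1; apply: coshift_pair_lin => t /hg[? ? ? ?]//.
move: key; rewrite -m1 -m2 -m3 -m4 !meanE -mulrBr -mulrDr normrM.
have a0 := area_gt0 R (r, r').
rewrite gtr0_norm ?invr_gt0// mulrCA ler_pM2l ?invr_gt0// => key.
apply: le_trans key; rewrite -RintegralB//; [|exact: i1.2|exact: i2.2].
by rewrite le_eqVlt; apply/orP; left; apply/eqP; congr `|_|; apply: eq_Rintegral => z _;
  rewrite /commutator_form mulrBr.
Qed.

End Polynomials.

(** * Reduction of the plane to four root squares *)

Section Roots.
Context (R : realType).
Implicit Types (I J K L : dyadic) (u b : plane R -> R).
Local Notation mu2 := (mu2 R).

(** The intervals $[0,2^m)$ and $[-2^m,0)$. No dyadic interval contains points on both sides of 0,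
    so two roots are needed on the line and four in the plane. *)
Definition root_itv (m : nat) (s : bool) := Dyadic (- m%:Z) (if s then 0 else -1).

Lemma iter_parent_scale n I : scale (iter n parent I) = scale I - n%:Z.
Proof. by elim: n => [|n IH] /=; [|rewrite IH]; lia. Qed.

(** The range, linear in [n] where $2^n$ would be possible, is mapped by halving into the range for
    [n - 1], and the ancestor can be taken as high as desired. *)
Lemma iter_parent_pos n I : - n%:Z - 1 <= pos I <= n%:Z ->
  pos (iter n parent I) = if 0 <= pos I then 0 else -1.
Proof.
elim: n I => [|n IH] I.
  by case: I => s p /= /andP[h h']; case: leP => hp; lia.
rewrite iterSr; case: I => s p /= /andP[h h']; rewrite IH /=; last by lia.
by have [] := leP 0 p; have [] := leP 0 (p %/ 2)%Z; lia.
Qed.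

Lemma itv_root m I x : (`|pos I| + `|scale I| <= m)%N -> itv R I x ->
  exists s, itv R (root_itv m s) x.
Proof.
move=> hm Ix; exists (0 <= pos I).
have [n En] : exists n : nat, n%:Z = scale I + m%:Z.
  by exists `|(scale I + m%:Z)%R|%N; lia.
suff -> : root_itv m (0 <= pos I) = iter n parent I.
  by elim: n {En} => //= n; exact: itv_parent.
have := iter_parent_scale n I; have := @iter_parent_pos n I.
case: (iter n parent I) => s p /= -> => [->|]; rewrite /root_itv; [congr Dyadic|]; lia.
Qed.

Lemma root_disjoint m x : itv R (root_itv m true) x -> itv R (root_itv m false) x -> False.
Proof. by move=> h h'; have := @itv_inj R _ _ x _ h h' => /(_ erefl) []. Qed.

Definition in_roots (m : nat) (x : line R) :=
  itv R (root_itv m true) x \/ itv R (root_itv m false) x.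

Lemma indic_roots m x : in_roots m x ->
  \1_(itv R (root_itv m true)) x + \1_(itv R (root_itv m false)) x = 1 :> R.
Proof.
rewrite !indicE => -[h|h]; rewrite (mem_set h) memNset ?addr0 ?add0r// => h'.
  exact: root_disjoint h h'.
exact: root_disjoint h' h.
Qed.

Lemma Rintegral_roots m u : locint u ->
  (forall z, u z != 0 -> in_roots m z.1 /\ in_roots m z.2) ->
  \int[mu2]_z u z =
  \int[mu2]_z (\1_(rect (root_itv m true, root_itv m true)) z * u z) +
  \int[mu2]_z (\1_(rect (root_itv m true, root_itv m false)) z * u z) +
  (\int[mu2]_z (\1_(rect (root_itv m false, root_itv m true)) z * u z) +
   \int[mu2]_z (\1_(rect (root_itv m false, root_itv m false)) z * u z)).
Proof.
move=> [_ iu] hu; rewrite -!RintegralD//; last 2 first.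
- exact: (integrableD measurableT (iu _) (iu _)).
- exact: (integrableD measurableT (iu _) (iu _)).
apply: eq_Rintegral => z _; rewrite !indic_rect /tensor /=.
have [->|/hu[/indic_roots h1 /indic_roots h2]] := eqVneq (u z) 0.
  by rewrite !mulr0 !addr0.
rewrite -!mulrDl.
set a := \1__ _ in h1 *; set a' := \1__ _ in h1 *.
set c := \1__ _ in h2 *; set c' := \1__ _ in h2 *.
have -> : a * c + a * c' + (a' * c + a' * c') = (a + a') * (c + c') by ring.
by rewrite h1 h2 !mul1r.
Qed.

Lemma eventually_all (T : eqType) (l : seq T) (P : T -> nat -> Prop) :
  (forall t, exists M, forall m, (M <= m)%N -> P t m) ->
  exists M, forall m, (M <= m)%N -> forall t, t \in l -> P t m.
Proof.
move=> H; elim: l => [|t l [M hM]]; first by exists 0%N.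
have [M' hM'] := H t; exists (maxn M M') => m hm t'.
rewrite inE => /predU1P[->|]; first by apply: hM'; lia.
by apply: hM; lia.
Qed.

Lemma lin_tensor_neq0 al be (l : seq (R * (dyadic * dyadic))) m z :
  (forall t, t \in l -> forall x, al t.2.1 x != 0 -> in_roots m x) ->
  (forall t, t \in l -> forall x, be t.2.2 x != 0 -> in_roots m x) ->
  lin_tensor al be l z != 0 -> in_roots m z.1 /\ in_roots m z.2.
Proof.
move=> ha hb h; have /hasP[t tl] : has (fun t => tensor (al t.2.1) (be t.2.2) z != 0) l.
  apply: contraNT h => /hasPn h; rewrite /lin_tensor big_seq big1// => t /h.
  by move/negPn/eqP ->; rewrite mulr0.
rewrite /tensor mulf_eq0 negb_or => /andP[ax ay].
by split; [exact: ha ax|exact: hb ay].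
Qed.

(** For [m] large the root squares contain the supports of both polynomials, with a generation to
    spare. Both sides are then sums of integrals over the four squares, and the estimates add with
    the same constant. *)
Lemma commutator_form_bound b (be : R) lf lg : 0 < be ->
  bounded_oscillation b be ->
  `|\int[mu2]_z commutator_form b lf lg z| <=
  4 * (13 * be + 5) * (ip mu2 (haar_span lf) (haar_span lf) +
                       ip mu2 (haar_span lg) (haar_span lg)).
Proof.
move=> be0 ob; have lb := ob.1.
pose P I (m : nat) := (forall x, itv R I x -> in_roots m x) /\
  - m%:Z + 1 <= scale I.
have HP I : exists M, forall m, (M <= m)%N -> P I m.
  exists (`|pos I| + `|scale I| + 1)%N => m hm; split; last by lia.
  by move=> x Ix; have [|[] h] := @itv_root m I x _ Ix; [lia|left|right].
have HP2 (t : R * (dyadic * dyadic)) : exists M, forall m, (M <= m)%N -> P t.2.1 m /\ P t.2.2 m.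
  have [M hM] := HP t.2.1; have [M' hM'] := HP t.2.2; exists (maxn M M') => m hm.
  by split; [apply: hM; lia|apply: hM'; lia].
have [m hm'] := eventually_all (lf ++ lg) HP2; have {hm'} hm := hm' _ (leqnn m).
have HN (t : R * (dyadic * dyadic)) : exists M, forall n : nat, (M <= n)%N ->
    scale t.2.1 < - m%:Z + n%:Z /\ scale t.2.2 < - m%:Z + n%:Z.
  by exists (`|scale t.2.1| + `|scale t.2.2| + m + 1)%N => n hn; lia.
have [n hn'] := eventually_all (lf ++ lg) HN; have {hn'} hn := hn' _ (leqnn n).
have haar_in I : P I m -> forall x, haar R I x != 0 -> in_roots m x.
  move=> [h _] x; have [Ix _|/haar_out ->] := pselect (itv R I x); last by rewrite eqxx.
  exact: h.
have hf t : t \in lf -> P t.2.1 m /\ P t.2.2 m.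
  by move=> tl; apply: hm; rewrite mem_cat tl.
have hg t : t \in lg -> P t.2.1 m /\ P t.2.2 m.
  by move=> tl; apply: hm; rewrite mem_cat tl orbT.
have zf z : haar_span lf z != 0 -> in_roots m z.1 /\ in_roots m z.2.
  by apply: lin_tensor_neq0 => t /hf[? ?]; exact: haar_in.
have zg z : haar_span lg z != 0 -> in_roots m z.1 /\ in_roots m z.2.
  by apply: lin_tensor_neq0 => t /hg[? ?]; exact: haar_in.
have isq := @locint_haar_span_sqr R.
have ipE (l : seq (R * (dyadic * dyadic))) : ip mu2 (haar_span l) (haar_span l) = \int[mu2]_z (haar_span l z ^+ 2).
  by apply: eq_Rintegral => z _; rewrite expr2.
rewrite !ipE (@Rintegral_roots m _ (isq lf)); last first.
  by move=> z h; apply: zf; apply: contra h => /eqP ->; rewrite expr0n.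
rewrite (@Rintegral_roots m _ (isq lg)); last first.
  by move=> z h; apply: zg; apply: contra h => /eqP ->; rewrite expr0n.
rewrite (@Rintegral_roots m); last 2 first.
- exact: locint_commutator_form.
- move=> z h; have [fz|] := eqVneq (haar_span lf z) 0; last exact: zf.
  have [gz|] := eqVneq (haar_span lg z) 0; last exact: zg.
  by move: h; rewrite /commutator_form fz gz mul0r !mulr0 subr0 eqxx.
have E s s' := @root_estimate R b be (root_itv m s) (root_itv m s') n lf lg be0 ob.
have {E} E s s' : `|\int[mu2]_z (\1_(rect (root_itv m s, root_itv m s')) z * commutator_form b lf lg z)| <=
  4 * (13 * be + 5) * (\int[mu2]_z (\1_(rect (root_itv m s, root_itv m s')) z * haar_span lf z ^+ 2) +
                       \int[mu2]_z (\1_(rect (root_itv m s, root_itv m s')) z * haar_span lg z ^+ 2)).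
  apply: E => // t tl; have [[_ ?] [_ ?]] := hm t tl; have [? ?] := hn t tl.
  by split.
have := E true true; have := E true false; have := E false true; have := E false false.
set x1 := \int[mu2]_z _; set x2 := \int[mu2]_z _; set x3 := \int[mu2]_z _.
set x4 := \int[mu2]_z _; set x5 := \int[mu2]_z _; set x6 := \int[mu2]_z _.
set x7 := \int[mu2]_z _; set x8 := \int[mu2]_z _; set x9 := \int[mu2]_z _.
set y1 := \int[mu2]_z _; set y2 := \int[mu2]_z _; set y3 := \int[mu2]_z _.
move=> e1 e2 e3 e4.
have tri (x y : R) : `|x + y| <= `|x| + `|y| by exact: ler_normD.
apply: (le_trans (tri _ _)); apply: (le_trans (lerD (tri _ _) (tri _ _))).
set C := 4 * _ in e1 e2 e3 e4 *.
apply: (le_trans (lerD (lerD e4 e3) (lerD e2 e1))).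
by rewrite -!mulrDr le_eqVlt; apply/orP; left; apply/eqP; congr (_ * _); ring.
Qed.

End Roots.

(** * Density of step functions and of Haar polynomials *)

Section DyadicGenerate.
Context (R : realType).

Definition dyadic_sets : set (set (line R)) :=
  [set A | A = set0 \/ exists I, A = itv R I].

Lemma dyadic_setI I K : [\/ itv R I `&` itv R K = set0,
  itv R I `&` itv R K = itv R I /\ (exists n, iter n parent I = K) |
  itv R I `&` itv R K = itv R K /\ (exists n, iter n parent K = I)].
Proof.
have anc n J x : itv R J x -> itv R (iter n parent J) x.
  by elim: n => //= n IH /IH; exact: itv_parent.
have [[x [Ix Kx]]|h] := pselect (exists x, itv R I x /\ itv R K x); last first.
  by apply: Or31; apply/seteqP; split => // x [? ?]; apply: h; exists x.
have [KI|IK] := leP (scale K) (scale I).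
  apply: Or32; have E : iter `|(scale I - scale K)%R| parent I = K.
    apply: (@itv_inj R _ _ x) => //; last exact: anc.
    by rewrite iter_parent_scale; lia.
  split; last by eexists; exact: E.
  by apply/setIidPl => y; rewrite -[in X in _ -> X]E; exact: anc.
apply: Or33; have E : iter `|(scale K - scale I)%R| parent K = I.
  apply: (@itv_inj R _ _ x) => //; last exact: anc.
  by rewrite iter_parent_scale; lia.
split; last by eexists; exact: E.
by apply/setIidPr => y; rewrite -[in X in _ -> X]E; exact: anc.
Qed.

Lemma setI_closed_dyadic_sets : setI_closed dyadic_sets.
Proof.
move=> A B [->|[I ->]] [->|[K ->]]; rewrite ?set0I ?setI0; try by left.
by have [->|[-> _]|[-> _]] := dyadic_setI I K; [left|right; exists I|right; exists K].
Qed.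

Lemma small_dyadic (x y : R) : x < y ->
  exists2 I, itv R I y & itv R I `<=` [set w | x < w].
Proof.
move=> xy; pose n := (Num.truncn (y - x)^-1).+1.
have n2 : (2 : R) ^- n < y - x.
  rewrite -[y - x]invrK ltf_pV2 ?posrE ?invr_gt0 ?subr_gt0 ?exprn_gt0//.
  apply: (lt_trans (truncnS_gt _)); rewrite -/n -natrX ltr_nat.
  exact: ltn_expl.
pose I := Dyadic n%:Z (Num.floor (y * 2 ^ n%:Z)).
exists I; first exact/itvE.
move=> w Iw; have := itvE I w; have : itv R I y by exact/itvE.
move: Iw; rewrite /itv /= !in_itv /=.
have -> : len R I = 2 ^- n by rewrite /len/= -invr_expz.
rewrite rmorphD/= mulrDl mul1r; move: n2; set c := _ * _; lra.
Qed.

Lemma measurable_dyadic : @measurable _ (line R) = <<s dyadic_sets >>.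
Proof.
rewrite eqEsubset; split => A; last first.
  apply: smallest_sub; first exact: sigma_algebra_measurable.
  by move=> _ [->|[I ->]] //; exact: measurable_itv.
rewrite [X in X _](_ : _ = <<s RGenOInfty.G (R:=R) >>); last first.
  exact: RGenOInfty.measurableE.
apply: smallest_sub; first exact: smallest_sigma_algebra.
move=> _ [x ->].
(* The open ray is the union of the dyadic intervals inside it, enumerated by decoding [n] as a pair
   of scale and position. *)
pose F (n : nat) : set (line R) :=
  if @unpickle (int * int)%type n is Some (s, p) then
    if `[< itv R (Dyadic s p) `<=` [set w | x < w] >] then itv R (Dyadic s p) else set0
  else set0.
have -> : `]x, +oo[%classic = \bigcup_n F n.
  apply/seteqP; split => [y|y [n _]].
    rewrite /= in_itv/= andbT => xy; have [[s p] Iy Isub] := small_dyadic xy.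
    by exists (pickle (s, p)) => //; rewrite /F pickleK asboolT.
  rewrite /F; case: unpickle => [[s p]|//]; case: asboolP => // sub /sub.
  by rewrite /= in_itv/= andbT.
have [_ _] := smallest_sigma_algebra setT dyadic_sets; apply => n.
apply: sub_sigma_algebra; rewrite /F; case: unpickle => [[s p]|]; last by left.
by case: asboolP => _; [right; eexists|left].
Qed.

End DyadicGenerate.

(** * Approximation in the domain of the commutator *)

Section WeightedClosure.
Context (R : realType).
Local Notation mu2 := (mu2 R).
Variables (b : plane R -> R) (S : (plane R -> R) -> Prop).
Hypothesis mb : measurable_fun setT b.

Definition admissible (u : plane R -> R) :=
  sqint mu2 u /\ sqint mu2 (fun z => b z * u z).

(* The square of the norm of L^2((1 + b^2) dz). *)
Definition weighted (u : plane R -> R) : R :=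
  ip mu2 u u + ip mu2 (fun z => b z * u z) (fun z => b z * u z).

Definition approximable u := admissible u /\
  forall eps, 0 < eps -> exists2 s, S s & weighted (fun z => u z - s z) < eps.

Hypothesis S_admissible : forall s, S s -> admissible s.
Hypothesis S_D : forall s t, S s -> S t -> S (fun z => s z + t z).
Hypothesis S_Z : forall c s, S s -> S (fun z => c * s z).
Hypothesis S_0 : S (fun=> 0).

Implicit Types (u v s t : plane R -> R).

Lemma admissibleD u v : admissible u -> admissible v ->
  admissible (fun z => u z + v z).
Proof.
move=> [su sbu] [sv sbv]; split; first exact: sqintD.
by under eq_fun do rewrite mulrDr; exact: sqintD.
Qed.

Lemma admissibleZ c u : admissible u -> admissible (fun z => c * u z).
Proof.
move=> [su sbu]; split; first exact: sqintZ.
by under eq_fun do rewrite mulrCA; exact: sqintZ.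
Qed.

Lemma admissibleB u v : admissible u -> admissible v ->
  admissible (fun z => u z - v z).
Proof.
move=> au av; have := admissibleD au (admissibleZ (-1) av).
by under eq_fun do rewrite mulN1r.
Qed.

Lemma admissible_le u v : measurable_fun setT u -> admissible v ->
  (forall z, `|u z| <= `|v z|) -> admissible u.
Proof.
move=> mu [sv sbv] uv; split; first exact: sqint_le sv uv.
apply: sqint_le sbv _; first exact: measurable_funM.
by move=> z; rewrite !normrM ler_wpM2l.
Qed.

Lemma weightedD u v : admissible u -> admissible v ->
  weighted (fun z => u z + v z) <= 2 * weighted u + 2 * weighted v.
Proof.
move=> [su sbu] [sv sbv]; rewrite /weighted.
have := ip_sqrD su sv; have := ip_sqrD sbu sbv.
have -> : (fun z => b z * u z + b z * v z) = (fun z => b z * (u z + v z)).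
  by apply/funext => z; rewrite mulrDr.
lra.
Qed.

Lemma weightedZ c u : admissible u ->
  weighted (fun z => c * u z) = c ^+ 2 * weighted u.
Proof.
move=> [su sbu]; rewrite /weighted mulrDr ipZZ//.
have -> : (fun z => b z * (c * u z)) = (fun z => c * (b z * u z)).
  by apply/funext => z; rewrite mulrCA.
by rewrite ipZZ.
Qed.

Lemma weighted_ge0 u : 0 <= weighted u.
Proof. by rewrite addr_ge0 ?ip_ge0. Qed.

Lemma approximable_S s : S s -> approximable s.
Proof.
move=> Ss; split; first exact: S_admissible.
move=> eps eps0; exists s => //.
have -> : (fun z => s z - s z) = (fun=> 0) by apply/funext => z; rewrite subrr.
rewrite /weighted ip0l add0r.
by under [X in ip _ _ X]eq_fun do rewrite mulr0; rewrite ipC ip0l.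
Qed.

Lemma approximable_weighted u : admissible u ->
  (forall eps, 0 < eps -> exists2 v, approximable v &
     weighted (fun z => u z - v z) < eps) ->
  approximable u.
Proof.
move=> au H; split => // eps eps0.
have e4 : 0 < eps / 4 by rewrite divr_gt0.
have [v [av Hv] uv] := H _ e4; have [s Ss vs] := Hv _ e4; exists s => //.
have as_ := S_admissible Ss.
have := weightedD (admissibleB au av) (admissibleB av as_).
have -> : (fun z => u z - v z + (v z - s z)) = (fun z => u z - s z).
  by apply/funext => z; ring.
lra.
Qed.

Lemma approximableD u v : approximable u -> approximable v ->
  approximable (fun z => u z + v z).
Proof.
move=> [au Hu] [av Hv]; split; first exact: admissibleD.
move=> eps eps0; have e4 : 0 < eps / 4 by rewrite divr_gt0.
have [s Ss us] := Hu _ e4; have [t St vt] := Hv _ e4.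
exists (fun z => s z + t z); first exact: S_D.
have := weightedD (admissibleB au (S_admissible Ss)) (admissibleB av (S_admissible St)).
have -> : (fun z => u z - s z + (v z - t z)) = (fun z => u z + v z - (s z + t z)).
  by apply/funext => z; ring.
lra.
Qed.

Lemma approximableZ c u : approximable u -> approximable (fun z => c * u z).
Proof.
move=> [au Hu]; split; first exact: admissibleZ.
move=> eps eps0; have c1 : 0 < c ^+ 2 + 1 by rewrite ltr_wpDl ?sqr_ge0.
have [|s Ss us] := Hu (eps / (c ^+ 2 + 1)); first by rewrite divr_gt0.
exists (fun z => c * s z); first exact: S_Z.
have -> : (fun z => c * u z - c * s z) = (fun z => c * (u z - s z)).
  by apply/funext => z; rewrite mulrBr.
rewrite weightedZ; last exact: admissibleB au (S_admissible Ss).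
move: us; rewrite ltr_pdivlMr// => us; apply: le_lt_trans us.
by rewrite mulrC ler_wpM2l ?weighted_ge0// lerDl.
Qed.

Lemma approximableB u v : approximable u -> approximable v ->
  approximable (fun z => u z - v z).
Proof.
move=> au av; have := approximableD au (approximableZ (-1) av).
by under eq_fun do rewrite mulN1r.
Qed.

Lemma approximable_sum (T : Type) (l : seq T) (u : T -> plane R -> R) :
  (forall i, approximable (u i)) -> approximable (fun z => \sum_(i <- l) u i z).
Proof.
move=> au; elim: l => [|i l IH].
  by under eq_fun do rewrite big_nil; exact: approximable_S.
by under eq_fun do rewrite big_cons; exact: approximableD.
Qed.

Lemma approximable_lim (u_ : nat -> plane R -> R) u v :
  (forall n, approximable (u_ n)) -> admissible v -> admissible u ->
  (forall n z, `|u_ n z - u z| <= `|v z|) ->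
  (forall z, (fun n => u_ n z) @ \oo --> u z) -> approximable u.
Proof.
move=> au [sv sbv] adu uv uu; apply: approximable_weighted => // eps eps0.
have e2 : 0 < eps / 2 by rewrite divr_gt0.
have mu_ n : measurable_fun setT (u_ n) by have [[[]]] := au n.
have mu0 : measurable_fun setT u by have [[]] := adu.
have [N hN] := ip_dct mu_ sv uv uu mu0 e2.
have [||||N' hN'] := @ip_dct _ _ _ mu2 (fun n z => b z * u_ n z)
   (fun z => b z * u z) _ _ sbv _ _ _ _ e2.
- by move=> n; exact: measurable_funM.
- by move=> n z; rewrite -mulrBr !normrM ler_wpM2l.
- by move=> z; apply: cvgM; [exact: cvg_cst|exact: uu].
- exact: measurable_funM.
exists (u_ (maxn N N')); first exact: au.
have := hN _ (leq_maxl N N'); have := hN' _ (leq_maxr N N').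
set w := u_ _.
have -> : weighted (fun z => u z - w z) =
    ip mu2 (fun z => w z - u z) (fun z => w z - u z) +
    ip mu2 (fun z => b z * w z - b z * u z) (fun z => b z * w z - b z * u z).
  by congr (_ + _); apply: eq_Rintegral => z _; ring.
by move=> /= h1 h2; lra.
Qed.

(** Dynkin's pi-lambda argument. The fixed factor [h] keeps all functions in the weighted space,
    which does not contain the constant 1; the map [f] is a coordinate projection or the identity of
    the plane. *)
Lemma approximable_dynkin d (T : measurableType d) (f : plane R -> T)
    (G : set (set T)) (h : plane R -> R) :
  @measurable _ T = <<s G >> -> setI_closed G -> measurable_fun setT f ->
  approximable h ->
  (forall A, G A -> approximable (fun z => \1_A (f z) * h z)) ->
  forall A, measurable A -> approximable (fun z => \1_A (f z) * h z).
Proof.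
move=> TG GI mf ah HG A; rewrite TG.
have mh : measurable_fun setT h by have [[[]]] := ah.
have m1 B : measurable B -> measurable_fun setT (fun z => \1_B (f z) * h z).
  move=> mB; apply: measurable_funM => //.
  by apply: measurableT_comp mf; exact: measurable_indic.
have le1 B z : `|\1_B (f z) * h z| <= `|h z|.
  rewrite normrM indicE; case: (_ \in _); rewrite ?normr1 ?mul1r//.
  by rewrite normr0 mul0r.
pose P B := approximable (fun z => \1_B (f z) * h z).
apply: (dynkin_induction (P := P)) => //.
- rewrite /P; rewrite (_ : (fun z => _) = h)//; apply/funext => z.
  by rewrite indicT mul1r.
- move=> B mB PB; have := approximableB ah PB; rewrite /P.
  congr approximable; apply/funext => z; rewrite !indicE in_setC.
  by case: (f z \in B) => /=; rewrite ?mul1r ?mul0r ?subrr ?subr0.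
- move=> F mF tF PF.
  pose u_ n z := \sum_(k <- iota 0 n) \1_(F k) (f z) * h z.
  have mU : measurable (\bigcup_k F k) by exact: bigcupT_measurable.
  have uE n z : u_ n z = \1_(\bigcup_(k < n) F k) (f z) * h z.
    elim: n => [|n IH]; first by rewrite /u_ big_nil bigcup0 ?indic0 ?mul0r.
    rewrite /u_ -addn1 iotaD big_cat /= big_seq1 -/(u_ n z) IH -mulrDl.
    congr (_ * _); rewrite !indicE add0n.
    have [Fn|nFn] := pselect (F n (f z)).
      rewrite (mem_set Fn) memNset ?add0r => [|[k /= kn Fk]]; last first.
        have := tF n k I I; move: (kn) => /[swap] -> //; first by rewrite ltnn.
        by exists (f z).
      by rewrite mem_set//; exists n => //=; rewrite addn1.
    rewrite (memNset nFn) addr0; congr (_ %:R); congr nat_of_bool.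
    apply/idP/idP; rewrite !inE => -[k /= kn Fk]; exists k => //=.
      by rewrite addn1; exact: ltnW.
    move: kn; rewrite addn1 ltnS leq_eqVlt => /predU1P[kn|//].
    by move: Fk; rewrite kn.
  apply: (@approximable_lim u_ _ h).
  + by move=> n; apply: approximable_sum => k; exact: PF.
  + by case: ah.
  + by apply: admissible_le (m1 _ mU) _ (le1 _); case: ah.
  + move=> n z; rewrite uE -mulrBl normrM ler_piMl// !indicE.
    case: (boolP (f z \in \bigcup_(k < n) F k)).
      rewrite inE => -[k _ Fk]; rewrite mem_set ?subrr ?normr0//; exists k => //.
    move=> _; rewrite mulr0n sub0r normrN.
    by case: (f z \in _); rewrite ?normr1 ?normr0.
  + move=> z; under eq_fun do rewrite uE; apply: cvg_near_cst.
    have [[k _ Fk]|nF] := pselect ((\bigcup_k F k) (f z)).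
      exists k.+1 => // n /= kn; rewrite !indicE !mem_set//; first by exists k.
      by exists k.
    apply: nearW => n; rewrite !indicE !memNset// => -[k _ Fk]; apply: nF.
    by exists k.
Qed.

End WeightedClosure.

Section LinTensor.
Context (R : realType).
Implicit Types (l : seq (R * (dyadic * dyadic))).

Lemma lin_tensor_cat al be l l' : lin_tensor al be (l ++ l') =
  (fun z : plane R => lin_tensor al be l z + lin_tensor al be l' z).
Proof. by apply/funext => z; rewrite /lin_tensor big_cat. Qed.

Definition scale_seq (c : R) l := [seq (c * t.1, t.2) | t <- l].

Lemma lin_tensor_scale al be c l : lin_tensor al be (scale_seq c l) =
  (fun z : plane R => c * lin_tensor al be l z).
Proof.
apply/funext => z; rewrite /lin_tensor big_map mulr_sumr.
by apply: eq_bigr => t _; rewrite mulrA.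
Qed.

Definition itv_span l : plane R -> R :=
  lin_tensor (fun I => \1_(itv R I)) (fun I => \1_(itv R I)) l.

End LinTensor.

(** * Density of dyadic step functions on a rectangle *)

Section Steps.
Context (R : realType).
Local Notation mu2 := (mu2 R).
Variables (b : plane R -> R).
Hypothesis lb : locsqint b.

Definition sub_itv I K := exists n, iter n parent I = K.

(** Only subrectangles of [Q] are allowed because the lower bound tests the commutator on functions
    that live on a single rectangle. *)
Definition steps (Q : dyadic * dyadic) (s : plane R -> R) :=
  exists l, (forall t, t \in l -> sub_itv t.2.1 Q.1 /\ sub_itv t.2.2 Q.2) /\
    s = itv_span l.

Lemma itv_span_admissible l : admissible b (@itv_span R l).
Proof.
split; first by apply: sqint_lin_tensor => I; exact: sqint_itv.
under eq_fun do rewrite mulr_sumr.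
apply: sqint_sum => t; under eq_fun do rewrite mulrCA.
apply: sqintZ; have := lb.2 t.2; rewrite indic_rect.
by under eq_fun do rewrite mulrC.
Qed.

Lemma steps_admissible Q s : steps Q s -> admissible b s.
Proof. by move=> [l [_ ->]]; exact: itv_span_admissible. Qed.

Lemma stepsD Q s t : steps Q s -> steps Q t -> steps Q (fun z => s z + t z).
Proof.
move=> [l [hl ->]] [l' [hl' ->]]; exists (l ++ l'); split; last first.
  by rewrite /itv_span lin_tensor_cat.
by move=> k; rewrite mem_cat => /orP[/hl|/hl'].
Qed.

Lemma stepsZ Q c s : steps Q s -> steps Q (fun z => c * s z).
Proof.
move=> [l [hl ->]]; exists (scale_seq c l); split; last first.
  by rewrite /itv_span lin_tensor_scale.
by move=> k /mapP[k' /hl h ->].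
Qed.

Lemma steps0 Q : steps Q (fun=> 0).
Proof.
by exists [::]; split => //; apply/funext => z; rewrite /itv_span /lin_tensor big_nil.
Qed.

Lemma steps_itv Q I J : sub_itv I Q.1 -> sub_itv J Q.2 ->
  steps Q (tensor (\1_(itv R I)) (\1_(itv R J))).
Proof.
move=> hI hJ; exists [:: (1, (I, J))]; split; first by move=> t; rewrite inE => /eqP ->.
by apply/funext => z; rewrite /itv_span /lin_tensor big_seq1 mul1r.
Qed.

Lemma dyadic_sets_itv A K : dyadic_sets A -> exists (c : R) I, sub_itv I K /\
  forall x : line R, \1_A x * \1_(itv R K) x = c * \1_(itv R I) x.
Proof.
move=> [->|[I ->]].
  by exists 0, K; split; [exists 0%N|move=> x; rewrite indic0 !mul0r].
have E x : \1_(itv R I) x * \1_(itv R K) x = \1_(itv R I `&` itv R K) x :> R.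
  by rewrite indicI.
have [e|[e h]|[e h]] := dyadic_setI R I K.
- by exists 0, K; split; [exists 0%N|move=> x; rewrite E e indic0 mul0r].
- by exists 1, I; split => // x; rewrite E e mul1r.
- by exists 1, K; split; [exists 0%N|move=> x; rewrite E e mul1r].
Qed.

Lemma steps_rect Q A B : dyadic_sets A -> dyadic_sets B ->
  steps Q (fun z => \1_A z.1 * (\1_B z.2 * \1_(rect Q) z)).
Proof.
move=> /(@dyadic_sets_itv _ Q.1)[c [I [hI cI]]] /(@dyadic_sets_itv _ Q.2)[e [J [hJ eJ]]].
have := stepsZ (c * e) (steps_itv hI hJ); congr steps; apply/funext => z.
by rewrite indic_rect /tensor mulrACA -cI -eJ; ring.
Qed.

Let appr Q := approximable b (steps Q).

Let appr_S Q s : steps Q s -> appr Q s.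
Proof. by apply: approximable_S => ?; exact: steps_admissible. Qed.

(** Two Dynkin passes: the first extends [A] to Borel sets while [B] is dyadic, the second extends
    [B] with the Borel set [A] already in place. *)
Lemma approximable_rect Q A B : measurable A -> measurable B ->
  approximable b (steps Q) (fun z => \1_A z.1 * (\1_B z.2 * \1_(rect Q) z)).
Proof.
move=> mA mB; have mb := lb.1.
have dQ : dyadic_sets (itv R Q.2) by right; exists Q.2.
have dyn := approximable_dynkin mb (@steps_admissible Q) (@stepsD Q) (@stepsZ Q) (steps0 Q).
have step1 B' : dyadic_sets B' -> forall A', measurable A' ->
    appr Q (fun z => \1_A' z.1 * (\1_B' z.2 * \1_(rect Q) z)).
  move=> dB'; apply: (dyn _ _ _ _ (fun z => \1_B' z.2 * \1_(rect Q) z)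
    (measurable_dyadic R) (@setI_closed_dyadic_sets R)).
  - exact: measurable_fst.
  - apply: appr_S; have [c [J [hJ cJ]]] := dyadic_sets_itv Q.2 dB'.
    have := stepsZ c (@steps_itv Q Q.1 J (ex_intro _ 0%N erefl) hJ).
    congr steps; apply/funext => z; rewrite indic_rect /tensor.
    by rewrite mulrCA -cJ; ring.
  - by move=> A' dA'; apply: appr_S; exact: steps_rect.
have step2 A' : measurable A' -> forall B', measurable B' ->
    appr Q (fun z => \1_B' z.2 * (\1_A' z.1 * \1_(rect Q) z)).
  move=> mA'; apply: (dyn _ _ _ _ (fun z => \1_A' z.1 * \1_(rect Q) z)
    (measurable_dyadic R) (@setI_closed_dyadic_sets R)).
  - exact: measurable_snd.
  - have := step1 _ dQ _ mA'; congr approximable; apply/funext => z.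
    by rewrite indic_rect /tensor; congr (_ * _); rewrite mulrCA indic_idem.
  - move=> B' dB'; have := step1 _ dB' _ mA'; congr approximable; apply/funext => z.
    by rewrite mulrCA.
have := step2 _ mA _ mB; congr approximable; apply/funext => z; exact: mulrCA.
Qed.

Lemma approximable_set Q E : measurable E ->
  approximable b (steps Q) (fun z => \1_E z * \1_(rect Q) z).
Proof.
move=> mE; have mb := lb.1.
have dyn := approximable_dynkin mb (@steps_admissible Q) (@stepsD Q) (@stepsZ Q) (steps0 Q).
apply: (dyn _ (plane R) id _ _ (measurable_prod_measurableType _ _)) => //.
- move=> _ _ [A mA [B mB <-]] [A' mA' [B' mB' <-]].
  exists (A `&` A'); first exact: measurableI.
  by exists (B `&` B'); [exact: measurableI|rewrite setXI].
- by apply: appr_S; rewrite indic_rect; apply: steps_itv; exists 0%N.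
- move=> _ [A mA [B mB <-]]; have := approximable_rect Q mA mB.
  congr approximable; apply/funext => z; rewrite mulrA; congr (_ * _).
  rewrite !indicE -natrM mulnb; congr (_ %:R); congr nat_of_bool.
  by apply/andP/idP; rewrite !inE.
Qed.

Import HBNNSimple.

Lemma approximable_ge0 Q u : admissible b u -> (forall z, 0 <= u z) ->
  approximable b (steps Q) (fun z => \1_(rect Q) z * u z).
Proof.
move=> au u0; have mb := lb.1; have mu0 : measurable_fun setT u by case: au => -[].
have mEu : measurable_fun setT (EFin \o u) by exact/measurable_EFinP.
pose g := nnsfun_approx measurableT mEu.
have gu n z : g n z <= u z.
  rewrite -lee_fin nnsfun_approxE; apply: le_approx => // w _.
  by rewrite lee_fin.
have g0 n z : 0 <= g n z by exact: fun_ge0.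
have gcv z : (fun n => g n z) @ \oo --> u z.
  have h : EFin \o g^~ z @ \oo --> (u z)%:E.
    by apply: cvg_nnsfun_approx => // w _; rewrite lee_fin.
  by move/fine_cvgP : h => [_].
have mr : measurable_fun setT (\1_(rect Q) : plane R -> R).
  by apply: measurable_indic; exact: measurable_rect.
have le1 (z : plane R) (x : R) : `|\1_(rect Q) z * x| <= `|x|.
  rewrite normrM indicE; case: (_ \in _); rewrite ?normr1 ?mul1r//.
  by rewrite normr0 mul0r.
apply: (@approximable_lim _ b _ mb (@steps_admissible Q)
   (fun n z => \1_(rect Q) z * g n z) _ u) => //.
- move=> n.
  have -> : (fun z => \1_(rect Q) z * g n z) =
    (fun z => \sum_(y <- finmap.enum_fset (fset_set (range (g n))))
       y * (\1_(g n @^-1` [set y]) z * \1_(rect Q) z)).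
    apply/funext => z; rewrite (fimfunE (g n) z) fsbig_finite//= mulr_sumr.
    by apply: eq_bigr => y _; ring.
  apply: approximable_sum; [exact: steps_admissible|exact: stepsD|exact: steps0|].
  move=> y; apply: approximableZ; [exact: steps_admissible|exact: stepsZ|].
  exact: approximable_set.
- apply: admissible_le au _ => //; exact: measurable_funM.
- move=> n z; rewrite -mulrBr; apply: (le_trans (le1 _ _)).
  by rewrite distrC !ger0_norm ?subr_ge0// lerBlDr lerDl.
- by move=> z; apply: cvgM; [exact: cvg_cst|exact: gcv].
Qed.

Lemma approximable_steps Q u : admissible b u ->
  approximable b (steps Q) (fun z => \1_(rect Q) z * u z).
Proof.
move=> au; have mb := lb.1; have mu0 : measurable_fun setT u by case: au => -[].
have -> : (fun z => \1_(rect Q) z * u z) = (fun z =>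
    \1_(rect Q) z * Num.max (u z) 0 - \1_(rect Q) z * Num.max (- u z) 0).
  apply/funext => z; rewrite -mulrBr; congr (_ * _).
  by case: (leP (u z) 0) => h; case: (leP (- u z) 0) => h'; lra.
have mx (v : plane R -> R) : measurable_fun setT v ->
    measurable_fun setT (fun z => Num.max (v z) 0).
  by move=> mv; exact: measurable_maxr.
have ax v : admissible b v -> admissible b (fun z => Num.max (v z) 0).
  move=> av; apply: (admissible_le mb _ av).
    by apply: mx; case: av => -[].
  by move=> z; case: (leP (v z) 0) => h; rewrite ?normr0.
apply: approximableB; [exact: steps_admissible|exact: stepsD|exact: stepsZ|..].
- by apply: approximable_ge0; [exact: ax|move=> z; rewrite le_max lexx orbT].
- apply: approximable_ge0; last by move=> z; rewrite le_max lexx orbT.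
  apply: ax; have := admissibleZ (-1) au.
  by under eq_fun do rewrite mulN1r.
Qed.

End Steps.

(** * Density of Haar polynomials by telescoping *)

Section Growth.
Context (R : realType).
Local Notation mu2 := (mu2 R).
Variables (b : plane R -> R) (be : R).
Hypothesis be0 : 0 < be.
Hypothesis ob : bounded_oscillation b be.

Let lb : locsqint b := ob.1.

Definition mass Q := \int[mu2]_z (\1_(rect Q) z * b z ^+ 2).

Let ib : locint b := locint_locsqint lb.

Let ib2 : locint (fun z => b z ^+ 2).
Proof. by have := locint_mul lb lb; under eq_fun do rewrite -expr2. Qed.

Let iosc c : locint (fun z => (b z - c) ^+ 2).
Proof.
have lc := locsqintB lb (locsqint_cst c).
by have := locint_mul lc lc; under eq_fun do rewrite -expr2.
Qed.

Lemma mass_osc Q c : mass Q =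
  \int[mu2]_z (\1_(rect Q) z * (b z - c) ^+ 2) +
  2 * c * (area R Q * mean b Q) - c ^+ 2 * area R Q.
Proof.
have i1 := integrable_rect R Q.
have ic (x : R) u : mu2.-integrable setT (EFin \o u) ->
    mu2.-integrable setT (EFin \o (fun z => x * u z)).
  by move=> iu; exact: (integrableZl measurableT x iu).
rewrite meanE mulVKf ?area_neq0// -[X in _ - _ * X]Rintegral_rect.
rewrite -!RintegralZl//; last exact: ib.2.
have j1 := (iosc c).2 Q; have j2 := ic (2 * c) _ (ib.2 Q); have j3 := ic (c ^+ 2) _ i1.
rewrite -RintegralD// -RintegralB//; last exact: (integrableD measurableT j1 j2).
by apply: eq_Rintegral => z _; ring.
Qed.

Section OneDirection.
Variable P : dyadic -> dyadic * dyadic.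
Hypothesis P_split : (exists I, P = pair I) \/ (exists J, P = pair^~ J).

Lemma area_parent L : area R (P (parent L)) = 2 * area R (P L).
Proof.
have [h1 h2] := area_split R P_split (parent L).
by rewrite -[in RHS](childP L); case: ifP => _; rewrite ?h1 ?h2; field.
Qed.

Lemma Rintegral_parent_le u L : locint u -> (forall z, 0 <= u z) ->
  \int[mu2]_z (\1_(rect (P L)) z * u z) <=
  \int[mu2]_z (\1_(rect (P (parent L))) z * u z).
Proof.
move=> iu u0; rewrite (Rintegral_split P_split (parent L) iu) -{1}(childP L).
have h K : 0 <= \int[mu2]_z (\1_(rect (P K)) z * u z).
  by apply: Rintegral_ge0 => z _; rewrite mulr_ge0// indicE.
by case: ifP => _; rewrite ?lerDl ?lerDr h.
Qed.

(* Any growth factor less than 4 suffices in approximable_telescope. *)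
Lemma mass_parent L :
  mass (P (parent L)) <= 3 * mass (P L) + 14 * be * area R (P L).
Proof.
set m := mean b (P (parent L)); set a := area R (P L).
have hp := ob.2 (P (parent L)).
have h1 := Rintegral_parent_le L (iosc m) (fun z => sqr_ge0 _).
rewrite area_parent -/m -/a in hp h1.
have -> : mass (P (parent L)) =
    \int[mu2]_z (\1_(rect (P (parent L))) z * (b z - m) ^+ 2) + m ^+ 2 * (2 * a).
  by rewrite (mass_osc _ m) area_parent -/a -/m; ring.
(* Pointwise $\frac32b^2+3(b-m)^2-m^2=\frac12(3b-2m)^2\ge0$. As the parent has twice the area, the
   factor 3 is $2\cdot\frac32$; the oscillation on the parent occurs $1+6$ times, each at most
   [be * (2 * a)], which gives 14. *)
suff h : m ^+ 2 * a <= 3 / 2 * mass (P L) +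
    3 * \int[mu2]_z (\1_(rect (P L)) z * (b z - m) ^+ 2) by lra.
have i1 := integrable_rect R (P L).
rewrite /a -Rintegral_rect -!RintegralZl//; [|exact: (iosc m).2|exact: ib2.2].
have j1 := integrableZl measurableT (3 / 2) (ib2.2 (P L)).
have j2 := integrableZl measurableT 3 ((iosc m).2 (P L)).
rewrite -RintegralD//; apply: le_Rintegral => //.
- exact: (integrableZl measurableT (m ^+ 2) i1).
- exact: (integrableD measurableT j1 j2).
move=> z _; have [->|->] : \1_(rect (P L)) z = 0 :> R \/ \1_(rect (P L)) z = 1 :> R.
- by rewrite indicE; case: (z \in _); [right|left].
- by rewrite !(mul0r, mulr0) addr0.
rewrite !mul1r mulr1; have := sqr_ge0 (3 * b z - 2 * m); rewrite !expr2; lra.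
Qed.

Lemma weighted_growth L k :
  weighted b (\1_(rect (P (iter k parent L)))) <=
  3 ^+ k * (mass (P L) + (14 * be + 1) * area R (P L)).
Proof.
(* The area only doubles, so a multiple of it absorbs the additive error of [mass_parent]: [X] grows
   by at most 3 because $14\beta+2(14\beta+1)\le3(14\beta+1)$. *)
pose X K := mass (P K) + (14 * be + 1) * area R (P K).
have E K : weighted b (\1_(rect (P K))) = area R (P K) + mass (P K).
  rewrite /weighted ip_rect; congr (_ + _); apply: eq_Rintegral => z _.
  by rewrite mulrACA indic_idem -expr2 mulrC.
have m0 K : 0 <= mass (P K).
  by apply: Rintegral_ge0 => z _; rewrite mulr_ge0 ?sqr_ge0// indicE.
apply: (@le_trans _ _ (X (iter k parent L))).
  rewrite E /X; have := mulr_ge0 (ltW be0) (ltW (area_gt0 R (P (iter k parent L)))); lra.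
rewrite -/(X L); elim: k => [|k IH]; first by rewrite expr0 mul1r.
rewrite iterS exprS -mulrA; apply: (@le_trans _ _ (3 * X (iter k parent L))); last first.
  by rewrite ler_pM2l.
rewrite /X area_parent; have := mass_parent (iter k parent L).
have := area_gt0 R (P (iter k parent L)) => a0.
have := mulr_ge0 (ltW be0) (ltW a0); lra.
Qed.

End OneDirection.

Definition haar_spans (s : plane R -> R) := exists l, s = haar_span l.

Lemma admissible_lin_tensor (al : dyadic -> line R -> R) l :
  (forall I, sqint (mu1 R) (al I)) ->
  (forall I, exists C : R, forall x, `|al I x| <= C) ->
  (forall I x, ~ itv R I x -> al I x = 0) ->
  admissible b (lin_tensor al al l).
Proof.
move=> sal bal sup; split; first exact: sqint_lin_tensor.
under eq_fun do rewrite mulr_sumr.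
apply: sqint_sum => t; under eq_fun do rewrite mulrCA.
apply: sqintZ.
have h : bounded_plane_fun (tensor (al t.2.1) (al t.2.2)).
  have [A hA] := bal t.2.1; have [B hB] := bal t.2.2.
  by exists (A * B) => z; rewrite /tensor normrM; apply: ler_pM.
have st : sqint mu2 (tensor (al t.2.1) (al t.2.2)) by exact: sqint_tensor.
have := sqint_bounded_mul h st.1 (lb.2 t.2).
congr sqint; apply/funext => z; rewrite indic_rect /tensor.
have e I (x : line R) : al I x * \1_(itv R I) x = al I x.
  rewrite indicE; have [Ix|nI] := pselect (itv R I x); first by rewrite mem_set ?mulr1.
  by rewrite (sup _ _ nI) mul0r.
by rewrite mulrA mulrACA !e mulrC.
Qed.

Lemma haar_spans_admissible s : haar_spans s -> admissible b s.
Proof.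
move=> [l ->]; apply: admissible_lin_tensor => I.
- exact: sqint_haar.
- exact: haar_bounded_ex.
- by move=> x; exact: haar_out.
Qed.

Lemma haar_spansD s t : haar_spans s -> haar_spans t ->
  haar_spans (fun z => s z + t z).
Proof.
by move=> [l ->] [l' ->]; exists (l ++ l'); rewrite /haar_span lin_tensor_cat.
Qed.

Lemma haar_spansZ c s : haar_spans s -> haar_spans (fun z => c * s z).
Proof.
by move=> [l ->]; exists (scale_seq c l); rewrite /haar_span lin_tensor_scale.
Qed.

Lemma haar_spans0 : haar_spans (fun=> 0).
Proof.
by exists [::]; apply/funext => z; rewrite /haar_span /lin_tensor big_nil.
Qed.

Lemma haar_spans_tensor I J : haar_spans (tensor (haar R I) (haar R J)).
Proof.
exists [:: (1, (I, J))]; apply/funext => z.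
by rewrite /haar_span /lin_tensor big_seq1 mul1r.
Qed.

Let appr := approximable b haar_spans.

(** Modulo approximable functions [F 0] equals $2^{-k}F_k$ for every $k$, and the weighted square
    norm of the latter is at most $(3/4)^kX$. *)
Lemma approximable_telescope (F : nat -> plane R -> R) (X : R) :
  (forall k, admissible b (F k)) ->
  (forall k, weighted b (F k) <= 3 ^+ k * X) ->
  (forall k, appr (fun z => F k z - 2^-1 * F k.+1 z)) -> appr (F 0%N).
Proof.
move=> aF wF dF.
have tele k : appr (fun z => F 0%N z - 2 ^- k * F k z).
  elim: k => [|k IH].
    apply: approximable_S; first exact: haar_spans_admissible.
    rewrite (_ : (fun z => _) = (fun=> 0)); first exact: haar_spans0.
    by apply/funext => z; rewrite expr0 invr1 mul1r subrr.
  have := approximableD haar_spans_admissible haar_spansD IH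
    (approximableZ haar_spans_admissible haar_spansZ (2 ^- k) (dF k)).
  congr approximable; apply/funext => z; rewrite exprS invfM; ring.
apply: approximable_weighted; [exact: haar_spans_admissible|exact: aF|].
move=> eps eps0.
have X0 : 0 <= X.
  by have := wF 0%N; rewrite expr0 mul1r; apply: le_trans; exact: weighted_ge0.
have [k hk] : exists k : nat, (3 / 4) ^+ k * X < eps.
  have : (fun k => (3 / 4) ^+ k * X : R) @ \oo --> (0 : R).
    rewrite -[X in _ --> X](mul0r X); apply: cvgMl; apply: cvg_expr.
    by rewrite ger0_norm; lra.
  move=> /cvgrPdist_lt /(_ _ eps0) [k _ /(_ k (leqnn k))]; rewrite /= sub0r normrN.
  by move=> h; exists k; apply: le_lt_trans h; exact: ler_norm.
exists (fun z => F 0%N z - 2 ^- k * F k z); first exact: tele.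
rewrite (_ : (fun z => _) = (fun z => 2 ^- k * F k z)); last first.
  by apply/funext => z; ring.
rewrite weightedZ//; apply: le_lt_trans hk.
have -> : (3 / 4) ^+ k * X = (2 ^- k) ^+ 2 * (3 ^+ k * X) :> R.
  rewrite mulrA; congr (_ * _); rewrite -exprVn -!exprM mulnC exprM -exprMn.
  by congr (_ ^+ _); field.
by rewrite ler_wpM2l// sqr_ge0.
Qed.

Lemma indic_parent I x : \1_(itv R I) x = 2^-1 * \1_(itv R (parent I)) x +
  (if is_right I then 1 else -1) / 2 * Num.sqrt (len R (parent I)) *
  haar R (parent I) x.
Proof.
have s0 : Num.sqrt (len R (parent I)) != 0 by rewrite gt_eqF// sqrtr_gt0 len_gt0.
rewrite /haar (indic_children (parent I)) -{1}(childP I).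
by case: ifP => _; field.
Qed.

Lemma weighted_le u v : admissible b u -> admissible b v ->
  (forall z, `|u z| <= `|v z|) -> weighted b u <= weighted b v.
Proof.
move=> [su sbu] [sv sbv] uv; apply: lerD; apply: ip_le => // z.
by rewrite !normrM ler_wpM2l.
Qed.

Let ar Q : admissible b (\1_(rect Q)).
Proof.
split; first exact: sqint_rect.
by have := lb.2 Q; under eq_fun do rewrite mulrC.
Qed.

(** Telescoping in the second variable with the Haar factor fixed; the weight is controlled because
    $|h_I|$ is constant on [I]. The telescoping in the first variable that follows produces
    differences of exactly this form. *)
Lemma approximable_haar_itv I J : appr (tensor (haar R I) (\1_(itv R J))).
Proof.
pose c := (Num.sqrt (len R I))^-1.
pose F k : plane R -> R := tensor (haar R I) (\1_(itv R (iter k parent J))).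
have le k z : `|F k z| <= `|c * \1_(rect (I, iter k parent J)) z|.
  apply: le_trans (ler_norm _); rewrite /F indic_rect /tensor /=.
  rewrite (normrM (haar R I z.1)) mulrA; apply: ler_pM => //; last first.
    by rewrite ger0_norm// indicE.
  rewrite indicE; have [Ix|nI] := pselect (itv R I z.1).
    by rewrite mem_set// mulr1; exact: haar_bounded.
  by rewrite (haar_out nI) normr0 memNset// mulr0.
have mF k : measurable_fun setT (F k).
  by have [] := sqint_tensor (sqint_haar R I) (sqint_itv R (iter k parent J)).
have aF k : admissible b (F k).
  exact: (admissible_le lb.1 (mF k) (admissibleZ c (ar (I, iter k parent J))) (le k)).
apply: (@approximable_telescope F
  (c ^+ 2 * (mass (I, J) + (14 * be + 1) * area R (I, J)))) => // k.
- apply: (le_trans (weighted_le (aF k) (admissibleZ c (ar _)) (le k))).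
  rewrite weightedZ; last exact: ar.
  rewrite mulrCA ler_wpM2l ?sqr_ge0//.
  by apply: (@weighted_growth (pair I)); left; exists I.
- rewrite (_ : (fun z => _) = (fun z => (if is_right (iter k parent J) then 1 else -1) / 2 *
    Num.sqrt (len R (iter k.+1 parent J)) *
    tensor (haar R I) (haar R (iter k.+1 parent J)) z)); last first.
    apply/funext => z; rewrite /F /tensor (indic_parent (iter k parent J)) /=; ring.
  apply: approximableZ; [exact: haar_spans_admissible|exact: haar_spansZ|].
  apply: approximable_S; first exact: haar_spans_admissible.
  exact: haar_spans_tensor.
Qed.

Lemma approximable_itv_itv I J : appr (tensor (\1_(itv R I)) (\1_(itv R J))).
Proof.
pose F k : plane R -> R := \1_(rect (iter k parent I, J)).
rewrite (_ : tensor _ _ = F 0%N); last by rewrite /F indic_rect.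
apply: (@approximable_telescope F (mass (I, J) + (14 * be + 1) * area R (I, J))) => k.
- exact: ar.
- by apply: (@weighted_growth (pair^~ J)); right; exists J.
- rewrite (_ : (fun z => _) = (fun z => (if is_right (iter k parent I) then 1 else -1) / 2 *
    Num.sqrt (len R (iter k.+1 parent I)) *
    tensor (haar R (iter k.+1 parent I)) (\1_(itv R J)) z)); last first.
    apply/funext => z.
    have e K : \1_(rect (K, J)) z = \1_(itv R K) z.1 * \1_(itv R J) z.2 :> R.
      by rewrite indic_rect.
    rewrite /F /tensor !e (indic_parent (iter k parent I)) iterS; ring.
  apply: approximableZ; [exact: haar_spans_admissible|exact: haar_spansZ|].
  exact: approximable_haar_itv.
Qed.

(** On a rectangle [u] is approximated by steps, and each indicator in a step by Haar polynomials;
    the root squares then exhaust the plane with [u] as dominating function. *)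
Lemma approximable_haar_spans u : admissible b u -> approximable b haar_spans u.
Proof.
move=> au.
have aQ Q : appr (fun z => \1_(rect Q) z * u z).
  have [aQ hQ] := approximable_steps lb Q au.
  apply: approximable_weighted => //; first exact: haar_spans_admissible.
  move=> eps /hQ [s [l [_ ->]] hs]; exists (itv_span l) => //.
  apply: approximable_sum; [exact: haar_spans_admissible|exact: haar_spansD|
    exact: haar_spans0|] => t.
  apply: approximableZ; [exact: haar_spans_admissible|exact: haar_spansZ|].
  exact: approximable_itv_itv.
have aD := approximableD haar_spans_admissible haar_spansD.
pose one m (x : line R) := \1_(itv R (root_itv m true)) x + \1_(itv R (root_itv m false)) x : R.
pose u_ m (z : plane R) := one m z.1 * one m z.2 * u z.
have one1 m x : `|one m x - 1| <= 1 /\ 0 <= one m x <= 1.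
  rewrite /one; have [h|h] := pselect (in_roots m x).
    by rewrite (indic_roots h) subrr normr0; split => //; apply/andP; split.
  have ht : ~ itv R (root_itv m true) x by move=> h'; apply: h; left.
  have hf : ~ itv R (root_itv m false) x by move=> h'; apply: h; right.
  by rewrite !indicE !memNset// addr0 sub0r normrN normr1; split => //; rewrite lexx ler01.
apply: (@approximable_lim _ b _ lb.1 haar_spans_admissible u_ u u) => //.
- move=> m; have := aD _ _
    (aD _ _ (aQ (root_itv m true, root_itv m true)) (aQ (root_itv m true, root_itv m false)))
    (aD _ _ (aQ (root_itv m false, root_itv m true)) (aQ (root_itv m false, root_itv m false))).
  congr approximable; apply/funext => z; rewrite !indic_rect /tensor /u_ /one /=; ring.
- move=> m z; rewrite /u_ -[X in _ - X]mul1r -mulrBl normrM ler_piMl//.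
  have [_ /andP[a0 a1]] := one1 m z.1; have [_ /andP[b0 b1]] := one1 m z.2.
  rewrite ler_norml; apply/andP; split; nra.
- move=> z; apply: cvg_near_cst.
  have ev x : exists M, forall m, (M <= m)%N -> one m x = 1.
    pose I := Dyadic 0 (Num.floor x).
    have Ix : itv R I x by apply/itvE; rewrite /I/= expr0z mulr1.
    exists (`|pos I| + `|scale I|)%N => m hm; apply: indic_roots.
    by have [[] h] := itv_root hm Ix; [left|right].
  have [M hM] := ev z.1; have [M' hM'] := ev z.2.
  exists (maxn M M') => // m /= hm; rewrite /u_ hM ?hM' ?mul1r//; lia.
Qed.

End Growth.

(** * Sufficiency of bounded oscillation *)

Section Operators.
Context d (X : measurableType d) (R : realType).
Variable mu : {measure set X -> \bar R}.
Variable T : (X -> R) -> (X -> R).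
Hypothesis hT : L2_operator mu T.
Implicit Types (f g u v : X -> R).

Lemma operator_sqint f : sqint mu f -> sqint mu (T f).
Proof. by case: hT => h _ _ /LfunE/h/LfunE. Qed.

Lemma operator_lin (a : R) f g : sqint mu f -> sqint mu g ->
  ae_eq mu setT (T (fun x => a * f x + g x)) (fun x => a * T f x + T g x).
Proof. by case: hT => _ h _ /LfunE sf /LfunE sg; exact: h. Qed.

Lemma operator_bounded : exists2 C : R, 0 < C &
  forall f, sqint mu f -> ip mu (T f) (T f) <= C * ip mu f f.
Proof.
case: hT => _ _ [C hC]; exists (C ^+ 2 + 1); first by rewrite ltr_wpDl ?sqr_ge0.
move=> f sf; apply: (@le_trans _ _ (C ^+ 2 * ip mu f f)).
  by apply: norm2_le => //; [exact: operator_sqint|apply: hC; exact/LfunE].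
by rewrite ler_wpM2r ?ip_ge0// lerDl.
Qed.

Lemma operator0 : ae_eq mu setT (T (fun=> 0)) (fun=> 0).
Proof.
have := operator_lin 1 (sqint0 mu) (sqint0 mu).
under [X in T X]eq_fun do rewrite mulr0 addr0.
by apply: filterS => x /(_ I) h _; move: h; lra.
Qed.

Lemma operator_sum (A : Type) (l : seq (R * A)) (F G : A -> X -> R) :
  (forall i, sqint mu (F i)) -> (forall i, ae_eq mu setT (T (F i)) (G i)) ->
  ae_eq mu setT (T (fun x => \sum_(t <- l) t.1 * F t.2 x))
                (fun x => \sum_(t <- l) t.1 * G t.2 x).
Proof.
move=> sF FG; elim: l => [|t l IH].
  under [X in T X]eq_fun do rewrite big_nil.
  by under [X in ae_eq _ _ _ X]eq_fun do rewrite big_nil; exact: operator0.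
under [X in T X]eq_fun do rewrite big_cons.
under [X in ae_eq _ _ _ X]eq_fun do rewrite big_cons.
have sS : sqint mu (fun x => \sum_(t <- l) t.1 * F t.2 x).
  by apply: sqint_sum => i; exact: sqintZ.
have := operator_lin t.1 (sF t.2) sS.
move=> h; near=> x => _.
rewrite (near h x _ I)// (near (FG t.2) x _ I)// (near IH x _ I)//.
Unshelve. all: by end_near.
Qed.

Lemma operatorB f g : sqint mu f -> sqint mu g ->
  ae_eq mu setT (T (fun x => f x - g x)) (fun x => T f x - T g x).
Proof.
move=> sf sg; have := operator_lin (-1) sg sf.
under [X in T X]eq_fun do rewrite mulN1r addrC.
by apply: filterS => x h /h ->; rewrite mulN1r addrC.
Qed.

Lemma operatorB_bound (C : R) f g : sqint mu f -> sqint mu g ->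
  (forall f, sqint mu f -> ip mu (T f) (T f) <= C * ip mu f f) ->
  ip mu (fun x => T f x - T g x) (fun x => T f x - T g x) <=
  C * ip mu (fun x => f x - g x) (fun x => f x - g x).
Proof.
move=> sf sg hC; have sfg := sqintB sf sg.
have sT := sqintB (operator_sqint sf) (operator_sqint sg).
rewrite -(eq_ip_ae2 _ _ (operatorB sf sg)); [exact: hC| |by case: sT].
by case: (operator_sqint sfg).
Qed.

End Operators.

(** * The shift on Haar polynomials, its adjoint, and the upper bound *)

Section TensorShift.
Context (R : realType).
Local Notation mu1 := (mu1 R).
Local Notation mu2 := (mu2 R).
Variables (T : (line R -> R) -> (line R -> R)) (TT : (plane R -> R) -> (plane R -> R)).
Hypothesis hT : dyadic_shift T.
Hypothesis hTT : tensor_square T TT.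

Lemma shift_haarE I : ae_eq mu1 setT (T (haar R I)) (@shift_haar R I).
Proof.
case: hT => _ he ho; rewrite /shift_haar /even_itv.
case: asboolP => [/he|/ho]; apply: filterS => x h /h ->; first by rewrite mul1r.
by rewrite mul0r.
Qed.

Lemma tensor_shift_haarE I J :
  ae_eq mu2 setT (TT (tensor (haar R I) (haar R J)))
    (tensor (@shift_haar R I) (@shift_haar R J)).
Proof.
case: hTT => _ h; apply: ae_eq_trans (h _ _ _ _) (ae_eq_tensor _ _).
- by apply/LfunE; exact: sqint_haar.
- by apply/LfunE; exact: sqint_haar.
- exact: shift_haarE.
- exact: shift_haarE.
Qed.

Lemma haar_span_shiftE l : ae_eq mu2 setT (TT (haar_span l))
  (lin_tensor (@shift_haar R) (@shift_haar R) l).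
Proof.
apply: (operator_sum hTT.1 l (F := fun i => tensor (haar R i.1) (haar R i.2))
  (G := fun i => tensor (@shift_haar R i.1) (@shift_haar R i.2))) => i.
  by apply: sqint_tensor; exact: sqint_haar.
exact: tensor_shift_haarE.
Qed.

Lemma ip_shift_span lf lg :
  ip mu2 (lin_tensor (@shift_haar R) (@shift_haar R) lf) (haar_span lg) =
  ip mu2 (haar_span lf) (lin_tensor (@coshift_haar R) (@coshift_haar R) lg).
Proof.
have sh I J : sqint mu2 (tensor (haar R I) (haar R J)).
  by apply: sqint_tensor; exact: sqint_haar.
have ss I J : sqint mu2 (tensor (@shift_haar R I) (@shift_haar R J)).
  by apply: sqint_tensor; exact: sqint_shift_haar.
have sc I J : sqint mu2 (tensor (@coshift_haar R I) (@coshift_haar R J)).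
  by apply: sqint_tensor; exact: sqint_coshift_haar.
rewrite [LHS]ip_suml => [|t|]; [|exact: sqintZ|]; last first.
  by apply: sqint_sum => t; exact: sqintZ.
rewrite [RHS]ip_suml => [|t|]; [|exact: sqintZ|]; last first.
  by apply: sqint_sum => t; exact: sqintZ.
apply: eq_bigr => t _.
rewrite [LHS]ip_sumr => [|t'|]; [|exact: sqintZ|exact: sqintZ].
rewrite [RHS]ip_sumr => [|t'|]; [|exact: sqintZ|exact: sqintZ].
apply: eq_bigr => t' _.
rewrite [LHS]ipZl//; last exact: sqintZ.
rewrite [RHS]ipZl//; last exact: sqintZ.
rewrite [X in _ * X = _]ipZr// [X in _ = _ * X]ipZr//.
rewrite (ip_tensor (sqint_shift_haar R _) (sqint_shift_haar R _)
  (sqint_haar R _) (sqint_haar R _)).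
rewrite (ip_tensor (sqint_haar R _) (sqint_haar R _)
  (sqint_coshift_haar R _) (sqint_coshift_haar R _)).
by rewrite !ip_shift_haar.
Qed.

Lemma bounded_oscillation0 : bounded_oscillation (cst 0 : plane R -> R) 1.
Proof.
split; first exact: locsqint_cst.
move=> Q; have m0 : mean (cst 0 : plane R -> R) Q = 0 by apply: mean_cst.
rewrite (_ : \int[mu2]_z _ = \int[mu2]_z (cst 0 : plane R -> R) z).
  by rewrite Rintegral_cst// mul0r mul1r ltW// area_gt0.
by apply: eq_Rintegral => z _; rewrite m0 subrr expr0n mulr0.
Qed.

(** For the symbol 0 the weighted space is $L^2$, so weighted density specializes to plain
    density. *)
Lemma haar_spans_dense u eps : sqint mu2 u -> 0 < eps ->
  exists l, ip mu2 (fun z => u z - haar_span l z) (fun z => u z - haar_span l z) < eps.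
Proof.
move=> su eps0.
have au : admissible (cst 0 : plane R -> R) u.
  split => //; have := sqint0 mu2; congr sqint.
  by apply/funext => z; rewrite mul0r.
have [_ /(_ _ eps0)] := approximable_haar_spans ltr01 bounded_oscillation0 au.
move=> [_ [l ->] h]; exists l; apply: le_lt_trans h.
by rewrite lerDl ip_ge0.
Qed.

(** The adjoint is required only on Haar polynomials, where it is explicit: the identity holds for
    polynomial [u] by orthonormality and extends by density and boundedness of [TT]. *)
Lemma adjoint_shift u l : sqint mu2 u ->
  ip mu2 (TT u) (haar_span l) =
  ip mu2 u (lin_tensor (@coshift_haar R) (@coshift_haar R) l).
Proof.
move=> su; have [C C0 hC] := operator_bounded hTT.1.
set g := haar_span l; set g' := lin_tensor _ _ l.
have sg (l' : seq (R * (dyadic * dyadic))) : sqint mu2 (haar_span l').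
  by apply: sqint_lin_tensor => I; exact: sqint_haar.
have sg' : sqint mu2 g' by apply: sqint_lin_tensor => I; exact: sqint_coshift_haar.
have sTu := operator_sqint hTT.1 su.
have key eps : 0 < eps -> `|ip mu2 (TT u) g - ip mu2 u g'| <= eps.
  move=> eps0.
  (* [t] is fixed first, so that the terms divided by [t] total at most [eps / 4]; the approximation
     of [u] is chosen afterwards, fine enough to offset the factor [t]. *)
  pose t : R := 4 * (ip mu2 g g + ip mu2 g' g' + 1) / eps.
  have gg : 0 <= ip mu2 g g by exact: ip_ge0.
  have gg' : 0 <= ip mu2 g' g' by exact: ip_ge0.
  have t0 : 0 < t by rewrite divr_gt0// mulr_gt0//; lra.
  have tE : t = 4 * (ip mu2 g g + ip mu2 g' g' + 1) / eps by [].
  clearbody t.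
  have [|lu hu] := haar_spans_dense su (eps := eps / (4 * t * (C + 1))).
    by rewrite divr_gt0// !mulr_gt0//; lra.
  set p := haar_span lu in hu.
  have sp : sqint mu2 p by exact: sg.
  have sTp := operator_sqint hTT.1 sp.
  have E : ip mu2 (TT p) g = ip mu2 p g'.
    rewrite -ip_shift_span; apply: eq_ip_ae; [by case: sTp| |by case: (sg l)|].
      have sS : sqint mu2 (lin_tensor (@shift_haar R) (@shift_haar R) lu).
        by apply: sqint_lin_tensor => I; exact: sqint_shift_haar.
      by case: sS.
    exact: haar_span_shiftE.
  have -> : ip mu2 (TT u) g - ip mu2 u g' =
      ip mu2 (fun z => TT u z - TT p z) g - ip mu2 (fun z => u z - p z) g'.
    by rewrite !ipBl//; [rewrite E; ring|exact: sg].
  apply: (le_trans (ler_normB _ _)).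
  have b1 := ip_bound t0 (sqintB sTu sTp) (sg l).
  have b2 := ip_bound t0 (sqintB su sp) sg'.
  have b3 := operatorB_bound hTT.1 su sp hC.
  apply: (le_trans (lerD b1 b2)); rewrite -/g.
  set e := ip mu2 (fun z => u z - p z) _ in b3 hu *.
  set e' := ip mu2 (fun z => TT u z - TT p z) _ in b3 *.
  have h1 : t * e' + t * e <= eps / 4.
    apply: (@le_trans _ _ (t * ((C + 1) * e))).
      by rewrite -mulrDr ler_wpM2l ?(ltW t0)// mulrDl mul1r lerD2r.
    move: hu; rewrite ltr_pdivlMr; last by rewrite !mulr_gt0//; lra.
    by move=> h; rewrite ler_pdivlMr//; apply: ltW; apply: le_lt_trans h; lra.
  have h2 : ip mu2 g g / t + ip mu2 g' g' / t <= eps / 4.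
    rewrite -mulrDl ler_pdivrMr// tE mulrA.
    have -> : eps / 4 * (4 * (ip mu2 g g + ip mu2 g' g' + 1)) / eps =
      ip mu2 g g + ip mu2 g' g' + 1 by field; rewrite gt_eqF.
    lra.
  lra.
apply/eqP; rewrite -subr_eq0 -normr_eq0; apply/eqP/le_anti; rewrite normr_ge0 andbT.
by apply/ler_addgt0Pr => eps eps0; rewrite add0r; exact: key.
Qed.

Section Upper.
Variables (b : plane R -> R) (be : R).
Hypothesis be0 : 0 < be.
Hypothesis ob : bounded_oscillation b be.

Let lb : locsqint b := ob.1.
Let Cb : R := 4 * (13 * be + 5).

Lemma admissible_shift_span l :
  admissible b (lin_tensor (@shift_haar R) (@shift_haar R) l).
Proof.
apply: (admissible_lin_tensor ob) => I.
- exact: sqint_shift_haar.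
- exact: shift_bounded.
- move=> x nI; rewrite /shift_haar (@haar_out _ (left_half I)).
    by rewrite (@haar_out _ (right_half I)) ?subrr ?mulr0// => /itv_right.
  by move=> /itv_left.
Qed.

(** For a Haar polynomial $\mathbf T$ has a bounded representative of bounded support, so the
    commutator is square integrable from the outset and [dual_bound] applies against Haar
    polynomials. *)
Lemma haar_span_commutator l :
  let F := commutator TT b (haar_span l) in
  sqint mu2 F /\ ip mu2 F F <= 16 * Cb ^+ 2 * ip mu2 (haar_span l) (haar_span l).
Proof.
set p := haar_span l => F.
have Cb0 : 0 < Cb by rewrite mulr_gt0// addr_gt0// mulr_gt0.
have [sp sbp] := haar_spans_admissible ob (ex_intro _ l erefl : haar_spans p).
have [sS sbS] := admissible_shift_span l.
have sTb := operator_sqint hTT.1 sbp.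
pose F' z := TT (fun z => b z * p z) z - b z * lin_tensor (@shift_haar R) (@shift_haar R) l z.
have sF' : sqint mu2 F' by exact: sqintB.
have FF' : ae_eq mu2 setT F' F.
  apply: filterS (haar_span_shiftE l) => z h /h hz.
  by rewrite /F' /F /commutator /= hz.
have mF : measurable_fun setT F.
  apply: measurable_funB; first by case: sTb.
  apply: measurable_funM; first by case: lb.
  by case: (operator_sqint hTT.1 sp).
have sF := eq_sqint_ae mF sF' FF'.
split => //; rewrite -(eq_ip_ae2 sF'.1 mF FF').
apply: (@dual_bound _ _ _ mu2 (@haar_spans R)) => //.
- exact: ip_ge0.
- by move=> g /(haar_spans_admissible ob)[].
- exact: haar_spansZ.
- move=> _ [lg ->].
  have sg : sqint mu2 (haar_span lg).
    by have [] := haar_spans_admissible ob (ex_intro _ lg erefl : haar_spans (haar_span lg)).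
  have sC : sqint mu2 (lin_tensor (@coshift_haar R) (@coshift_haar R) lg).
    by apply: sqint_lin_tensor => I; exact: sqint_coshift_haar.
  rewrite ipBl// adjoint_shift//.
  have <- : \int[mu2]_z commutator_form b l lg z =
    ip mu2 (fun z => b z * p z) (lin_tensor (@coshift_haar R) (@coshift_haar R) lg) -
    ip mu2 (fun z => b z * lin_tensor (@shift_haar R) (@shift_haar R) l z) (haar_span lg).
    rewrite -RintegralB//; [|exact: sqint_mul..].
    by apply: eq_Rintegral => z _; rewrite /commutator_form !mulrA.
  apply: (le_trans (ler_norm _)); exact: commutator_form_bound.
- by move=> eps eps0; have [lg h] := haar_spans_dense sF' eps0;
    exists (haar_span lg); split => //; exists lg.
Qed.

(* b (TT f) is controlled only where |b| <= M: Haar polynomials converge to f in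
   the weighted norm, but their images converge only in L^2. *)
Lemma bounded_oscillation_commutator f :
  sqint mu2 f -> sqint mu2 (fun z => b z * f z) ->
  let F := commutator TT b f in
  sqint mu2 F /\ ip mu2 F F <= 64 * Cb ^+ 2 * ip mu2 f f.
Proof.
move=> sf sbf F.
have [K K0 hK] := operator_bounded hTT.1.
have sTf := operator_sqint hTT.1 sf; have sTbf := operator_sqint hTT.1 sbf.
have mb : measurable_fun setT b by case: lb.
have mF : measurable_fun setT F.
  apply: measurable_funB; first by case: sTbf.
  by apply: measurable_funM => //; case: sTf.
apply: (sqint_truncate mb mF) => M FM.
pose E : plane R -> R := \1_[set x | `|b x| <= M%:R].
have mE : measurable_fun setT E.
  apply: measurable_indic.
  have mn : measurable_fun setT (fun z => `|b z|) by exact: measurableT_comp.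
  rewrite (_ : [set x | _] = setT `&` (fun z => `|b z|) @^-1` `]-oo, M%:R]%classic).
    by apply: mn.
  by apply/seteqP; split => [z h|z []]; rewrite /= ?in_itv//=; split => //=; rewrite in_itv.
have E1 z (x : R) : `|E z * x| <= `|x|.
  rewrite normrM /E indicE; case: (_ \in _); rewrite ?normr1 ?mul1r//.
  by rewrite normr0 mul0r.
have EM z (x : R) : `|E z * (b z * x)| <= `|M%:R * x|.
  rewrite mulrA !normrM ler_wpM2r// /E indicE.
  have [bM|nbM] := pselect ([set x | `|b x| <= M%:R] z).
    by rewrite (mem_set bM) normr1 mul1r (ger0_norm (ler0n R M)).
  by rewrite (memNset nbM) normr0 mul0r.
have sEu u : sqint mu2 u -> sqint mu2 (fun z => E z * u z).
  move=> su; apply: (sqint_le _ su) => //.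
  by apply: measurable_funM => //; case: su.
have sEb u : sqint mu2 u -> sqint mu2 (fun z => E z * (b z * u z)).
  move=> su; apply: (sqint_le _ (sqintZ M%:R su)) => //.
  by apply: measurable_funM => //; apply: measurable_funM => //; case: su.
have sFM : sqint mu2 FM.
  have := sqintB (sEu _ sTbf) (sEb _ sTf); congr sqint; apply/funext => z.
  by rewrite /FM /F /commutator /= mulrBr.
split => //.
apply/ler_addgt0Pr => eps eps0.
(* The polynomial is chosen after [M], so the error constant may depend on [M]. The factor 64 is
   $16\cdot2\cdot2$: one 2 from splitting off the error, the other from comparing $\|p\|^2$ with
   $\|f\|^2$. *)
pose D : R := 4 * K * (1 + M%:R ^+ 2) + 64 * Cb ^+ 2 + 1.
have D0 : 0 < D.
  have kk : 0 <= K * (1 + M%:R ^+ 2).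
    by apply: mulr_ge0; [exact: ltW|rewrite addr_ge0 ?sqr_ge0].
  by have := sqr_ge0 Cb; rewrite /D; lra.
have [_ hap] := approximable_haar_spans be0 ob (conj sf sbf : admissible b f).
have [|_ [l ->]] := hap (eps / D); first by rewrite divr_gt0.
set p := haar_span l; rewrite ltr_pdivlMr// => hp.
have [sp sbp] := haar_spans_admissible ob (ex_intro _ l erefl : haar_spans p).
have [sG GG] := haar_span_commutator l.
set G := commutator _ _ _ in sG GG.
have sTp := operator_sqint hTT.1 sp; have sTbp := operator_sqint hTT.1 sbp.
pose U z := E z * (TT (fun z => b z * f z) z - TT (fun z => b z * p z) z).
pose V z := E z * (b z * (TT f z - TT p z)).
have sU : sqint mu2 U by apply: sEu; exact: sqintB.
have sV : sqint mu2 V by apply: sEb; exact: sqintB.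
have FME : FM = (fun z => (U z - V z) + E z * G z).
  apply/funext => z; rewrite /FM /F /G /commutator /U /V /E /=; ring.
have nU : ip mu2 U U <= K * ip mu2 (fun z => b z * f z - b z * p z) (fun z => b z * f z - b z * p z).
  apply: le_trans (operatorB_bound hTT.1 sbf sbp hK).
  by apply: ip_le => // [|z]; [exact: sqintB|exact: E1].
have nV : ip mu2 V V <= M%:R ^+ 2 * (K * ip mu2 (fun z => f z - p z) (fun z => f z - p z)).
  apply: (@le_trans _ _ (M%:R ^+ 2 * ip mu2 (fun z => TT f z - TT p z) (fun z => TT f z - TT p z))).
    rewrite -ipZZ; last exact: sqintB.
    apply: ip_le => // [|z]; last exact: EM.
    by apply: sqintZ; exact: sqintB.
  by rewrite ler_wpM2l ?sqr_ge0//; exact: (operatorB_bound hTT.1 sf sp hK).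
have nG : ip mu2 (fun z => E z * G z) (fun z => E z * G z) <= ip mu2 G G.
  by apply: ip_le => //; exact: sEu.
have n1 := ip_sqrD (sqintB sU sV) (sEu _ sG).
have n2 := ip_sqrB sU sV.
have np : ip mu2 p p <= 2 * ip mu2 f f + 2 * ip mu2 (fun z => f z - p z) (fun z => f z - p z).
  have := ip_sqrB sf (sqintB sf sp).
  have -> : (fun x => f x - (f x - p x)) = p by apply/funext => z; ring.
  by [].
rewrite {1 2}FME; apply: (le_trans n1).
have e1 : weighted b (fun z => f z - p z) =
   ip mu2 (fun z => f z - p z) (fun z => f z - p z) +
   ip mu2 (fun z => b z * f z - b z * p z) (fun z => b z * f z - b z * p z).
  by congr (_ + _); apply: eq_Rintegral => z _; rewrite mulrBr.
move: hp; rewrite e1 /D.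
have x0 := ip_ge0 mu2 (fun z => f z - p z).
have y0 := ip_ge0 mu2 (fun z => b z * f z - b z * p z).
move: nU nV n2 nG GG np.
set x := ip _ (fun z => f z - p z) _ in x0 *.
set y := ip _ (fun z => b z * f z - b z * p z) _ in y0 *.
set c := Cb ^+ 2; have c0 : 0 <= c by exact: sqr_ge0.
set m := M%:R ^+ 2; have m0 : 0 <= m by exact: sqr_ge0.
move=> nU nV n2 nG GG np hp.
have cnp := ler_wpM2l c0 np.
have := mulr_ge0 c0 x0; have := mulr_ge0 c0 y0.
have := mulr_ge0 (ltW K0) x0; have := mulr_ge0 (ltW K0) y0.
have := mulr_ge0 m0 (mulr_ge0 (ltW K0) y0); have := mulr_ge0 m0 (mulr_ge0 (ltW K0) x0).
move=> *; lra.
Qed.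

End Upper.

Lemma bmod_commutator b : measurable_fun setT b -> bmod b ->
  commutator_L2_bounded TT b.
Proof.
move=> mb /(bmodP mb)[be be0 ob]; split.
  move=> I J; apply/LfunE.
  by have [_] := haar_spans_admissible ob (haar_spans_tensor R I J).
exists (Num.sqrt (64 * (4 * (13 * be + 5)) ^+ 2)) => f /LfunE sf /LfunE sbf.
have [sF FF] := bounded_oscillation_commutator be0 ob sf sbf.
by apply: le_norm2 => //; rewrite mulr_ge0 ?sqr_ge0.
Qed.

End TensorShift.

(** * Necessity of bounded oscillation *)

Section Lower.
Context (R : realType).
Local Notation mu1 := (mu1 R).
Local Notation mu2 := (mu2 R).
Implicit Types (I J K L A : dyadic).

Lemma sub_itv_subset I A x : sub_itv I A -> itv R I x -> itv R A x.
Proof. by move=> [n <-]; elim: n => //= n IH /IH; exact: itv_parent. Qed.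

Lemma haar_norm I x : `|haar R I x| = (Num.sqrt (len R I))^-1 * \1_(itv R I) x.
Proof.
have h : 0 <= (Num.sqrt (len R I))^-1 by rewrite invr_ge0 sqrtr_ge0.
rewrite indicE; have [Ix|nI] := pselect (itv R I x); last first.
  by rewrite (haar_out nI) normr0 memNset ?mulr0.
rewrite mem_set// mulr1.
by case/itv_children : Ix => [/haar_right|/haar_left] ->; rewrite ?normrN ger0_norm.
Qed.

(** $|h_I\otimes h_J|$ is a positive constant on $I\times J$, so the domain condition on Haar
    tensors amounts to local square integrability. *)
Lemma locsqint_commutator TT (b : plane R -> R) : measurable_fun setT b ->
  commutator_L2_bounded TT b -> locsqint b.
Proof.
move=> mb [hb _]; split => // -[I J]; have /LfunE sb := hb I J.
pose c : R := Num.sqrt (len R I) * Num.sqrt (len R J).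
apply: (sqint_le _ (sqintZ c sb)).
  by apply: measurable_funM => //; apply: measurable_indic; exact: measurable_rect.
move=> z; rewrite /= indic_rect /tensor /=.
rewrite (normrM c) (normrM (b z)) (normrM (haar R I z.1)) !haar_norm normrM.
have sI : Num.sqrt (len R I) != 0 by rewrite gt_eqF// sqrtr_gt0 len_gt0.
have sJ : Num.sqrt (len R J) != 0 by rewrite gt_eqF// sqrtr_gt0 len_gt0.
rewrite [`|c|]ger0_norm; last by rewrite mulr_ge0 ?sqrtr_ge0.
rewrite ger0_norm; last by rewrite !indicE mulr_ge0.
set i := \1__ _; set j := \1__ _; rewrite le_eqVlt; apply/orP; left; apply/eqP.
by rewrite /c; field; rewrite sI sJ.
Qed.

Lemma even_itv_scale I : (exists k : int, scale I = 2 * k) -> even_itv R I.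
Proof. by move=> [k hk]; apply/asboolP; exists k; rewrite /len hk. Qed.

(* L is a child of an even interval K, and A lies in the other child of K. *)
Lemma neighbour A : exists L (c : R),
  [/\ (forall x, itv R A x -> ~ itv R L x),
      (forall x, itv R A x -> @coshift_haar R L x = c)
    & 1 <= 4 * len R A * c ^+ 2].
Proof.
(* [B] is the child of [K] on the side of [A], either [A] itself or its parent; hence $|K|\le4|A|$,
   while $c^2=1/|K|$. The sign of $c$ is always negative because [B] and [L] are opposite halves. *)
have key (B K : dyadic) : parent B = K -> even_itv R K -> sub_itv A B ->
    len R B <= 2 * len R A -> exists L (c : R),
    [/\ (forall x, itv R A x -> ~ itv R L x),
      (forall x, itv R A x -> @coshift_haar R L x = c)
    & 1 <= 4 * len R A * c ^+ 2].
  move=> BK eK AB lBA; have lB : len R B = len R K / 2.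
    by rewrite -(childP B) BK; case: ifP => _; rewrite ?len_right ?len_left.
  pose L := if is_right B then left_half K else right_half K.
  have pL : parent L = K.
    by rewrite /L; case: ifP => _; rewrite ?parent_left ?parent_right.
  exists L, (- (Num.sqrt (len R K))^-1); split.
  - move=> x /(sub_itv_subset AB); rewrite -(childP B) BK /L.
    by case: ifP => _ h h'; [exact: children_disjoint h h'|exact: children_disjoint h' h].
  - move=> x /(sub_itv_subset AB); rewrite /coshift_haar pL eK -(childP B) BK /L.
    case: ifP => _; rewrite ?is_right_left ?is_right_right mul1r.
      by move/haar_right ->; rewrite mulN1r.
    by move/haar_left ->; rewrite mul1r.
  - rewrite sqrrN exprVn sqr_sqrtr ?(ltW (len_gt0 _ _))//.
    by rewrite ler_pdivlMr ?len_gt0// mul1r; move: lBA; rewrite lB; lra.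
have lA := len_gt0 R A.
have lP : len R (parent A) = 2 * len R A.
  by rewrite -{2}(childP A); case: ifP => _; rewrite ?len_right ?len_left; field.
have [k hk] : exists k : int, scale A - 1 = 2 * k \/ scale A - 2 = 2 * k.
  by exists ((scale A - 1) %/ 2)%Z; lia.
case: hk => hk.
  apply: (key A (parent A)) => //; last lra.
    by apply: even_itv_scale; exists k.
  by exists 0%N.
apply: (key (parent A) (parent (parent A))) => //; last by rewrite lP.
  by apply: even_itv_scale; exists k; rewrite /=; lia.
by exists 1%N.
Qed.

Section Operator.
Variables (T : (line R -> R) -> (line R -> R)) (TT : (plane R -> R) -> (plane R -> R)).
Hypothesis hT : dyadic_shift T.
Hypothesis hTT : tensor_square T TT.

Let hT1 : L2_operator mu1 T. Proof. by case: hT. Qed.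

(** Climbing from [D] to [A]: at each step $1_D$ is half the indicator of its parent plus a Haar
    term of the parent, and the shift of that Haar term stays inside [A], away from [L]. *)
Lemma shift_itv D A L : sub_itv D A -> (forall x, itv R A x -> ~ itv R L x) ->
  ae_eq mu1 setT (fun x => T (\1_(itv R D)) x * haar R L x)
    (fun x => len R D / len R A * (T (\1_(itv R A)) x * haar R L x)).
Proof.
move=> [n]; elim: n D => [|n IH] D; rewrite ?iterSr /=.
  by move=> -> _; apply: aeW => x _; rewrite mulfV ?mul1r// len_neq0.
move=> hn AL; pose P := parent D.
pose c : R := (if is_right D then 1 else -1) / 2 * Num.sqrt (len R P).
have lP : len R P = 2 * len R D.
  by rewrite -(childP D) -/P; case: ifP => _; rewrite ?len_right ?len_left; field.
have IE : (\1_(itv R D) : line R -> R) =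
    (fun x => 2^-1 * \1_(itv R P) x + c * haar R P x).
  by apply/funext => x; rewrite (indic_parent D x).
have sc : sqint mu1 (fun x => c * haar R P x) by apply: sqintZ; exact: sqint_haar.
have l1 := operator_lin hT1 2^-1 (sqint_itv R P) sc.
have l2 := operator_lin hT1 c (sqint_haar R P) (sqint0 mu1).
have e0 : (fun x => c * haar R P x + 0) = (fun x => c * haar R P x).
  by apply/funext => x; rewrite addr0.
rewrite e0 in l2; have l3 := IH _ hn AL; have l4 := shift_haarE hT P.
have l5 := operator0 hT1.
rewrite -IE in l1.
near=> x => _.
rewrite (near l1 x _ I)// (near l2 x _ I)// (near l4 x _ I)// (near l5 x _ I)//.
rewrite addr0 mulrDl -mulrA (near l3 x _ I)// -/P lP.
have -> : c * @shift_haar R P x * haar R L x = 0.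
  have [Lx|nL] := pselect (itv R L x); last by rewrite (haar_out nL) mulr0.
  have nP : ~ itv R P x.
    by move=> Px; apply: (AL x) => //; apply: (@sub_itv_subset P) => //; exists n.
  rewrite /shift_haar (@haar_out _ (left_half P)); last by move=> /itv_left.
  by rewrite (@haar_out _ (right_half P)) ?subrr ?mulr0 ?mul0r// => /itv_right.
by rewrite addr0; field; rewrite len_neq0.
Unshelve. all: by end_near.
Qed.

Lemma steps_support Q (s : plane R -> R) z : steps Q s -> \1_(rect Q) z * s z = s z.
Proof.
move=> [l [hl ->]]; rewrite /itv_span /lin_tensor mulr_sumr big_seq [RHS]big_seq.
apply: eq_bigr => t /hl[h1 h2]; rewrite indic_rect /tensor.
have e I A (x : line R) : sub_itv I A ->
    \1_(itv R A) x * \1_(itv R I) x = \1_(itv R I) x :> R.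
  move=> IA; rewrite !indicE; have [Ix|nI] := pselect (itv R I x).
    by rewrite (mem_set Ix) (mem_set (sub_itv_subset IA Ix)) mulr1.
  by rewrite (memNset nI) mulr0.
by rewrite mulrCA mulrACA !e.
Qed.

Lemma ip_steps_rect Q l :
  (forall t, t \in l -> sub_itv t.2.1 Q.1 /\ sub_itv t.2.2 Q.2) ->
  ip mu2 (@itv_span R l) (\1_(rect Q)) =
  \sum_(t <- l) t.1 * (len R t.2.1 * len R t.2.2).
Proof.
move=> hl; have sI I J : sqint mu2 (tensor (\1_(itv R I)) (\1_(itv R J))).
  by apply: sqint_tensor; exact: sqint_itv.
rewrite ip_suml => [|t|]; [|exact: sqintZ|exact: sqint_rect].
rewrite big_seq [RHS]big_seq; apply: eq_bigr => t tl.
rewrite ipZl//; last exact: sqint_rect.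
congr (_ * _); rewrite -[RHS](Rintegral_rect R t.2); apply: eq_Rintegral => z _.
have [h1 h2] := hl t tl.
by rewrite mulrC (steps_support _ (steps_itv R h1 h2)) indic_rect.
Qed.

(* Off A all the T 1_I with I inside A are proportional, so that TT s is
   determined on L x L' by the mean of s. *)
Lemma shift_steps A A' L L' (s : plane R -> R) :
  (forall x, itv R A x -> ~ itv R L x) -> (forall x, itv R A' x -> ~ itv R L' x) ->
  steps (A, A') s -> ip mu2 s (\1_(rect (A, A'))) = 0 ->
  ae_eq mu2 setT (fun z => TT s z * tensor (haar R L) (haar R L') z) (fun=> 0).
Proof.
move=> AL AL' [l [hl ->]]; rewrite ip_steps_rect// => s0.
pose V I J : plane R -> R := tensor (fun x => T (\1_(itv R I)) x * haar R L x)
  (fun x => T (\1_(itv R J)) x * haar R L' x).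
have e1 : ae_eq mu2 setT (TT (itv_span l)) (fun z => \sum_(t <- l) t.1 *
    tensor (T (\1_(itv R t.2.1))) (T (\1_(itv R t.2.2))) z).
  apply: (operator_sum hTT.1 l (F := fun i => tensor (\1_(itv R i.1)) (\1_(itv R i.2)))
    (G := fun i => tensor (T (\1_(itv R i.1))) (T (\1_(itv R i.2))))) => i.
    by apply: sqint_tensor; exact: sqint_itv.
  by case: hTT => _; apply; apply/LfunE; exact: sqint_itv.
have e2 t : t \in l -> ae_eq mu2 setT (V t.2.1 t.2.2)
    (fun z => len R t.2.1 * len R t.2.2 / (len R A * len R A') * V A A' z).
  move=> /hl[/= h1 h2].
  have := ae_eq_tensor (shift_itv h1 AL) (shift_itv h2 AL').
  apply: filterS => z h /h; rewrite /V => ->; rewrite /tensor.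
  by field; rewrite !len_neq0.
have e3 : ae_eq mu2 setT (fun z => \sum_(t <- l) t.1 * V t.2.1 t.2.2 z)
   (fun z => \sum_(t <- l) t.1 * (len R t.2.1 * len R t.2.2 / (len R A * len R A') * V A A' z)).
  elim: l e2 {hl s0 e1} => [|t l IH] e2.
    by apply: aeW => z _; rewrite !big_nil.
  have h1 := e2 t (mem_head _ _).
  have h2 := IH (fun t' h => e2 t' (mem_behead (s := t :: l) h)).
  near=> z => _; rewrite !big_cons (near h1 z _ I)// (near h2 z _ I)//.
near=> z => _; rewrite (near e1 z _ I)// mulr_suml.
transitivity (\sum_(t <- l) t.1 * V t.2.1 t.2.2 z).
  by apply: eq_bigr => t _; rewrite /V /tensor; ring.
rewrite (near e3 z _ I)//.
transitivity ((\sum_(t <- l) t.1 * (len R t.2.1 * len R t.2.2)) *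
  (V A A' z / (len R A * len R A'))).
  by rewrite mulr_suml; apply: eq_bigr => t _; ring.
by rewrite s0 mul0r.
Unshelve. all: by end_near.
Qed.

Section Symbol.
Variables (b : plane R -> R) (C : R).
Hypothesis mb : measurable_fun setT b.
Hypothesis hb : commutator_L2_bounded TT b.
Hypothesis hC : forall f, f \in Lfun mu2 2%:E -> b \* f \in Lfun mu2 2%:E ->
  (norm2 mu2 (commutator TT b f) <= C%:E * norm2 mu2 f)%E.

Let lb : locsqint b := locsqint_commutator mb hb.

(** The assumed inequality makes the norm of the commutator finite, which supplies the integrability
    that real-valued inner products require. *)
Lemma commutator_sqint f : sqint mu2 f -> sqint mu2 (fun z => b z * f z) ->
  sqint mu2 (commutator TT b f) /\
  ip mu2 (commutator TT b f) (commutator TT b f) <= C ^+ 2 * ip mu2 f f.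
Proof.
move=> sf sbf; have sTf := operator_sqint hTT.1 sf.
have sTbf := operator_sqint hTT.1 sbf.
have mF : measurable_fun setT (commutator TT b f).
  apply: measurable_funB; first by case: sTbf.
  by apply: measurable_funM => //; case: sTf.
have h := hC (iffRL (LfunE _ _) sf) (iffRL (LfunE _ _) sbf).
have sF : sqint mu2 (commutator TT b f).
  apply/LfunE; rewrite inE; apply/andP; split; rewrite inE//= /finite_norm.
  change (norm2 mu2 (commutator TT b f) < +oo)%E.
  by apply: le_lt_trans h _; rewrite (norm2_sqint sf) -EFinM ltry.
by split => //; exact: norm2_le.
Qed.

Lemma steps_pairing A A' (s : plane R -> R) : steps (A, A') s ->
  ip mu2 s (\1_(rect (A, A'))) = 0 ->
  ip mu2 (fun z => b z * s z) (\1_(rect (A, A'))) ^+ 2 <=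
  16 * C ^+ 2 * area R (A, A') * ip mu2 s s.
Proof.
move=> Ss s0; have [ss sbs] := steps_admissible lb Ss.
have [L [c [AL cL c1]]] := neighbour A; have [L' [c' [AL' cL' c1']]] := neighbour A'.
have [sF FC] := commutator_sqint ss sbs.
set F := commutator TT b s in sF FC.
pose g : plane R -> R := tensor (haar R L) (haar R L').
have sg : sqint mu2 g by apply: sqint_tensor; exact: sqint_haar.
have gg : ip mu2 g g = 1.
  by rewrite ip_tensor ?ip_haar ?eqxx ?mulr1//; exact: sqint_haar.
have sTbs := operator_sqint hTT.1 sbs.
have sbT : sqint mu2 (fun z => b z * TT s z).
  have := sqintB sTbs sF; congr sqint; apply/funext => z.
  by rewrite /F /commutator /=; ring.
have z0 : ip mu2 (fun z => b z * TT s z) g = 0.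
  rewrite -(ip0l mu2 (cst 1 : plane R -> R)); congr fine; apply: ae_eq_integral => //.
  - by apply/measurable_EFinP; apply: measurable_funM; [case: sbT|case: sg].
  - by apply/measurable_EFinP; apply: measurable_funM.
  - apply: filterS (shift_steps AL AL' Ss s0) => z h /h hz.
    by rewrite -mulrA hz mulr0 mul0r.
(* $\mathbf T$ is moved onto [g], whose image under the adjoint is the constant [c * c'] on the
   rectangle that carries [s]. *)
have E : ip mu2 F g = c * c' * ip mu2 (fun z => b z * s z) (\1_(rect (A, A'))).
  rewrite [LHS](ipBl sTbs sbT sg) z0 subr0.
  have -> : g = haar_span [:: (1, (L, L'))].
    by apply/funext => z; rewrite /haar_span /lin_tensor big_seq1 mul1r.
  rewrite (adjoint_shift hT hTT _ sbs) -ipZr//; last exact: sqint_rect.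
  apply: eq_Rintegral => z _; rewrite -(steps_support z Ss) /lin_tensor big_seq1 mul1r.
  rewrite /tensor indic_rect /tensor /= !indicE.
  have [Az|nA] := pselect (itv R A z.1); last first.
    by rewrite (memNset nA) !(mul0r, mulr0).
  have [Az'|nA'] := pselect (itv R A' z.2); last first.
    by rewrite (memNset nA') !(mul0r, mulr0).
  by rewrite (mem_set Az) (mem_set Az') cL// cL'// !mulr1.
have cs := CauchySchwarz_ip sF sg; rewrite gg mulr1 E exprMn in cs.
have {cs FC} h := le_trans cs FC.
set x := ip _ _ (\1_(rect (A, A'))) ^+ 2 in h *.
have x0 : 0 <= x by exact: sqr_ge0.
have a0 := area_gt0 R (A, A').
have c4 : 1 <= 16 * area R (A, A') * (c * c') ^+ 2.
  have := ler_pM ler01 ler01 c1 c1'; rewrite mulr1 => hh; apply: (le_trans hh).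
  by rewrite /area /= le_eqVlt; apply/orP; left; apply/eqP; ring.
apply: (@le_trans _ _ (16 * area R (A, A') * (c * c') ^+ 2 * x)).
  by rewrite -{1}[x]mul1r ler_wpM2r.
rewrite -mulrA.
have -> : 16 * C ^+ 2 * area R (A, A') * ip mu2 s s =
  16 * area R (A, A') * (C ^+ 2 * ip mu2 s s) by ring.
by rewrite ler_pM2l// mulr_gt0.
Qed.

Lemma commutator_oscillation : bounded_oscillation b (64 * C ^+ 2 + 1).
Proof.
split => // -[A A']; set Q := (A, A'); set m := mean b Q.
have a0 := area_gt0 R Q.
have s1 := sqint_rect R Q; have [_ sb] := lb.
pose F (z : plane R) := \1_(rect Q) z * (b z - m).
have sF : sqint mu2 F by exact: (locsqintB lb (locsqint_cst m)).2.
have -> : \int[mu2]_z (\1_(rect Q) z * (b z - m) ^+ 2) = ip mu2 F F.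
  by apply: eq_Rintegral => z _; rewrite /F mulrACA indic_idem -expr2.
(* [dual_bound] is used with constant $\frac12$: the pairing estimate $x^2\le Dy$, with
   $D=16C^2|Q|$, yields $x\le\frac12(D+y)$. *)
apply: (@le_trans _ _ (16 * 2^-1 ^+ 2 * (16 * C ^+ 2 * area R Q))); last first.
  have -> : 16 * 2^-1 ^+ 2 * (16 * C ^+ 2 * area R Q) = 64 * C ^+ 2 * area R Q :> R.
    by field.
  by rewrite (mulrDl (64 * C ^+ 2) 1) mul1r lerDl ltW.
apply: (@dual_bound _ _ _ mu2 (steps Q)) => //.
- by apply: mulr_ge0; [apply: mulr_ge0 => //; exact: sqr_ge0|exact: ltW].
- by move=> g /(steps_admissible lb)[].
- exact: stepsZ.
- move=> g Sg; have [sg sbg] := steps_admissible lb Sg.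
  pose mg := ip mu2 g (\1_(rect Q)) / area R Q.
  (* Removing the mean of [g] meets the hypothesis of [steps_pairing] and does not increase the
     norm; pairing [g0] with [b] is the same as pairing [g] with [b - m] on [Q]. *)
  pose g0 (z : plane R) := g z - mg * \1_(rect Q) z.
  have S1 : steps Q (\1_(rect Q) : plane R -> R).
    by rewrite indic_rect; apply: steps_itv; exists 0%N.
  have sbQ : sqint mu2 (fun z => b z * \1_(rect Q) z).
    by have [] := steps_admissible lb S1.
  have S0 : steps Q g0.
    have := stepsD Sg (stepsZ (- mg) S1); congr steps.
    by apply/funext => z; rewrite mulNr.
  have g00 : ip mu2 g0 (\1_(rect Q)) = 0.
    rewrite ipBl//; last exact: sqintZ.
    rewrite ipZl// ip_rect /mg; field; exact: area_neq0.
  have := steps_pairing S0 g00.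
  have -> : ip mu2 (fun z => b z * g0 z) (\1_(rect Q)) = ip mu2 F g.
    have -> : (fun z => b z * g0 z) = (fun z => b z * g z - mg * (b z * \1_(rect Q) z)).
      by apply/funext => z; rewrite /g0; ring.
    rewrite ipBl//; last exact: sqintZ.
    rewrite ipZl//.
    have -> : ip mu2 (fun z => b z * \1_(rect Q) z) (\1_(rect Q)) = area R Q * m.
      rewrite /m meanE mulVKf ?area_neq0//; apply: eq_Rintegral => z _.
      by rewrite -mulrA indic_idem mulrC.
    have -> : ip mu2 (fun z => b z * g z) (\1_(rect Q)) =
        ip mu2 (fun z => \1_(rect Q) z * b z) g.
      by apply: eq_Rintegral => z _; ring.
    have -> : ip mu2 F g = ip mu2 (fun z => \1_(rect Q) z * b z) g - m * ip mu2 (\1_(rect Q)) g.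
      rewrite -ipZl// -ipBl//; last exact: sqintZ.
      by apply: eq_ip => // z; rewrite /F; ring.
    rewrite (ipC _ (\1_(rect Q))) /mg; field; exact: area_neq0.
  have ng : ip mu2 g0 g0 <= ip mu2 g g.
    rewrite ipBB//; last exact: sqintZ.
    rewrite ipZr// ipZZ// ip_rect.
    have -> : ip mu2 g (\1_(rect Q)) = mg * area R Q.
      by rewrite /mg divfK ?area_neq0.
    have := mulr_ge0 (sqr_ge0 mg) (ltW a0); lra.
  set D := 16 * C ^+ 2 * area R Q.
  have D0 : 0 <= D.
    by apply: mulr_ge0; [apply: mulr_ge0 => //; exact: sqr_ge0|exact: ltW].
  move=> hp; have {hp} hp := le_trans hp (ler_wpM2l D0 ng).
  set x := ip mu2 F g in hp *; set y := ip mu2 g g in hp *.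
  have y0 : 0 <= y by exact: ip_ge0.
  have h2 : x ^+ 2 <= ((D + y) / 2) ^+ 2.
    apply: (le_trans hp); have := sqr_ge0 (D - y); rewrite !expr2; lra.
  have [x0|/ltW x0] := leP x 0.
    by apply: (le_trans x0); rewrite mulr_ge0// addr_ge0.
  by rewrite mulrC; move: h2; rewrite ler_pXn2r// nnegrE// divr_ge0// addr_ge0.
- move=> eps eps0.
  have aF : admissible (cst 0 : plane R -> R) F.
    split => //; have := sqint0 mu2; congr sqint.
    by apply/funext => z; rewrite mul0r.
  (* Only plain $L^2$ approximation is wanted here, so the weight is taken with symbol 0. *)
  have [_ /(_ _ eps0) [g Sg hg]] := approximable_steps (locsqint_cst 0) Q aF.
  exists g; split => //; apply: le_lt_trans hg.
  have -> : (fun z => \1_(rect Q) z * F z - g z) = (fun z => F z - g z).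
    by apply/funext => z; rewrite /F mulrA indic_idem.
  by rewrite lerDl ip_ge0.
Qed.

End Symbol.

Lemma commutator_bmod b : measurable_fun setT b ->
  commutator_L2_bounded TT b -> bmod b.
Proof.
move=> mb hb; apply/(bmodP mb); have [_ [C hC]] := hb.
exists (64 * C ^+ 2 + 1); first by rewrite ltr_wpDl// mulr_ge0 ?sqr_ge0.
exact: commutator_oscillation hC.
Qed.

End Operator.

End Lower.

Unset Implicit Arguments.

Theorem theorem4p1 (R : realType)
    (T : (line R -> R) -> (line R -> R))
    (TT : (plane R -> R) -> (plane R -> R))
    (b : plane R -> R)
    (hT : dyadic_shift T)
    (hTT : tensor_square T TT)
    (hb : measurable_fun setT b) :
  commutator_L2_bounded TT b <-> bmod b.
Proof.
split; first exact: (commutator_bmod hT hTT hb).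
exact: (bmod_commutator hT hTT hb).
Qed.
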